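(* Let $\lambda>0$ and let $k\ge 2$ be an integer. For every sufficiently large $n$ let $p=p_n\in(0,1]$ be given by $\binom{n-1}{k-1}p=\lambda$, and let $H_n$ be the $k$-uniform random hypergraph $H(n,k,p)$, the $H_n$ being realized on a common probability space. Then, almost surely, the $1$-set local weak limit of $(H_n)$ is $\nu_{k-1,\lambda}$; that is, almost surely, $$U_1(H_n)\rightsquigarrow \nu_{k-1,\lambda}\qquad\text{as } n\to\infty .$$
   Context: Random hypergraph: $H(n,k,p)$ is the random hypergraph with vertex set $[n]=\{1,\dots,n\}$ in which each $k$-element subset of $[n]$ is included as a hyperedge with probability $p$, independently. Line graph: for a $k$-uniform hypergraph $H$ on $[n]$ with hyperedge set $E(H)$, and $1\le r\le k-1$, the $r$-set weighted line graph $G_r(H)$ has as vertices all $r$-element subsets of $[n]$; two distinct $r$-sets $S_1,S_2$ are adjacent iff some $e\in E(H)$ satisfies $S_1,S_2\subset e$, and then the edge has weight $w_{r,H}(S_1,S_2)=|\{e\in E(H): S_1,S_2\subset e\}|$. Rooted weighted graphs: $\mathbb G^*_w$ is the set of isomorphism classes of connected locally finite weighted graphs $(G,w,o)$ with a root vertex $o$ (edge weights real and symmetric; isomorphisms preserve edges, non-edges, weights and the root). For an integer $t\ge 0$, $(G,o)_t$ is the weighted subgraph induced on the vertices at graph distance at most $t$ from $o$, rooted at $o$. The local topology on $\mathbb G^*_w$ is induced by the metric $m((G,u),(G',v))=1/(1+T)$, with $T=\sup\{t\ge 0:(G,u)_t\cong(G',v)_t\}$. $\rightsquigarrow$ denotes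 weak convergence of Borel probability measures on $(\mathbb G^*_w,m)$, i.e. convergence of integrals of all bounded continuous functions. For a finite weighted graph $(G,w)$ with vertex set $V$, $U(G,w)=\frac1{|V|}\sum_{o\in V}\delta_{[(G(o),w,o)]}$, where $G(o)$ is the connected component of $o$. Put $U_r(H)=U(G_r(H))$. If $U_r(H_n)\rightsquigarrow\nu$, then $\nu$ is called the $r$-set local weak limit of $(H_n)$. $d$-block Galton–Watson measure $\nu_{d,\lambda}$: the law on $\mathbb G^*_w$ of the random rooted graph, with all edge weights equal to $1$, constructed from a root $o$ as follows. Independently, every vertex (the root included) has a Poisson$(\lambda)$ number of $d$-block children; each $d$-block child is a set of $d$ new vertices which together with their parent form a $(d+1)$-clique (complete graph on $d+1$ vertices); each of these new vertices then reproduces independently in the same way. There are no other edges. *)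

(* Defs.v *)
From HB Require Import structures.
From mathcomp Require Import all_boot all_order all_algebra.
From mathcomp Require Import all_classical all_reals all_analysis
  measurable_realfun.
Set Implicit Arguments. Unset Strict Implicit. Unset Printing Implicit Defensive.
Import Order.TTheory GRing.Theory Num.Theory.
Import numFieldTopology.Exports.
Local Open Scope classical_set_scope.
Local Open Scope ring_scope.
Local Open Scope quotient_scope.

(* A simple graph with real edge weights whose vertices are the elements of
   [vset]; the values of [wgt] off the edges are irrelevant. *)
Record wgraph (R : realType) (V : Type) := WGraph {
  vset : {pred V};
  adj : rel V;
  wgt : V -> V -> R;
  adj_vset : forall u v, adj u v -> u \in vset;
  adj_irr : irreflexive adj;
  adj_sym : symmetric adj;
  wgt_sym : forall u v, adj u v -> wgt u v = wgt v u }.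

Section graphs.
Context {R : realType}.

Section one_graph.
Context {V : Type}.
Implicit Types (G : wgraph R V) (u v o : V).

Definition walk G u v (p : seq V) := path (adj G) u p /\ last u p = v.

Definition gdist G u v : \bar R :=
  ereal_inf [set (size p)%:R%:E | p in [set p | walk G u v p]].

Definition locally_finite G := forall v, finite_set [set u | adj G v u].

Definition connected_from G o :=
  o \in vset G /\ forall v, v \in vset G -> exists p, walk G o v p.

Section induced.
Variables (G : wgraph R V) (A : {pred V}).
Let vs := [pred v | (v \in vset G) && (v \in A)].
Let ad := [rel u v | [&& u \in A, v \in A & adj G u v]].
Let ad_vs u v : ad u v -> u \in vs.
Proof. by move=> /and3P[uA _ uv]; rewrite inE /= (adj_vset uv). Qed.
Let ad_irr : irreflexive ad.
Proof. by move=> u /=; rewrite adj_irr !andbF. Qed.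
Let ad_sym : symmetric ad.
Proof. by move=> u v /=; rewrite adj_sym andbCA. Qed.
Let wg_sym u v : ad u v -> wgt G u v = wgt G v u.
Proof. by move=> /and3P[_ _ uv]; exact: wgt_sym. Qed.
Definition induced : wgraph R V := WGraph ad_vs ad_irr ad_sym wg_sym.
End induced.

Definition rball G o (t : nat) : wgraph R V :=
  induced G [pred v | `[< (gdist G o v <= t%:R%:E)%E >]].

Definition component G o : wgraph R V :=
  induced G [pred v | `[< exists p, walk G o v p >]].

Lemma gdist_leP G u v (t : nat) :
  (gdist G u v <= t%:R%:E)%E <-> exists2 p, walk G u v p & (size p <= t)%N.
Proof.
split=> [le_t|[p Gp pt]]; last first.
  apply: (@le_trans _ _ (size p)%:R%:E); last by rewrite lee_fin ler_nat.
  by apply: ereal_inf_lbound; exists p.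
have : (gdist G u v < t.+1%:R%:E)%E.
  by apply: le_lt_trans le_t _; rewrite lte_fin ltr_nat.
move=> /ereal_inf_lt[_ [p Gp <-]]; rewrite lte_fin ltr_nat ltnS => pt.
by exists p.
Qed.


Lemma walk_cat G u v w p q : walk G u v p -> walk G v w q ->
  walk G u w (p ++ q).
Proof. by case=> pp <- [pq <-]; split; rewrite ?cat_path ?pp// last_cat. Qed.

Lemma walk_vset G u v p : u \in vset G -> walk G u v p ->
  all (mem (vset G)) p /\ v \in vset G.
Proof.
move=> uG [+ <-] {v}; elim: p u uG => //= x p IH u uG /andP[ux xp].
have xG : x \in vset G by move: ux; rewrite adj_sym; exact: adj_vset.
by case: (IH _ xG xp) => -> ->; rewrite xG.
Qed.

Lemma in_rball G o t v : (v \in vset (rball G o t)) <->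
  v \in vset G /\ exists2 p, walk G o v p & (size p <= t)%N.
Proof.
rewrite !inE; split=> [/andP[-> /asboolP/gdist_leP]//|[->] /gdist_leP h].
exact/asboolP.
Qed.

Lemma in_rballT G o t v p : o \in vset G -> walk G o v p -> (size p <= t)%N ->
  v \in vset (rball G o t).
Proof.
move=> oG Gp pt; apply/in_rball; split; last by exists p.
by case: (walk_vset oG Gp).
Qed.

Lemma adj_induced G (A : {pred V}) u v : u \in vset (induced G A) ->
  v \in vset (induced G A) -> adj (induced G A) u v = adj G u v.
Proof. by rewrite !inE /= => /andP[_ ->] /andP[_ ->]. Qed.

Lemma walk_induced G (A : {pred V}) u v p : walk (induced G A) u v p ->
  walk G u v p.
Proof. by move=> [pp vp]; split=> //; apply: sub_path pp => x y /and3P[]. Qed.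

Lemma walk_rball G o v p t : o \in vset G -> walk G o v p -> (size p <= t)%N ->
  walk (rball G o t) o v p.
Proof.
move=> oG; elim/last_ind: p v => [|p x IH] v.
  by move=> [_ <-] _; split.
rewrite size_rcons => Gp pt; case: (Gp); rewrite last_rcons => + xv.
rewrite rcons_path => /andP[pp px]; subst v.
have Gp' : walk G o (last o p) p by split.
have [bp bl] := IH _ Gp' (ltnW pt); split; last by rewrite last_rcons.
rewrite rcons_path bp adj_induced//; first exact: in_rballT Gp' (ltnW pt).
by apply: in_rballT Gp _ => //; rewrite size_rcons.
Qed.

End one_graph.

(* Rooted isomorphism: a bijection between the vertex sets preserving root,
   edges, non-edges and edge weights. *)
Definition is_riso {V W : Type} (G : wgraph R V) (o : V) (G' : wgraph R W)
    (o' : W) (f : V -> W) :=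
  [/\ set_bij [set` vset G] [set` vset G'] f, f o = o',
     {in vset G &, forall u v, adj G u v = adj G' (f u) (f v)} &
     {in vset G &, forall u v, adj G u v -> wgt G u v = wgt G' (f u) (f v)}].

Definition riso {V W : Type} (G : wgraph R V) (o : V) (G' : wgraph R W) (o' : W) :=
  exists f : V -> W, is_riso G o G' o' f.

Lemma riso_refl {V : Type} (G : wgraph R V) o : riso G o G o.
Proof.
by exists id; split=> //; split=> [x|x y _ _|x xG] //; exists x.
Qed.

Lemma riso_trans {V W X : Type} (G : wgraph R V) o (G' : wgraph R W) o'
  (G'' : wgraph R X) o'' : riso G o G' o' -> riso G' o' G'' o'' -> riso G o G'' o''.
Proof.
move=> [f [bf fo af wf]] [g [bg go ag wg]]; exists (g \o f).
have fV u : u \in vset G -> f u \in vset G' by move=> uG; case: bf => + _ _; apply.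
split=> /=.
- exact: set_bij_comp bf bg.
- by rewrite fo.
- by move=> u v uG vG; rewrite af// ag// fV.
- by move=> u v uG vG uv; rewrite wf// wg ?fV// -af.
Qed.

Lemma is_riso_inv {V W : Type} (G : wgraph R V) o (G' : wgraph R W) o' f :
  o \in vset G -> is_riso G o G' o' f ->
  exists g, [/\ is_riso G' o' G o g, {in vset G, cancel f g} &
                {in vset G', cancel g f}].
Proof.
move=> oG [[fV fI fS] fo af wf].
have /choice[g gP] y : exists x, y \in vset G' -> x \in vset G /\ f x = y.
  case: (boolP (y \in vset G')) => [yG|_]; last by exists o.
  by case: (fS y yG) => x xG xy; exists x.
have gf u : u \in vset G -> g (f u) = u.
  by move=> uG; apply: fI; rewrite ?inE //=; case: (gP _ (fV _ uG)).
have fg y : y \in vset G' -> f (g y) = y by case/gP.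
have gV y : y \in vset G' -> g y \in vset G by case/gP.
exists g; split=> //; split.
- split=> [y /gP[]//|x y xG yG e|x xG].
    by rewrite !inE /= in xG yG; rewrite -(fg _ xG) -(fg _ yG) e.
  by exists (f x); [exact: fV|exact: gf].
- by rewrite -fo gf.
- by move=> u v uG vG; rewrite af ?gV// !fg.
- move=> u v uG vG uv; rewrite wf ?gV// ?fg//.
  by rewrite af ?gV// !fg.
Qed.

Lemma riso_sym {V W : Type} (G : wgraph R V) o (G' : wgraph R W) o' :
  o \in vset G -> riso G o G' o' -> riso G' o' G o.
Proof. by move=> oG [f /(is_riso_inv oG)[g [? _ _]]]; exists g. Qed.

Lemma walk_map {V W : Type} (G : wgraph R V) (G' : wgraph R W) (f : V -> W) u v p :
  {in vset G &, forall u v, adj G u v = adj G' (f u) (f v)} ->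
  u \in vset G -> walk G u v p -> walk G' (f u) (f v) (map f p).
Proof.
move=> af uG [pp <-] {v}; split; last by rewrite last_map.
elim: p u uG pp => //= x p IH u uG /andP[ux xp].
have xG : x \in vset G by move: ux; rewrite adj_sym; exact: adj_vset.
by rewrite -af// ux IH.
Qed.


Lemma riso_rball {V W : Type} (G : wgraph R V) o (G' : wgraph R W) o' t :
  o \in vset G -> riso G o G' o' -> riso (rball G o t) o (rball G' o' t) o'.
Proof.
move=> oG [f fP]; have [g [[[gV _ _] go ag _] gf fg]] := is_riso_inv oG fP.
case: fP => [[fV fI fS] fo af wf].
have o'G : o' \in vset G' by rewrite -fo; exact: fV.
have fb v : v \in vset (rball G o t) -> f v \in vset (rball G' o' t).
  move=> /in_rball[vG [p Gp pt]].
  apply: (@in_rballT _ _ _ _ _ (map f p)) => //; last by rewrite size_map.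
  by rewrite -fo; exact: (walk_map af oG Gp).
have gb v : v \in vset (rball G' o' t) -> g v \in vset (rball G o t).
  move=> /in_rball[vG [p Gp pt]].
  apply: (@in_rballT _ _ _ _ _ (map g p)) => //; last by rewrite size_map.
  by rewrite -go; exact: (walk_map ag o'G Gp).
have sub u : u \in vset (rball G o t) -> u \in vset G by case/in_rball.
exists f; split=> //.
- split=> // [x y|y /= yb].
    by rewrite !inE /= => /sub xG /sub yG; apply: fI; rewrite inE.
  by exists (g y); [exact: gb|apply: fg; case/in_rball: yb].
- move=> u v ub vb; rewrite !adj_induced ?fb//.
  by apply: af; exact: sub.
- move=> u v ub vb; rewrite adj_induced// => uv /=.
  by apply: wf => //; exact: sub.
Qed.

Lemma riso_rball_rball {V : Type} (G : wgraph R V) o s t :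
  o \in vset G -> (s <= t)%N ->
  riso (rball (rball G o t) o s) o (rball G o s) o.
Proof.
move=> oG st; have ob : o \in vset (rball G o t) by apply: (@in_rballT _ _ _ _ _ [::]).
have E v : (v \in vset (rball (rball G o t) o s)) = (v \in vset (rball G o s)).
  apply/idP/idP => /in_rball[vb [p Gp ps]].
    by apply: (in_rballT oG _ ps); exact: walk_induced Gp.
  apply: (in_rballT ob _ ps); apply: walk_rball => //.
  exact: leq_trans ps st.
exists id; split=> //.
- split=> [x /=|x y _ _ //|x /=]; rewrite ?E// => xb.
  by exists x; rewrite /= ?E.
- move=> u v ub vb; rewrite adj_induced// [RHS]adj_induced -?E//.
  by rewrite adj_induced//; apply: (proj1 (proj1 (in_rball _ _ _ _) _)); eassumption.
Qed.

Lemma riso_rball_le {V W : Type} (G : wgraph R V) o (G' : wgraph R W) o' s t :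
  o \in vset G -> o' \in vset G' -> (s <= t)%N ->
  riso (rball G o t) o (rball G' o' t) o' ->
  riso (rball G o s) o (rball G' o' s) o'.
Proof.
move=> oG oG' st i.
have ob : o \in vset (rball G o t) by apply: (@in_rballT _ _ _ _ _ [::]).
have ob' : o \in vset (rball (rball G o t) o s) by apply: (@in_rballT _ _ _ _ _ [::]).
have j := riso_rball_rball oG st.
apply: riso_trans (riso_sym ob' j) _.
apply: riso_trans (riso_rball s ob i) _.
exact: riso_rball_rball.
Qed.

Record rgraph (V : Type) := RGraph {
  rg :> wgraph R V;
  root : V;
  rg_connected : connected_from rg root;
  rg_lf : locally_finite rg }.

Lemma root_vset V (g : rgraph V) : root g \in vset g.
Proof. by case: (rg_connected g). Qed.

Lemma root_rball V (g : rgraph V) t : root g \in vset (rball g (root g) t).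
Proof. by apply: (@in_rballT _ _ _ _ _ [::]) => //; exact: root_vset. Qed.

(* A connected locally finite graph is countable, so every isomorphism class
   has a representative with vertices in [nat], which makes the classes of
   [rgraph nat] a model of the set of all isomorphism classes. [relabel]
   moves a graph over a countable type to [nat] along [pickle]. *)
Section relabel.
Variables (V : countType) (g : rgraph V).
Let un (n : nat) : option V := pickle_inv n.
Let vs := [pred n | if un n is Some v then v \in vset g else false].
Let ad : rel nat := fun m n =>
  if un m is Some u then if un n is Some v then adj g u v else false else false.
Let wg m n : R :=
  if un m is Some u then if un n is Some v then wgt g u v else 0 else 0.
Let ad_vs u v : ad u v -> u \in vs.
Proof.
rewrite /ad inE; case: (un u) => // x; case: (un v) => // y; exact: adj_vset.
Qed.
Let ad_irr : irreflexive ad.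
Proof. by move=> u; rewrite /ad; case: (un u) => // x; exact: adj_irr. Qed.
Let ad_sym : symmetric ad.
Proof.
move=> u v; rewrite /ad; case: (un u) => [x|]; case: (un v) => [y|] //.
exact: adj_sym.
Qed.
Let wg_sym u v : ad u v -> wg u v = wg v u.
Proof.
rewrite /ad /wg; case: (un u) => // x; case: (un v) => // y; exact: wgt_sym.
Qed.
Let G := WGraph ad_vs ad_irr ad_sym wg_sym.

Lemma is_riso_pickle : is_riso g (root g) G (pickle (root g)) pickle.
Proof.
split=> //.
- split=> [x /= xg|x y _ _|n /=]; first by rewrite inE /un pickleK_inv.
    exact: (pcan_inj pickleK_inv).
  rewrite inE /un; case E: (pickle_inv n) => [v|//] vg; exists v => //.
  by have := @pickle_invK V n; rewrite E.
- by move=> u v _ _; rewrite /= /ad /un !pickleK_inv.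
- by move=> u v _ _ _; rewrite /= /wg /un !pickleK_inv.
Qed.

Let conn : connected_from G (pickle (root g)).
Proof.
case: is_riso_pickle => [[fV _ fS]] _ ap _; split; first exact: fV (root_vset g).
move=> n /fS[v vg <-]; case: (rg_connected g) => rV /(_ _ vg)[p gp].
by exists (map pickle p); exact: (walk_map ap rV gp).
Qed.

Let lf : locally_finite G.
Proof.
move=> m; case E : (un m) => [u|]; last first.
  by rewrite (_ : [set _ | _] = set0)// -subset0 => n /=; rewrite /ad E.
apply: (@sub_finite_set _ _ (pickle @` [set v | adj g u v])).
  move=> n /=; rewrite /ad E /un; case F: (pickle_inv n) => [v|//] uv.
  by exists v => //; have := @pickle_invK V n; rewrite F.
by apply: finite_image; exact: rg_lf.
Qed.

Definition relabel : rgraph nat := RGraph conn lf.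

End relabel.

HB.instance Definition _ := gen_eqMixin (rgraph nat).
HB.instance Definition _ := gen_choiceMixin (rgraph nat).

Definition rg_iso : rel (rgraph nat) :=
  fun g h => `[< riso g (root g) h (root h) >].

Lemma rg_iso_refl : reflexive rg_iso.
Proof. by move=> g; apply/asboolP; exact: riso_refl. Qed.

Lemma rg_iso_sym : symmetric rg_iso.
Proof.
by move=> g h; apply/asboolP/asboolP; apply: riso_sym; exact: root_vset.
Qed.

Lemma rg_iso_trans : transitive rg_iso.
Proof.
by move=> h g k /asboolP gh /asboolP hk; apply/asboolP; exact: riso_trans gh hk.
Qed.

Canonical rg_iso_equiv := EquivRel rg_iso rg_iso_refl rg_iso_sym rg_iso_trans.

Definition Gstar := {eq_quot rg_iso_equiv}.

Lemma finite_rball (V : Type) (g : rgraph V) t :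
  finite_set [set v | v \in vset (rball g (root g) t)].
Proof.
have rg := root_vset g.
elim: t => [|t IH].
  apply: (@sub_finite_set _ _ [set root g]) => // v /in_rball[_ [[|//] [_ /= <-]]] //.
apply: (@sub_finite_set _ _ ([set root g] `|`
    \bigcup_(u in [set v | v \in vset (rball g (root g) t)]) [set v | adj g u v])).
  move=> v /in_rball[vg [p]]; elim/last_ind: p => [|p x _].
    by case=> _ /= <- _; left.
  case; rewrite rcons_path last_rcons size_rcons ltnS => /andP[pp px] <- pt.
  right; exists (last (root g) p) => //=.
  exact: (in_rballT rg (conj pp erefl) pt).
rewrite finite_setU; split => //.
by apply: bigcup_finite => // u _; exact: rg_lf.
Qed.

Lemma ultra_finite_cover (T : choiceType) (U : set_system nat) (B : set T)
    (A : T -> set nat) : UltraFilter U -> finite_set B ->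
  U (\bigcup_(w in B) A w) -> exists2 w, B w & U (A w).
Proof.
move=> UU /finite_seqP[s ->]; elim: s => [|x s IH].
  by move=> /filter_ex[n []].
move=> UA.
have [Ax|nAx] := in_ultra_setVsetC (A x) UU.
  by exists x => //=; rewrite mem_head.
have [|w sw Aw] := IH; last by exists w => //=; rewrite in_cons sw orbT.
apply: filterS (filterI UA nAx) => n [[w /=]]; rewrite in_cons.
by case/orP=> [/eqP->//|ws wn _]; exists w.
Qed.

Lemma riso_rballs (V W : choiceType) (g : rgraph V) (h : rgraph W) :
  (forall t, riso (rball g (root g) t) (root g) (rball h (root h) t) (root h)) ->
  riso g (root g) h (root h).
Proof.
move=> /choice[f fP].
have /choice[f' f'P] t := is_riso_inv (root_rball g t) (fP t).
have [U [UU Uoo]] := @ultraFilterLemma _ \oo _.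
have UP (A : set nat) s : (forall t, (s <= t)%N -> A t) -> U A.
  by move=> sA; apply: Uoo; exists s.
have ballV (X : choiceType) (k : rgraph X) v : v \in vset k ->
    exists s, forall t, (s <= t)%N -> v \in vset (rball k (root k) t).
  case: (rg_connected k) => rV c vg; have [p gp] := c _ vg.
  by exists (size p) => t pt; exact: (in_rballT rV gp pt).
have fV t v : v \in vset (rball g (root g) t) -> f t v \in vset (rball h (root h) t).
  by case: (fP t) => [[+ _ _] _ _ _]; apply.
have fV' t v : v \in vset (rball h (root h) t) -> f' t v \in vset (rball g (root g) t).
  by case: (f'P t) => [[[+ _ _] _ _ _] _ _]; apply.
have lim (X Y : choiceType) (k : rgraph X) (l : rgraph Y) (F : nat -> X -> Y) v :
    (forall t, is_riso (rball k (root k) t) (root k) (rball l (root l) t) (root l) (F t)) ->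
    v \in vset k -> exists w, U [set t | F t v = w].
  move=> FP vk; have [s sP] := ballV _ _ _ vk.
  have [] := @ultra_finite_cover Y U [set w | w \in vset (rball l (root l) s)]
    (fun w => [set t | F t v = w]) UU; first exact: finite_rball.
  - apply: (UP _ s) => t st /=; exists (F t v) => //=.
    have /in_rball[_ [p kp ps]] := sP s (leqnn s).
    have kp' := walk_rball (root_vset k) kp (leq_trans ps st).
    have [_ Fo Fa _] := FP t.
    have := walk_map Fa (root_rball k t) kp'; rewrite Fo => wl; have lp := walk_induced wl.
    by apply: (in_rballT (root_vset l) lp); rewrite size_map.
  - by move=> w _ Uw; exists w.
have /choice[F FE] v : exists w, v \in vset g -> U [set t | f t v = w].
  have [vg|_] := boolP (v \in vset g); last by exists (root h).
  by have [w Uw] := lim _ _ _ _ _ _ fP vg; exists w.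
have big v : v \in vset g -> U [set t | v \in vset (rball g (root g) t)].
  by move=> /ballV[s sP]; apply: UP sP.
have two u v : u \in vset g -> v \in vset g ->
    exists t, [/\ f t u = F u, f t v = F v, u \in vset (rball g (root g) t) &
      v \in vset (rball g (root g) t)].
  move=> ug vg; have [t [[/= ? ?] [? ?]]] := filter_ex
    (filterI (filterI (FE _ ug) (FE _ vg)) (filterI (big _ ug) (big _ vg))).
  by exists t.
have sub t v : v \in vset (rball h (root h) t) -> v \in vset h by case/in_rball.
exists F; split.
- split.
  + by move=> v /= vg; have [t [<- _ /fV/sub]] := two _ _ vg vg.
  + move=> u v; rewrite !inE /= => ug vg; have [t [<- <- ub vb]] := two _ _ ug vg.
    by case: (fP t) => [[_ fI _] _ _ _]; apply: fI; rewrite inE.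
  + move=> w /= wh.
    have [v Uv] := lim _ _ _ _ _ _ (fun t => let: And3 a _ _ := f'P t in a) wh.
    have [s sP] := ballV _ _ _ wh.
    have Us : U [set t | f' t w = v /\ w \in vset (rball h (root h) t)].
      by apply: filterI => //; exact: UP sP.
    have vg : v \in vset g.
      by have [t [<- /fV'/in_rball[]]] := filter_ex Us.
    exists v => //; have [t [[ft1 wb] ft2]] := filter_ex (filterI Us (FE _ vg)).
    by rewrite -ft2 -ft1; case: (f'P t) => _ _; apply.
- have [t [<- _ _ _]] := two _ _ (root_vset g) (root_vset g).
  by case: (fP t).
- move=> u v ug vg; have [t [<- <- ub vb]] := two _ _ ug vg.
  case: (fP t) => _ _ + _; move=> /(_ u v ub vb).
  by rewrite !adj_induced// fV.
- move=> u v ug vg uv; have [t [<- <- ub vb]] := two _ _ ug vg.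
  by case: (fP t) => _ _ _ /(_ u v ub vb); rewrite adj_induced//; apply.
Qed.

(* The set of radii at which the balls of two classes are isomorphic. It is
   computed on representatives; see [agree_rclass] for the independence. *)
Definition agree (x y : Gstar) : set nat :=
  [set t | riso (rball (repr x) (root (repr x)) t) (root (repr x))
                (rball (repr y) (root (repr y)) t) (root (repr y))].

(* 1 / (1 + T) with T = sup (agree x y) in the extended reals: agree x y always
   contains 0 ([agree0]), and the value is 0 when T = +oo. *)
Definition local_dist (x y : Gstar) : R :=
  fine (1 + ereal_sup [set t%:R%:E | t in agree x y])^-1.


Lemma agree0 x y : agree x y 0%N.
Proof.
rewrite /agree /=; set g := repr x; set h := repr y.
have b (k : rgraph nat) v : (v \in vset (rball k (root k) 0)) = (v == root k).
  apply/idP/eqP => [/in_rball[_ [[|//] [_ /= <-]]]//|->]; exact: root_rball.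
exists (fun=> root h); split=> //.
- split=> [v _|u v|w] /=; first exact: root_rball.
    by move=> /set_mem /= + /set_mem /=; rewrite !b => /eqP-> /eqP->.
  by rewrite b => /eqP->; exists (root g) => //=; exact: root_rball.
- by move=> u v; rewrite !b => /eqP-> /eqP->; rewrite !adj_irr.
- by move=> u v; rewrite !b => /eqP-> /eqP->; rewrite adj_irr.
Qed.

Lemma agree_sym x y : agree x y `<=` agree y x.
Proof. by move=> t; apply: riso_sym; exact: root_rball. Qed.

Lemma agree_trans y x z : agree x y `&` agree y z `<=` agree x z.
Proof. by move=> t [xy yz]; exact: riso_trans xy yz. Qed.

Lemma agree_le x y s t : (s <= t)%N -> agree x y t -> agree x y s.
Proof. by move=> st; apply: riso_rball_le => //; exact: root_vset. Qed.

Lemma local_dist_ge0 x y : 0 <= local_dist x y.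
Proof.
rewrite fine_ge0// inve_ge0 adde_ge0// ereal_sup_ge//.
by exists 0; rewrite //=; exists 0%N => //; exact: agree0.
Qed.

Lemma local_distP x y :
  ((forall t, agree x y t) /\ local_dist x y = 0) \/
  (exists s, (forall t, agree x y t <-> (t <= s)%N) /\
             local_dist x y = s.+1%:R^-1).
Proof.
set T := ereal_sup [set t%:R%:E | t in agree x y] : \bar R.
have le_T t : agree x y t -> (t%:R%:E <= T)%E.
  by move=> xyt; apply: ereal_sup_ubound; exists t.
have [all|] := pselect (forall t, agree x y t).
  left; split=> //; rewrite /local_dist -/T (_ : T = +oo%E).
    by rewrite addey// invey.
  apply/eqP; rewrite -leye_eq leNgt; apply/negP => Toy.
  have T0 := le_T _ (all 0%N).
  have Tf : T \is a fin_num by rewrite ge0_fin_numE.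
  have := le_T _ (all (Num.truncn (fine T)).+1).
  by rewrite -[in leRHS](fineK Tf) lee_fin leNgt truncnS_gt.
move=> /existsNP nall; right.
have ex : exists n, ~~ `[< agree x y n >].
  by case: nall => n ?; exists n; apply/asboolPn.
case: (ex_minnP ex) => -[/asboolPn[]|s /asboolPn ns smin]; first exact: agree0.
have agE t : agree x y t <-> (t <= s)%N.
  split=> [a|ts].
    by rewrite leqNgt; apply/negP => st; apply: ns; exact: agree_le a.
  by apply: contrapT => /asboolPn /smin; rewrite ltnNge ts.
exists s; split=> //; rewrite /local_dist -/T.
have -> : T = s%:R%:E.
  apply/eqP; rewrite eq_le le_T ?agE// andbT; apply: ge_ereal_sup.
  by move=> _ [t /agE ts <-]; rewrite lee_fin ler_nat.
by rewrite -EFinD addrC natr1 inver pnatr_eq0.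
Qed.

Lemma local_dist_le x y t : local_dist x y <= t.+1%:R^-1 <-> agree x y t.
Proof.
have [[all ->]|[s [agE ->]]] := local_distP x y.
  by split=> // _; rewrite invr_ge0.
by rewrite lef_pV2 ?posrE ?ltr0Sn// ler_nat ltnS; apply: iff_sym.
Qed.

Lemma local_dist_refl x : local_dist x x = 0.
Proof.
have [[]//|[s [sE _]]] := local_distP x x.
by have := (sE s.+1).1 (riso_refl _ _); rewrite ltnn.
Qed.

Lemma local_dist_eq0 x y : local_dist x y = 0 -> x = y.
Proof.
move=> xy0; rewrite -[x]reprK -[y]reprK; apply/eqP.
rewrite eqmodE; apply/asboolP; apply: riso_rballs => t.
by apply/local_dist_le; rewrite xy0 invr_ge0.
Qed.

Lemma local_dist_sym x y : local_dist x y = local_dist y x.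
Proof.
by rewrite /local_dist; congr (fine (1 + ereal_sup (_ @` _))^-1);
  apply/seteqP; split; exact: agree_sym.
Qed.

Lemma local_dist_triangle y x z :
  local_dist x z <= local_dist x y + local_dist y z.
Proof.
apply: (@le_trans _ _ (Num.max (local_dist x y) (local_dist y z))); last first.
  by rewrite ge_max lerDl lerDr !local_dist_ge0.
have xyz t : local_dist x y <= t.+1%:R^-1 -> local_dist y z <= t.+1%:R^-1 ->
    local_dist x z <= t.+1%:R^-1.
  by move=> /local_dist_le xy /local_dist_le yz; apply/local_dist_le/(agree_trans (conj xy yz)).
set M := Num.max _ _.
have [xM yM] : local_dist x y <= M /\ local_dist y z <= M.
  by rewrite /M !le_max !lexx orbT.
have [M0|[s Ms]] : M = 0 \/ exists s, M = s.+1%:R^-1.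
  rewrite /M maxEle; case: ifP => _.
    by have [[_ ->]|[s [_ ->]]] := local_distP y z; [left|right; exists s].
  by have [[_ ->]|[s [_ ->]]] := local_distP x y; [left|right; exists s].
- rewrite M0 in xM yM *; have [[_ ->]//|[s [sE _]]] := local_distP x z.
  have /sE : agree x z s.+1 by apply/local_dist_le/xyz; apply: le_trans; eassumption || rewrite invr_ge0.
  by rewrite ltnn.
- by rewrite Ms in xM yM *; exact: xyz.
Qed.

HB.instance Definition _ := Choice.on Gstar.
HB.instance Definition _ := @isMetric.Build R Gstar local_dist local_dist_refl
  local_dist_eq0 local_dist_sym local_dist_triangle.
End graphs.
Arguments Gstar R : clear implicits.

Section rooted_class.
Context {R : realType}.

Definition rclass (V : countType) (g : rgraph V) : Gstar R :=
  \pi_(Gstar R) (relabel g).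

Lemma riso_rclass (V : countType) (g : rgraph V) :
  riso (repr (rclass g)) (root (repr (rclass g))) g (root g).
Proof.
have : repr (rclass g) = relabel g %[mod Gstar R] by rewrite reprK.
move/eqP; rewrite eqmodE => /asboolP e; apply: riso_trans e _.
by apply: riso_sym; [exact: root_vset|exists pickle; exact: is_riso_pickle].
Qed.

Lemma rclass_eq (V W : countType) (g : rgraph V) (h : rgraph W) :
  rclass g = rclass h <-> riso g (root g) h (root h).
Proof.
split=> [gh|gh].
  apply: riso_trans (riso_sym (root_vset _) (riso_rclass g)) _.
  by rewrite gh; exact: riso_rclass.
rewrite -[LHS]reprK -[RHS]reprK; apply/eqP; rewrite eqmodE; apply/asboolP.
apply: riso_trans (riso_rclass g) _; apply: riso_trans gh _.
by apply: riso_sym; [exact: root_vset|exact: riso_rclass].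
Qed.

Lemma agree_rclass (V W : countType) (g : rgraph V) (h : rgraph W) t :
  agree (rclass g) (rclass h) t <->
  riso (rball g (root g) t) (root g) (rball h (root h) t) (root h).
Proof.
have ig := riso_rball t (root_vset _) (riso_rclass g).
have ih := riso_rball t (root_vset _) (riso_rclass h).
split=> [gh|gh].
  apply: riso_trans (riso_sym (root_rball _ _) ig) _.
  exact: riso_trans gh ih.
apply: riso_trans ig _; apply: riso_trans gh _.
by apply: riso_sym; first exact: root_rball.
Qed.

Section single.
Let ad_vs u v : (fun _ _ : nat => false) u v -> u \in pred1 0%N. Proof. by []. Qed.
Let wg_sym u v : (fun _ _ : nat => false) u v -> 0 = 0 :> R. Proof. by []. Qed.
Let G : wgraph R nat := @WGraph _ _ (pred1 0%N) (fun _ _ => false) (fun _ _ => 0)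
  ad_vs (fun=> erefl) (fun _ _ => erefl) wg_sym.
Let conn : connected_from G 0%N.
Proof. by split=> // v /eqP->; exists [::]. Qed.
Let lf : locally_finite G.
Proof. by move=> v; exact: (@sub_finite_set _ _ set0). Qed.
Definition single_vertex : rgraph nat := RGraph conn lf.
End single.

End rooted_class.

HB.instance Definition _ (R : realType) :=
  isPointed.Build (Gstar R) (rclass single_vertex).

Definition Gstar_borel (R : realType) : set (set (Gstar R)) := <<s open >>.

HB.instance Definition _ (R : realType) :=
  @isMeasurable.Build (sigma_display (@open (Gstar R))) (Gstar R)
  (@Gstar_borel R) (@sigma_algebra0 _ setT open)
  (@sigma_algebraC _ open) (@sigma_algebra_bigcup _ setT open).

Section weak_convergence.
Context {R : realType}.

Definition weak_cvg (mu : nat -> {measure set Gstar R -> \bar R})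
    (nu : {measure set Gstar R -> \bar R}) :=
  forall f : Gstar R -> R, continuous f -> (exists M, forall x, `|f x| <= M) ->
    (\int[mu n]_x (f x)%:E @[n --> \oo] --> \int[nu]_x (f x)%:E)%E.
End weak_convergence.

Section empirical.
Context {R : realType}.

Section rooted_component.
Context {V : finType}.
Variables (G : wgraph R V) (o : V).
Hypothesis oG : o \in vset G.
Let conn : connected_from (component G o) o.
Proof.
have in_comp v p : walk G o v p -> v \in vset (component G o).
  move=> Gp; rewrite inE /= (walk_vset oG Gp).2; apply/asboolP.
  by exists p.
split; first exact: (in_comp _ [::]).
move=> v /andP[vG /asboolP[p Gp]]; exists p.
elim/last_ind: p v Gp {vG} => [|p x IH] v; first by case=> _ <-.
move=> Gp; case: (Gp); rewrite rcons_path last_rcons => /andP[pp px] xv; subst v.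
have Gp' : walk G o (last o p) p by [].
have [bp bl] := IH _ Gp'; split; last by rewrite last_rcons.
by rewrite rcons_path bp adj_induced//; exact: in_comp Gp' || exact: in_comp Gp.
Qed.
Let lf : locally_finite (component G o).
Proof. by move=> v; exact: finite_finset. Qed.
Definition rooted_component : rgraph V := RGraph conn lf.
End rooted_component.

Variables (V : finType) (G : wgraph R V).

Let m (o : {o | o \in vset G}) : {measure set (Gstar R) -> \bar R} :=
  dirac (rclass (rooted_component (valP o))).
Let sm (A : set (Gstar R)) : \bar R := (\sum_o m o A)%E.
Let sm0 : sm set0 = 0%E.
Proof. by rewrite /sm big1. Qed.
Let sm_ge0 A : (0 <= sm A)%E.
Proof. by rewrite sume_ge0. Qed.
Let sm_sigma_additive : semi_sigma_additive sm.
Proof.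
move=> F mF tF mUF; rewrite [X in _ --> X](_ : _ =
    lim ((fun n => \sum_(0 <= i < n) sm (F i))%E @ \oo)).
  by apply: is_cvg_ereal_nneg_natsum => k _; exact: sume_ge0.
rewrite nneseries_sum//; apply: eq_bigr => /= i _.
exact: measure_semi_bigcup.
Qed.
HB.instance Definition _ := isMeasure.Build _ _ _ sm sm0 sm_ge0 sm_sigma_additive.

(* U(G, w): the law of the class of the component of a uniform vertex *)
Definition unif_root (A : set (Gstar R)) : \bar R :=
  ((#|vset G|%:R^-1)%:E * \sum_(o : {o | o \in vset G})
     \d_(rclass (rooted_component (valP o))) A)%E.

Let c_ge0 : 0 <= #|vset G|%:R^-1 :> R. Proof. by rewrite invr_ge0. Qed.
Let c : {nonneg R} := NngNum c_ge0.
Let unif_rootE : unif_root = mscale c sm.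
Proof. by apply/funext => A; rewrite /unif_root /mscale /sm /m /=. Qed.
Let unif_root0 : unif_root set0 = 0%E.
Proof. by rewrite unif_rootE measure0. Qed.
Let unif_root_ge0 A : (0 <= unif_root A)%E.
Proof. by rewrite unif_rootE. Qed.
Let unif_root_sigma_additive : semi_sigma_additive unif_root.
Proof. by rewrite unif_rootE; exact: measure_semi_sigma_additive. Qed.
HB.instance Definition _ := isMeasure.Build _ _ _ unif_root
  unif_root0 unif_root_ge0 unif_root_sigma_additive.
End empirical.

Section line_graph.
Context {R : realType}.
Variables (r n : nat) (E : {set {set 'I_n}}).
Let vs := [pred S : {set 'I_n} | #|S| == r].
Let wt (S1 S2 : {set 'I_n}) := #|[set e in E | (S1 \subset e) && (S2 \subset e)]|.
Let ad : rel {set 'I_n} := fun S1 S2 =>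
  [&& #|S1| == r, #|S2| == r, S1 != S2 &
      [exists e in E, (S1 \subset e) && (S2 \subset e)]].
Let ad_vs S1 S2 : ad S1 S2 -> S1 \in vs.
Proof. by case/and4P. Qed.
Let ad_irr : irreflexive ad.
Proof. by move=> S; rewrite /ad eqxx !andbF. Qed.
Let ad_sym : symmetric ad.
Proof.
move=> S1 S2; rewrite /ad andbCA (eq_sym S1); do 3 congr (_ && _).
by apply: eq_existsb => e /=; rewrite (andbC (S1 \subset e)).
Qed.
Let wg_sym S1 S2 : ad S1 S2 -> (wt S1 S2)%:R = (wt S2 S1)%:R :> R.
Proof.
move=> _; congr (_%:R); apply: eq_card => e.
by rewrite !inE (andbC (S1 \subset e)).
Qed.
Definition line_graph : wgraph R {set 'I_n} := WGraph ad_vs ad_irr ad_sym wg_sym.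
End line_graph.

Definition U_r {R : realType} (r n : nat) (E : {set {set 'I_n}}) :=
  @unif_root R _ (line_graph r E).
HB.instance Definition _ (R : realType) r n E := Measure.on (@U_r R r n E).

Definition local_weak_limit {R : realType} (r : nat)
    (H : forall n, {set {set 'I_n}}) (nu : {measure set Gstar R -> \bar R}) :=
  weak_cvg (fun n => @U_r R r n (H n)) nu.

Section independence.
Context {R : realType} {d : measure_display} {T : measurableType d}
  (P : probability T R).

(* Mutual independence: the product rule over every finite subfamily *)
Definition independent_events (I : eqType) (A : I -> set T) :=
  forall s : seq I, uniq s ->
    P (\bigcap_(i in [set` s]) A i) = (\prod_(i <- s) P (A i))%E.

Definition independent_RVs (I : eqType) {d'} {T' : measurableType d'}
    (X : I -> {RV P >-> T'}) :=
  forall B : I -> set T', (forall i, measurable (B i)) ->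
    independent_events (fun i => X i @^-1` B i).

Definition random_hypergraph (n k : nat) (p : R) (H : T -> {set {set 'I_n}}) :=
  [/\ forall w, {in H w, forall e : {set 'I_n}, #|e| = k},
      forall e : {set 'I_n}, #|e| = k ->
        measurable [set w | e \in H w] /\ P [set w | e \in H w] = p%:E &
      independent_events
        (fun e : {e : {set 'I_n} | #|e| == k} => [set w | val e \in H w])].

End independence.

Section galton_watson.
Context {R : realType} (d : nat).

(* Vertices of the block tree, as in Ulam-Harris labelling: [::] is the root
   and (b, i) :: u is the i-th new vertex (i < d) of the b-th d-block child of
   the vertex u, the most recent generation coming first. N u is the number of
   d-block children of u. *)
Definition address := seq (nat * 'I_d).
HB.instance Definition _ := Countable.on address.
Implicit Types (N : address -> nat) (u v : address).

Fixpoint gw_alive N (v : seq (nat * 'I_d)) : bool :=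
  if v is (b, _) :: u then (b < N u)%N && gw_alive N u else true.

Definition gw_child u v := if v is _ :: w then u == w else false.

Definition gw_sibling u v :=
  match u, v with
  | (b, i) :: w, (c, j) :: w' => [&& w == w', b == c & i != j]
  | _, _ => false
  end.

Definition gw_near u v := [|| gw_child u v, gw_child v u | gw_sibling u v].

Lemma gw_near_sym : symmetric gw_near.
Proof.
move=> u v; rewrite /gw_near orbCA; do 2 congr (_ || _).
case: u v => [|[b i] u] [|[c j] v] //=.
by rewrite (eq_sym u) (eq_sym b) (eq_sym i).
Qed.

Lemma gw_near_irr : irreflexive gw_near.
Proof.
move=> u; rewrite /gw_near; case: u => //= [[b i] u].
rewrite !eqxx /= orbF orbb; apply/negP => /eqP/(congr1 size) /= /eqP.
by rewrite eqn_leq ltnn.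
Qed.

Section tree.
Variable N : address -> nat.
Let vs : {pred address} := gw_alive N.
Let ad : rel address := fun u v => [&& gw_alive N u, gw_alive N v & gw_near u v].
Let ad_vs u v : ad u v -> u \in vs.
Proof. by case/and3P. Qed.
Let ad_irr : irreflexive ad.
Proof. by move=> u; rewrite /ad gw_near_irr !andbF. Qed.
Let ad_sym : symmetric ad.
Proof. by move=> u v; rewrite /ad andbCA gw_near_sym. Qed.
Let G : wgraph R address :=
  @WGraph _ _ vs ad (fun _ _ => 1) ad_vs ad_irr ad_sym (fun _ _ _ => erefl).

Let walkP v : v \in vset G -> exists2 p, walk G [::] v p & (size p <= size v)%N.
Proof.
elim: v => [|[b i] v IH]; first by exists [::].
move=> bv; have /andP[_ vG] : (b < N v)%N && gw_alive N v by [].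
have [p [pp pv] ps] := IH vG; exists (rcons p ((b, i) :: v)).
  split; last by rewrite last_rcons.
  rewrite rcons_path pp pv /= /ad; apply/and3P; split=> //.
  by rewrite /gw_near /= eqxx.
by rewrite size_rcons.
Qed.

Let conn : connected_from G [::].
Proof. by split=> // v /walkP[p Gp _]; exists p. Qed.

Let lf : locally_finite G.
Proof.
move=> v; pose kids w := [set x : address | exists2 y : 'I_(N w) * 'I_d,
  True & x = (nat_of_ord y.1, y.2) :: w].
have fk w : finite_set (kids w).
  apply: (@sub_finite_set _ _ ((fun y : 'I_(N w) * 'I_d =>
    (nat_of_ord y.1, y.2) :: w) @` setT)); last exact/finite_image/finite_finset.
  by move=> _ [y _ ->]; exists y.
have kP w b i : (b < N w)%N -> kids w ((b, i) :: w).
  by move=> bN; exists (Ordinal bN, i).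
apply: (@sub_finite_set _ _ ([set behead v] `|` kids v `|` kids (behead v))).
  move=> u /= /and3P[_ uG /or3P[]].
  - case: u uG => // -[b i] w /= /andP[bw _] /eqP vw; subst w.
    by left; right; exact: kP.
  - by case: v => //= x w /eqP->; left; left.
  - case: v {fk kP} => // -[b i] w; case: u uG => // -[c j] w' /= /andP[cw _].
    case/and3P => /eqP ww _ _; subst w'; right.
    by exists (Ordinal cw, j).
by rewrite !finite_setU; split=> //; split.
Qed.

Definition gw_graph : rgraph address := RGraph conn lf.

Lemma gw_walk v : v \in vset gw_graph ->
  exists2 p, walk gw_graph [::] v p & (size p <= size v)%N.
Proof. exact: walkP. Qed.

End tree.

Lemma gw_rball N t v :
  v \in vset (rball (gw_graph N) [::] t) <-> gw_alive N v /\ (size v <= t)%N.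
Proof.
split=> [/in_rball[vG [p Gp pt]]|[va vt]].
  split=> //; apply: leq_trans pt.
  elim/last_ind: p v Gp {vG} => [|p x IH] v; first by case=> _ <-.
  case; rewrite rcons_path last_rcons size_rcons => /andP[pp px] xv; subst v.
  have := IH _ (conj pp erefl); move: px; rewrite /= => /and3P[_ _].
  case/or3P => [| |]; move: (last _ _) => u.
  - by case: x => // y x /eqP-> /=; rewrite ltnS.
  - by case: u => // y u /eqP-> /= /ltnW /leq_trans; apply.
  - by case: u x => [|[b i] u] [|[c j] x] // /and3P[/eqP-> _ _] /= /leq_trans; apply.
have [p Gp pv] := gw_walk va.
by apply: (in_rballT _ Gp (leq_trans pv vt)).
Qed.

Lemma gw_alive_eq N N' t : (forall v, gw_alive N v -> (size v <= t)%N -> N v = N' v) ->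
  forall v, (size v <= t)%N -> gw_alive N v = gw_alive N' v.
Proof.
move=> NN; elim=> // -[b i] v IH /ltnW vt /=; rewrite -IH//.
by case va: (gw_alive N v); rewrite ?andbF// NN.
Qed.

Lemma gw_agree N N' t : (forall v, gw_alive N v -> (size v <= t)%N -> N v = N' v) ->
  agree (rclass (gw_graph N)) (rclass (gw_graph N')) t.
Proof.
move=> NN; apply/agree_rclass; exists id.
have aE := gw_alive_eq NN.
have bE v : (v \in vset (rball (gw_graph N) [::] t)) =
            (v \in vset (rball (gw_graph N') [::] t)).
  by apply/idP/idP => /gw_rball[va vt]; apply/gw_rball; split=> //; [rewrite -aE|rewrite aE].
split=> //.
- split=> [v /=|u v _ _//|v /= vb]; first by rewrite -bE.
  by exists v; rewrite //= bE.
- move=> u v ub vb; rewrite !adj_induced -?bE//=.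
  have /gw_rball[_ ut] := ub; have /gw_rball[_ vt] := vb.
  by rewrite !aE.
Qed.

Lemma measurable_gw_class {disp} {T : measurableType disp}
    (X : address -> {mfun T >-> nat}) :
  measurable_fun setT (fun w => rclass (gw_graph (fun v => X v w))).
Proof.
pose gw w := rclass (gw_graph (fun v => X v w)).
pose cyl (l : seq (address * nat)) : set T :=
  [set w | forall z, z \in l -> X z.1 w = z.2].
have mcyl l : measurable (cyl l).
  rewrite (_ : cyl l = \big[setI/setT]_(z <- l) (X z.1 @^-1` [set z.2])).
    apply: bigsetI_measurable => z _; rewrite -[X in measurable X]setTI.
    exact: measurable_funPT.
  rewrite -bigcap_seq; apply/seteqP; split=> w /= h z; exact: h.
apply: (@measurability _ _ _ _ _ _ (@open (Gstar R))) => // _ [A oA <-].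
rewrite setTI (_ : _ @^-1` _ =
    \bigcup_(l in [set l | cyl l `<=` gw @^-1` A]) cyl l).
  rewrite bigcup_mkcond; apply: countable_bigcupT_measurable => [|l].
    exact: countableP.
  by case: ifP => _; [exact: mcyl|exact: measurable0].
apply/seteqP; split=> [w Aw|w [l /= lA /lA //]].
have : nbhs (gw w) A by exact: open_nbhs_nbhs.
move=> /nbhs_ballP[e /= e0 eA].
have [t te] : exists t : nat, t.+1%:R^-1 < e.
  exists (Num.truncn e^-1); rewrite invf_plt ?posrE//; exact: truncnS_gt.
have fin := finite_rball (gw_graph (fun v => X v w)) t.
have [l lE] := (finite_seqP _).1 fin.
exists [seq (v, X v w) | v <- l]; last by move=> _ /mapP[v _ ->].
move=> w' /= cw'; apply: eA; rewrite ballEmdist /=.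
apply: le_lt_trans te; apply/local_dist_le/gw_agree => v va vt.
have vl : v \in l by have : [set` l] v by rewrite -lE; exact/gw_rball.
by rewrite (cw' (v, X v w))//; apply/mapP; exists v.
Qed.

Definition gw_class {disp} {T : measurableType disp}
  (X : address -> {mfun T >-> nat}) (w : T) : Gstar R :=
  rclass (gw_graph (fun v => X v w)).

HB.instance Definition _ {disp} {T : measurableType disp}
    (X : address -> {mfun T >-> nat}) :=
  isMeasurableFun.Build _ _ _ _ (gw_class X) (measurable_gw_class X).

(* nu is the law of the block tree driven by some independent Poisson(lam)
   family; such a law exists by [gw_law_exists] below. *)
Definition gw_law (lam : R) (nu : probability (Gstar R) R) :=
  exists (disp : measure_display) (T : measurableType disp)
         (P : probability T R) (X : address -> {RV P >-> nat}),
    [/\ forall v m, P (X v @^-1` [set m]) = (poisson_pmf lam m)%:E,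
        independent_RVs X &
        forall A, measurable A ->
          nu A = distribution P (gw_class X) A].

End galton_watson.

(* An independent Poisson(lam) family on [0, 1) with Lebesgue measure: X0 u is
   the index of the cell of u in the partition of [0, 1) into intervals of
   lengths poisson_pmf lam n, and phi expands this cell affinely onto [0, 1).
   The variables X0 \o phi^i are independent. *)
Section iid_poisson.
Context {R : realType}.
Variable lam : R.
Hypothesis lam0 : 0 < lam.
Local Notation pi_ n := (poisson_pmf lam n).
Local Notation leb := (@lebesgue_measure R).
Local Notation TR := (measurableTypeR R).

Let I01 : set TR := `[0, 1[.
Let mI01 : measurable I01. Proof. exact: measurable_itv. Qed.
Definition unit_prob : set TR -> \bar R := mrestr leb mI01.
HB.instance Definition _ := Measure.on unit_prob.
Let unit_prob1 : unit_prob setT = 1%E.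
Proof. by rewrite /unit_prob /mrestr setTI lebesgue_measure_itv /= lte_fin ltr01 oppr0 adde0. Qed.
HB.instance Definition _ := Measure_isProbability.Build _ _ _ unit_prob unit_prob1.

Let pi_gt0 n : 0 < pi_ n.
Proof. by rewrite /poisson_pmf lam0 !mulr_gt0 ?expR_gt0 ?exprn_gt0 ?invr_gt0 ?ltr0n ?fact_gt0. Qed.

Let F n := \sum_(i < n) pi_ i.
Let FS n : F n.+1 = F n + pi_ n. Proof. by rewrite /F big_ord_recr. Qed.
Let F_cvg : F n @[n --> \oo] --> (1 : R).
Proof.
have e0 n : (0 <= (pi_ n)%:E)%E by rewrite lee_fin ltW.
have e : (\sum_(0 <= i <oo) (pi_ i)%:E)%E = 1%E.
  rewrite nneseries_esumT// -(probability_setT (poisson_prob lam 0%N)).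
  by rewrite /= /poisson_prob lam0.
have : (\sum_(0 <= i < n) (pi_ i)%:E)%E @[n --> \oo] --> (1%E : \bar R).
  by rewrite -e; apply: is_cvg_nneseries => n _ _.
move=> /fine_cvg; apply: cvg_trans; apply: near_eq_cvg; near=> n.
by rewrite /= sumEFin /= big_mkord.
Unshelve. all: by end_near. Qed.
Let F_le m n : (m <= n)%N -> F m <= F n.
Proof.
move=> /subnK <-; elim: (n - m)%N => // k IH.
by rewrite addSn FS (le_trans IH)// lerDl ltW.
Qed.
Let F_ge0 n : 0 <= F n.
Proof. by rewrite sumr_ge0// => i _; exact: ltW. Qed.
Let F_le1 n : F n <= 1.
Proof.
rewrite -(cvg_lim _ F_cvg)//; apply: nondecreasing_cvgn_le => //.
by apply: cvgP F_cvg.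
Qed.

Let cell n : set R := [set u | F n <= u < F n.+1].
Let X0 (u : TR) : nat := xget 0%N [set n | cell n u].

Let cell_uniq m n u : cell m u -> cell n u -> m = n.
Proof.
move=> /andP[mu um] /andP[nu un]; apply/eqP; rewrite eqn_leq.
apply/andP; split; rewrite leqNgt; apply/negP => /F_le.
  by move=> /(lt_le_trans un) /(le_lt_trans mu); rewrite ltxx.
by move=> /(lt_le_trans um) /(le_lt_trans nu); rewrite ltxx.
Qed.
Let cellX n u : cell n u -> X0 u = n.
Proof. by move=> nu; rewrite /X0; case: xgetP => [m _ /cell_uniq|/(_ n)//]; exact. Qed.
Let cell01 n u : cell n u -> I01 u.
Proof.
by move=> /andP[Fu uF]; rewrite /I01 /= in_itv /= (le_trans (F_ge0 n) Fu) (lt_le_trans uF (F_le1 _)).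
Qed.
Let X0cell u : I01 u -> cell (X0 u) u.
Proof.
rewrite /I01 /= in_itv /= => /andP[u0 u1].
have [n un] : exists n, u < F n.
  have := cvgr_gt _ F_cvg _ u1. move=> [n _ /(_ n (leqnn n))]; by exists n.
case: (ex_minnP (ex_intro (fun n => u < F n) n un)) => -[|m] um mmin.
  by move: um; rewrite /F big_ord0 ltNge u0.
suff c : cell m u by rewrite (cellX c).
by rewrite /cell /= um andbT leNgt; apply/negP => /mmin; rewrite ltnn.
Qed.

Let mcell n : measurable (cell n : set TR).
Proof.
by rewrite (_ : cell n = `[F n, F n.+1[%classic)//; apply/seteqP; split=> u /=; rewrite in_itv.
Qed.
Let mX0s n : measurable (X0 @^-1` [set n]).
Proof.
have cE m : ~` I01 `&` X0 @^-1` [set m] = if m == 0%N then ~` I01 else set0.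
  have out u : ~ I01 u -> X0 u = 0%N.
    by move=> nu; rewrite /X0; case: xgetP => // k _ /cell01.
  apply/seteqP; split=> u /=; first by case=> nu <-; rewrite (out _ nu).
  by case: eqP => [-> nu|//]; split=> //; exact: out.
rewrite (_ : _ @^-1` _ = cell n `|` (~` I01 `&` X0 @^-1` [set n])).
  apply: measurableU; first exact: mcell.
  by rewrite cE; case: eqP => _ //; exact: measurableC.
apply/seteqP; split=> u /=.
  by move=> un; have [/X0cell|] := pselect (I01 u); [rewrite un; left|right].
by case=> [/cellX//|[]].
Qed.
Let mX0 : measurable_fun setT X0.
Proof.
move=> _ B _; rewrite setTI (_ : _ @^-1` _ = \bigcup_(n in B) (X0 @^-1` [set n])).
  by apply: bigcup_measurable => n _; exact: mX0s.
by apply/seteqP; split=> [u Bu|u [n Bn /= ->]//]; exists (X0 u).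
Qed.

Let g n (u : TR) : TR := (u - F n) / pi_ n.
Let phi (u : TR) : TR := g (X0 u) u.

Let mg n : measurable_fun setT (g n).
Proof. by apply: measurable_funM => //; exact: measurable_funB. Qed.
Let mphi : measurable_fun setT phi.
Proof.
move=> _ B mB; rewrite setTI (_ : _ @^-1` _ =
   \bigcup_n (X0 @^-1` [set n] `&` g n @^-1` B)).
  apply: bigcup_measurable => n _; apply: measurableI; first exact: mX0s.
  by rewrite -[X in measurable X]setTI; exact: mg.
by apply/seteqP; split=> [u Bu|u [n _ [/= <-]]//]; exists (X0 u).
Qed.

Let leb_g n (A : set TR) : measurable A -> leb (g n @^-1` A) = ((pi_ n)%:E * leb A)%E.
Proof.
move=> mA.
have c0 : 0 <= (pi_ n)^-1 by rewrite invr_ge0 ltW.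
have pn := pi_gt0 n.
rewrite [in RHS](@lebesgue_measure_unique _
  (mscale (NngNum c0) (pushforward leb (g n)))) /mscale/pushforward//=.
  by rewrite muleA -EFinM divff ?gt_eqF// mul1e.
move=> _ [[a b] _ <-].
have gE : g n @^-1` `]a, b] = `]a * pi_ n + F n, b * pi_ n + F n]%classic.
  apply/seteqP; split=> u /=; rewrite !in_itv /= /g.
    by rewrite ltr_pdivlMr// ler_pdivrMr// ltrBrDr lerBlDr.
  by rewrite ltr_pdivlMr// ler_pdivrMr// ltrBrDr lerBlDr.
change (leb `]a, b] = ((pi_ n)^-1%:E * leb (g n @^-1` `]a, b]))%E); rewrite gE.
rewrite !lebesgue_measure_itv /= !lte_fin ltrD2r ltr_pM2r//.
case: ifP => _; last by rewrite mule0.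
by rewrite -!EFinD -EFinM opprD addrACA subrr addr0 -mulrBl mulrCA mulVf ?mulr1 ?gt_eqF.
Qed.

Let key n (A : set TR) : measurable A ->
  unit_prob (X0 @^-1` [set n] `&` phi @^-1` A) = ((pi_ n)%:E * unit_prob A)%E.
Proof.
move=> mA; rewrite /unit_prob /mrestr -leb_g; last exact: measurableI.
congr (leb _); apply/seteqP; split=> u.
- move=> [[/= Xu Au] uI]; split; first by move: Au; rewrite /phi Xu.
  have := X0cell uI; rewrite Xu => /andP[Fu uF]; rewrite /I01 /= in_itv /= /g.
  by rewrite divr_ge0 ?subr_ge0 ?(ltW (pi_gt0 n))//= ltr_pdivrMr// mul1r ltrBlDl -FS.
- move=> [/= Au]; rewrite /I01 /= in_itv /= /g => /andP[].
  rewrite ler_pdivlMr// mul0r subr_ge0 ltr_pdivrMr// mul1r ltrBlDl -FS => Fu uF.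
  have c : cell n u by rewrite /cell /= Fu.
  by split; [split; rewrite /= ?/phi ?(cellX c)|exact: (cell01 c)].
Qed.

Let unit_X0 n : unit_prob (X0 @^-1` [set n]) = (pi_ n)%:E.
Proof. by have := key n measurableT; rewrite preimage_setT setIT unit_prob1 mule1. Qed.

Let mX0B (B : set nat) : measurable (X0 @^-1` B).
Proof. by rewrite -[X in measurable X]setTI; exact: mX0. Qed.
Let mphiA (A : set TR) : measurable A -> measurable (phi @^-1` A).
Proof. by move=> mA; rewrite -[X in measurable X]setTI; exact: mphi. Qed.

Let key2 (B : set nat) (A : set TR) : measurable A ->
  unit_prob (X0 @^-1` B `&` phi @^-1` A) = (unit_prob (X0 @^-1` B) * unit_prob A)%E.
Proof.
have dec (D : set TR) : measurable D -> unit_prob (X0 @^-1` B `&` D) =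
    (\sum_(0 <= n <oo | n \in B) unit_prob (X0 @^-1` [set n] `&` D))%E.
  move=> mD; rewrite -measure_bigcup//.
  - congr unit_prob; apply/seteqP; split=> [u [Bu Du]|u [n Bn [/= un Du]]].
      by exists (X0 u).
    by split=> //=; rewrite un.
  - by move=> n _; exact: measurableI.
  - by apply/trivIsetP => i j _ _ ij; rewrite -subset0 => u [[/= ui _] [/= uj _]]; rewrite -ui -uj eqxx in ij.
move=> mA; rewrite dec; last exact: mphiA.
rewrite -[X in (unit_prob X * _)%E]setIT dec//.
under eq_eseriesr do rewrite key//.
under [in RHS]eq_eseriesr do rewrite setIT unit_X0.
have -> : unit_prob A = (fine (unit_prob A))%:E.
  by rewrite fineK//; exact: fin_num_measure.
rewrite muleC -nneseriesZl; last by move=> n _; rewrite lee_fin ltW.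
by apply: eq_eseriesr => n _; rewrite muleC.
Qed.

Let X i (u : TR) : nat := X0 (iter i phi u).
Let miter i : measurable_fun setT (iter i phi).
Proof. by elim: i => [|i IH]; [exact: measurable_id|apply: measurableT_comp]. Qed.
Let mX i : measurable_fun setT (X i).
Proof. exact: (measurableT_comp mX0 (miter i)). Qed.
HB.instance Definition _ i := isMeasurableFun.Build _ _ _ _ (X i) (mX i).

Let X_pre i (B : set nat) : unit_prob (X i @^-1` B) = unit_prob (X0 @^-1` B).
Proof.
elim: i => // i IH; rewrite -IH (_ : X i.+1 @^-1` B = X0 @^-1` setT `&` phi @^-1` (X i @^-1` B)).
  rewrite key2 ?preimage_setT ?unit_prob1 ?mul1e//.
  by rewrite -[X in measurable X]setTI; exact: mX.
by apply/seteqP; split=> u; rewrite /X /preimage /= -iterS iterSr //; case.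
Qed.

Let ev m (B : nat -> set nat) : set TR := [set u | forall i, (i < m)%N -> B i (X i u)].
Let evS m B : ev m.+1 B = X0 @^-1` (B 0%N) `&` phi @^-1` ev m (B \o S).
Proof.
apply/seteqP; split=> [u h|u [h0 h]].
  split=> [|i im]; first exact: (h 0%N).
  by have := h i.+1 im; rewrite /X iterSr.
by case=> [//|i]; rewrite ltnS => /h; rewrite /X iterSr.
Qed.
Let mev m B : measurable (ev m B).
Proof.
elim: m B => [|m IH] B; first by rewrite (_ : ev _ _ = setT)// -subTset => u _ i.
by rewrite evS; apply: measurableI; [exact: mX0B|apply: mphiA; exact: IH].
Qed.
Let ev_prod m B : unit_prob (ev m B) = (\prod_(0 <= i < m) unit_prob (X i @^-1` B i))%E.
Proof.
elim: m B => [|m IH] B.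
  rewrite big_geq// (_ : ev _ _ = setT) ?unit_prob1//.
  by rewrite -subTset => u _ i.
rewrite evS key2// IH big_nat_recl//; congr (_ * _)%E.
by apply: eq_bigr => i _; rewrite !X_pre.
Qed.

Lemma iid_poisson (I : countType) : exists Y : I -> {RV unit_prob >-> nat},
  (forall v m, unit_prob (Y v @^-1` [set m]) = (pi_ m)%:E) /\ independent_RVs Y.
Proof.
exists (fun v => X (pickle v)); split=> [v m|B _ s us].
  by rewrite X_pre unit_X0.
pose B' i := if pickle_inv i is Some v then if v \in s then B v else setT else setT.
have B'E v : v \in s -> B' (pickle v) = B v by move=> vs; rewrite /B' pickleK_inv vs.
have [m vm] : exists m, forall v, v \in s -> (pickle v < m)%N.
  by exists (\max_(v <- s) pickle v).+1 => v vs; rewrite ltnS (leq_bigmax_seq v).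
transitivity (unit_prob (ev m B')).
  congr unit_prob; apply/seteqP; split=> u /= h.
    move=> i im; rewrite /B'; case E : (pickle_inv i) => [v|//].
    case: ifP => // vs; have := h v vs.
    by have := @pickle_invK I i; rewrite E /= => ->.
  by move=> v vs; have := h _ (vm v vs); rewrite B'E.
rewrite ev_prod.
transitivity (\prod_(v <- s) unit_prob (X (pickle v) @^-1` B' (pickle v)))%E.
  rewrite -[RHS](big_map (@pickle I) xpredT (fun i => unit_prob (X i @^-1` B' i))).
  rewrite (bigID [in map pickle s]) /= [X in (_ * X)%E]big1 ?mule1.
    rewrite -big_filter.  apply: perm_big; apply: uniq_perm.
    - by rewrite filter_uniq// iota_uniq.
    - by rewrite map_inj_uniq//; exact: pcan_inj pickleK_inv.
    - move=> i; rewrite mem_filter mem_index_iota /=.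
      by case: (boolP (i \in _)) => //= /mapP[v vs ->]; exact: vm.
  move=> i; rewrite /B' => nis; case E : (pickle_inv i) => [v|]; last first.
    by rewrite preimage_setT unit_prob1.
  case: ifP => vs; last by rewrite preimage_setT unit_prob1.
  case/negP: nis; apply/mapP; exists v => //.
  by have := @pickle_invK I i; rewrite E.
by apply: eq_big_seq => v vs; rewrite B'E.
Qed.

End iid_poisson.

Lemma gw_law_exists (R : realType) (d : nat) (lam : R) : 0 < lam ->
  exists nu : probability (Gstar R) R, gw_law d lam nu.
Proof.
move=> lam0; have [Y [Yp Yi]] := iid_poisson lam0 (address d).
exists (distribution unit_prob (gw_class Y)).
by exists _, (measurableTypeR R), unit_prob, Y.
Qed.

(* Main.v *)
Require Import Defs.
From HB Require Import structures.
From mathcomp Require Import all_boot all_order all_algebra.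
From mathcomp Require Import all_classical all_reals all_analysis.
From mathcomp Require Import measurable_realfun zify lra.
Set Implicit Arguments. Unset Strict Implicit. Unset Printing Implicit Defensive.
Import Order.TTheory GRing.Theory Num.Theory.
Import numFieldTopology.Exports numFieldNormedType.Exports.

(** The root of a block tree together with its descendants up to depth t+1 is
    described by the pruned offspring function m, and these cylinders carry the
    whole mass of the Galton-Watson measure. Hence it is enough to show that for
    every m, almost surely, the liminf of the fraction of vertices of H_n whose
    canonical exploration is tree-like and yields m is at least the
    Galton-Watson probability of m: the events are disjoint for distinct m, so
    no mass can be left over.

    The mean of this fraction is bounded below by counting the sub-hypertrees D
    with exploration m: given D, the hyperedges meeting the interior of D are
    exactly those of D with probability at least p^|D| (1-p)^(M C(n-1,k-1)).
    The number of vertices with exploration m changes by a bounded amount when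
    one hyperedge is added, because such a vertex is reached from the hyperedge
    through vertices of bounded degree; an exponential moment bound then gives
    exponentially small lower deviations, and Borel-Cantelli concludes. *)

(** * Canonical exploration of a hypergraph *)

(** The one-sided form spares any estimate of the probability of short cycles or large degrees.
    Labelled explorations replace isomorphism classes so that no automorphisms have to be counted: a
    root has exactly one exploration, and the orders in which the j blocks of a vertex can be added
    give the factor 1/j! of the Poisson weight. The exponential bound has to see the factor p: there
    are C(n,d+1) independent coordinates, of order n^(d+1), for which a bounded difference
    inequality without variances is too weak, whereas C(n,d+1) p <= n lam leaves a total variance of
    order n. Test functions are merely continuous on a non-compact space, so the radius at which one
    is nearly constant depends on the tree; a common radius and finitely many explorations are
    chosen by means of the limit law alone. The resulting lower bound for nonnegative functions is
    applied to f + M and to M - f, which gives both inequalities for f. *)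

Section exploration.
Variables (n d : nat) (E : {set {set 'I_n}}) (v : 'I_n).
Implicit Types (u w : address d) (x y : 'I_n) (e : {set 'I_n}).

(** The size test makes the exploration meaningful for every family of sets, since the expectations
    and the bounded difference estimate below range over arbitrary families. *)
Definition incident x := [set e in E | (#|e| == d.+1) && (x \in e)].

(* The vertex with label u and the hyperedge through which it is reached. The
   order in which [enum] lists sets makes the labelling canonical: a hypergraph
   and a root determine a single labelled tree. *)
Fixpoint state (u : seq (nat * 'I_d)) : 'I_n * {set 'I_n} :=
  if u is (b, i) :: w then
    let: (x, e) := state w in
    let e' := nth finset.set0 (enum (incident x :\ e)) b in
    (nth x (enum (e' :\ x)) i, e')
  else (v, finset.set0).

Definition vertex u := (state u).1.
Definition parent u := (state u).2.
Definition blocks u := enum (incident (vertex u) :\ parent u).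
Definition nblocks u := size (blocks u).

Lemma nblocksE u : nblocks u = #|incident (vertex u) :\ parent u|.
Proof. by rewrite /nblocks /blocks cardE. Qed.

Lemma mem_blocks u e : (e \in blocks u) =
  [&& e != parent u, e \in E, #|e| == d.+1 & vertex u \in e].
Proof. by rewrite mem_enum !inE. Qed.

Lemma parent_cons b i w : parent ((b, i) :: w) = nth finset.set0 (blocks w) b.
Proof. by rewrite /parent /blocks /vertex /parent /=; case: (state w). Qed.

Lemma vertex_cons b i w : vertex ((b, i) :: w) =
  nth (vertex w) (enum (nth finset.set0 (blocks w) b :\ vertex w)) i.
Proof. by rewrite /vertex /blocks /vertex /parent /=; case: (state w). Qed.

Lemma nth_blocks w b : (b < nblocks w)%N ->
  [/\ nth finset.set0 (blocks w) b \in E, #|nth finset.set0 (blocks w) b| = d.+1,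
      vertex w \in nth finset.set0 (blocks w) b & nth finset.set0 (blocks w) b != parent w].
Proof.
by move=> bw; have := mem_nth finset.set0 bw; rewrite mem_blocks => /and4P[-> -> /eqP-> ->].
Qed.

(** A block minus [vertex w] has exactly [d] elements, so the indices [i : 'I_d] run through its
    enumeration without reaching the default of [nth]. *)
Lemma block_image w b : (b < nblocks w)%N ->
  nth finset.set0 (blocks w) b = vertex w |: [set vertex ((b, i) :: w) | i : 'I_d].
Proof.
move=> bw; have [_ ed xe _] := nth_blocks bw.
set e := nth _ _ _ in ed xe *.
have se : size (enum (e :\ vertex w)) = d.
  by apply/eqP; rewrite -cardE -eqSS -ed (cardsD1 (vertex w) e) xe.
apply/setP => y; rewrite !inE; case: (eqVneq y (vertex w)) => [->|yx] //=.
have ye : (y \in e) = (y \in enum (e :\ vertex w)) by rewrite mem_enum !inE yx.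
rewrite ye; apply/idP/imsetP => [ye'|[i _ ->]].
  have ilt : (index y (enum (e :\ vertex w)) < d)%N by rewrite -[X in (_ < X)%N]se index_mem.
  exists (Ordinal ilt) => //=; rewrite vertex_cons -/e /= nth_index//.
by rewrite vertex_cons mem_nth// se.
Qed.

Lemma parentP b i w : (b < nblocks w)%N ->
  [/\ parent ((b, i) :: w) \in E, #|parent ((b, i) :: w)| = d.+1,
      vertex w \in parent ((b, i) :: w) &
      vertex ((b, i) :: w) \in parent ((b, i) :: w)].
Proof.
move=> bw; rewrite parent_cons; have [-> -> -> _] := nth_blocks bw; split=> //.
by rewrite block_image// inE; apply/orP; right; apply: imset_f.
Qed.

End exploration.

(** * Offspring functions truncated at depth t *)

Section prune.
Variable d : nat.
Implicit Types (N : address d -> nat) (u : address d).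

(** The value 0 elsewhere makes this a canonical form: equality of two pruned functions says that
    the offspring numbers agree at all live labels of depth at most t, and [prune t m = m] singles
    out the canonical functions. *)
Definition prune t N : address d -> nat :=
  fun u => if gw_alive N u && (size u <= t)%N then N u else 0%N.

Lemma alive_prune t N u :
  gw_alive (prune t N) u = gw_alive N u && (size u <= t.+1)%N.
Proof.
elim: u => // -[b i] u IH /=; rewrite IH /prune ltnS.
case: (gw_alive N u) => /=; last by rewrite !andbF.
case: (leqP (size u) t) => [ut|tu]; last by rewrite ltn0 andbF.
by rewrite (leq_trans ut) ?andbT.
Qed.

Lemma pruneK t N u : prune t (prune t N) u = prune t N u.
Proof.
rewrite {1}/prune alive_prune; case: ifP => //.
rewrite /prune; case: (gw_alive N u) => //=; case: (leqP (size u) t) => // ut.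
by rewrite (leq_trans ut).
Qed.

Lemma pruneE t N u : gw_alive N u -> (size u <= t)%N -> prune t N u = N u.
Proof. by rewrite /prune => -> ->. Qed.

End prune.

(** * Locality of the exploration *)

Section locality.
Variables (n d : nat).
Implicit Types (E : {set {set 'I_n}}) (v : 'I_n) (u w : address d).

Definition same_at E E' x :=
  forall e : {set 'I_n}, #|e| = d.+1 -> x \in e -> (e \in E) = (e \in E').

Lemma incident_same E E' x : same_at E E' x -> incident d E x = incident d E' x.
Proof.
move=> s; apply/setP => e; rewrite !inE; case: eqP => //= ed; last by rewrite !andbF.
by case: (boolP (x \in e)) => xe; rewrite ?andbF// s.
Qed.

(** Labels list the latest generation first, so the proper suffixes of [w] are its ancestors; the
    recursion for [state] consults the hyperedges at these alone. *)
Lemma state_local E E' v w :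
  (forall a, a != w -> suffix a w -> same_at E E' (vertex E v a)) ->
  state E v w = state E' v w.
Proof.
elim: w => // -[b i] w IH h /=; rewrite -IH.
  have: same_at E E' (vertex E v w).
    apply: h; last by rewrite suffix_cons.
    by apply/eqP => /(congr1 size) /= /n_Sn.
  by rewrite /vertex; case: (state E v w) => x e /= /incident_same->.
move=> a aw sa; apply: h; last by rewrite (suffix_trans sa)// suffix_cons.
by apply/eqP => e; move/size_suffix: sa; rewrite e /= ltnn.
Qed.

Lemma nblocks_local E E' v w :
  (forall a, suffix a w -> same_at E E' (vertex E v a)) ->
  nblocks E v w = nblocks E' v w.
Proof.
move=> h; have sE : state E v w = state E' v w by apply: state_local => a _; exact: h.
by rewrite !nblocksE /vertex /parent -sE (incident_same (h w (suffix_refl w))).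
Qed.

Lemma alive_suffix (N : address d -> nat) a w : suffix a w -> gw_alive N w -> gw_alive N a.
Proof.
move=> /suffixP[s ->]; elim: s => // -[b i] s IH /= /andP[_]; exact: IH.
Qed.

Variable t : nat.

(** Offspring numbers stop at depth t, but injectivity includes live labels of depth t+1: it has to
    separate all vertices of the hyperedges met at depth t, so that none of these closes a cycle. *)
Definition explores (m : address d -> nat) E v :=
  prune t (nblocks E v) = m /\
  forall u w, gw_alive m u -> gw_alive m w -> vertex E v u = vertex E v w -> u = w.

Section same.
Variables (m : address d -> nat) (E E' : {set {set 'I_n}}) (v : 'I_n).
Hypothesis same : forall u, gw_alive m u -> (size u <= t)%N -> same_at E E' (vertex E v u).
Hypothesis Em : explores m E v.

Lemma explores_state u : gw_alive m u -> state E v u = state E' v u.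
Proof.
move=> au; apply: state_local => a ane sa.
apply: same; first exact: alive_suffix au.
have ut : (size u <= t.+1)%N by move: au; case: Em => <- _; rewrite alive_prune => /andP[].
(* A proper ancestor of a label of depth at most t+1 has depth at most t. *)
rewrite -ltnS; apply: leq_trans ut.
rewrite ltn_neqAle size_suffix// andbT; apply/eqP => e.
case/suffixP: sa => s us; move/(congr1 size): (us); rewrite size_cat e => ss.
case: s us ss => [us|? ? _ /= ss]; last by lia.
by rewrite us eqxx in ane.
Qed.

(** The exploration reads only the hyperedges at live labels of depth at most t. This serves both
    for changing one hyperedge and for capturing a tree inside a larger hypergraph. *)
Lemma explores_same : explores m E' v.
Proof.
case: Em => mE inj.
have a1 u : gw_alive m u = gw_alive (nblocks E v) u && (size u <= t.+1)%N.
  by rewrite -mE alive_prune.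
have nb u : gw_alive m u -> (size u <= t)%N -> nblocks E v u = nblocks E' v u.
  move=> au ut; apply: nblocks_local => a sa; apply: same; first exact: alive_suffix au.
  exact: leq_trans (size_suffix sa) ut.
have al u : (size u <= t.+1)%N -> gw_alive (nblocks E v) u = gw_alive (nblocks E' v) u.
  elim: u => // -[b i] u IH /= ut; rewrite -IH; last exact: ltnW.
  case au : (gw_alive (nblocks E v) u); last by rewrite !andbF.
  by rewrite nb// a1 au /= ltnW.
split.
  rewrite -mE; apply/funext => u; rewrite /prune.
  case: (leqP (size u) t) => ut; last by rewrite !andbF.
  rewrite !andbT al; last exact: leqW.
  case: ifP => // au; rewrite nb// a1 al ?au ltnW//.
move=> u w au aw; rewrite /vertex -!explores_state//; exact: inj.
Qed.
End same.

End locality.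

(** * Explored balls and balls of the block tree *)

Section local_isomorphism.
Variables (R : realType) (n d t : nat) (m : address d -> nat).
Variables (E : {set {set 'I_n}}) (v : 'I_n).
Hypothesis Ek : {in E, forall e : {set 'I_n}, #|e| = d.+1}.
Hypothesis Em : explores t m E v.
Implicit Types (u w a : address d) (S : {set 'I_n}).
Local Notation N := (nblocks E v).
Local Notation vx := (vertex E v).
Local Notation bk w b := (nth finset.set0 (blocks E v w) b).
Local Notation G := (@line_graph R 1 n E).

Let inblk w b u := u = w \/ exists i, u = (b, i) :: w.

Let inj u w : gw_alive N u -> (size u <= t.+1)%N ->
  gw_alive N w -> (size w <= t.+1)%N -> vx u = vx w -> u = w.
Proof.
move=> au us aw ws; case: Em => mE; apply.
  by rewrite -mE alive_prune au.
by rewrite -mE alive_prune aw.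
Qed.

Let inblk_alive w b u : gw_alive N w -> (size w <= t)%N -> (b < N w)%N ->
  inblk w b u -> gw_alive N u /\ (size u <= t.+1)%N.
Proof.
by move=> aw wt bw [->|[i ->]] /=; [split=> //; exact: leqW|rewrite aw bw].
Qed.

Let vx_blk w b u : (b < N w)%N -> inblk w b u -> vx u \in bk w b.
Proof.
move=> bw [->|[i ->]]; rewrite block_image// !inE ?eqxx//.
by apply/orP; right; exact: imset_f.
Qed.

Let blk_vx w b x : (b < N w)%N -> x \in bk w b -> exists2 u, inblk w b u & x = vx u.
Proof.
move=> bw; rewrite block_image// !inE => /orP[/eqP->|/imsetP[i _ ->]].
  by exists w => //; left.
by exists ((b, i) :: w) => //; right; exists i.
Qed.

(** A hyperedge at an explored vertex is either the one through which the vertex was reached, hence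
    a block of the parent label, or one of its own blocks. *)
Let incident_blk u e : gw_alive N u -> (size u <= t)%N -> e \in E -> vx u \in e ->
  exists w b, [/\ gw_alive N w, (size w <= t)%N, (b < N w)%N, inblk w b u & e = bk w b].
Proof.
move=> au ut eE ue; case: (eqVneq e (parent E v u)) => [ep|enp].
  (* The root has the dummy parent [set0], which is no hyperedge because of its cardinality. *)
  case: u ep au ut ue => [ep|[b i] w ep /= /andP[bw aw] wt ue].
    by move: (Ek eE); rewrite ep finset.cards0.
  exists w, b; split=> //; first exact: ltnW.
    by right; exists i.
  by rewrite ep parent_cons.
have eb : e \in blocks E v u by rewrite mem_blocks enp eE (Ek eE) eqxx.
exists u, (index e (blocks E v u)); split=> //.
- by rewrite index_mem.
- by left.
- by rewrite nth_index.
Qed.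

Let incident_blk2 u u' e : gw_alive N u -> (size u <= t)%N ->
  gw_alive N u' -> (size u' <= t)%N -> e \in E -> vx u \in e -> vx u' \in e ->
  exists w b, [/\ inblk w b u, inblk w b u' & e = bk w b].
Proof.
move=> au ut au' ut' eE ue ue'.
have [w [b [aw wt bw iu ee]]] := incident_blk au ut eE ue.
exists w, b; split=> //; move: ue'; rewrite ee => /(blk_vx bw)[u'' iu''].
have [au'' us] := inblk_alive aw wt bw iu''.
by move/inj => -> //; exact: leqW.
Qed.

Let blk_near w b u u' : inblk w b u -> inblk w b u' -> u <> u' -> gw_near u u'.
Proof.
move=> [->|[i ->]] [->|[j ->]] ne; rewrite /gw_near /= ?eqxx ?orbT//=.
by rewrite (_ : i != j) ?orbT//; apply/eqP => ij; rewrite ij in ne.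
Qed.

(** Together with the injectivity of [vertex], this is why all edges of an explored ball have weight
    1. *)
Let blk_uniq w b w' b' u u' : inblk w b u -> inblk w b u' -> inblk w' b' u ->
  inblk w' b' u' -> u <> u' -> w = w' /\ b = b'.
Proof.
move=> i1 i2 i3 i4 ne; move: i1 i2 i3 i4 ne.
case=> [->|[i ->]] [->|[j ->]] [e1|[i' e1]] [e2|[j' e2]] ne //;
  move: (congr1 size e1) (congr1 size e2) => /= s1 s2; try lia.
- by case: e2.
- by case: e1.
- by case: ne; rewrite e1 e2.
- by case: e1 => -> _ ->.
Qed.

Let adjG u u' e : vx u <> vx u' -> e \in E -> vx u \in e -> vx u' \in e ->
  adj G [set vx u]%SET [set vx u']%SET.
Proof.
move=> ne eE ue ue'; apply/and4P; split; rewrite ?cards1//.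
  by apply/eqP => /finset.set1_inj.
by apply/existsP; exists e; rewrite eE !finset.sub1set ue ue'.
Qed.

Variable oG : [set v]%SET \in vset G.
Local Notation C := (rooted_component oG).
Local Notation GW := (@gw_graph R d m).

Let walkC u : gw_alive N u -> (size u <= t.+1)%N ->
  exists2 p, walk C [set v]%SET [set vx u]%SET p & size p = size u.
Proof.
elim: u => [|[b i] w IH] /=; first by exists [::].
move=> /andP[bw aw] wt; have [p Cp ps] := IH aw (ltnW wt).
have a : adj G [set vx w]%SET [set vx ((b, i) :: w)]%SET.
  have [eE _ we ue] := parentP i bw; apply: adjG eE we ue.
  have cw : gw_alive N ((b, i) :: w) by rewrite /= bw aw.
  by move=> /(inj aw (ltnW wt) cw wt) /(congr1 size) /= ?; lia.
have Gw : walk G [set vx w]%SET [set vx ((b, i) :: w)]%SET [:: [set vx ((b, i) :: w)]%SET].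
  by split=> //; apply/andP; split=> //; exact: a.
have Gp := walk_induced Cp; have Gp' := walk_cat Gp Gw.
exists (p ++ [:: [set vx ((b, i) :: w)]%SET]); last by rewrite size_cat /= addn1 ps.
apply: (walk_cat Cp); split=> //; apply/andP; split=> //.
apply/and3P; split; last exact: a.
  by apply/asboolP; exists p.
by apply/asboolP; eexists; exact: Gp'.
Qed.

Let walkC_inv S p : walk C [set v]%SET S p -> (size p <= t)%N ->
  exists u, [/\ gw_alive N u, (size u <= size p)%N & S = [set vx u]%SET].
Proof.
elim/last_ind: p S => [|p x IH] S.
  by case=> _ /= <- _; exists [::].
rewrite size_rcons => -[]; rewrite rcons_path last_rcons => /andP[pp px] <- pt.
have [u [au us ue]] := IH _ (conj pp erefl) (ltnW pt).
move: px; rewrite ue => /and3P[_ _ /and4P[_ /cards1P[y ->] ne /existsP[e /and3P[eE]]]].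
rewrite !finset.sub1set => ux yx.
have ut : (size u <= t)%N by apply: leq_trans us (ltnW pt).
have [w [b [aw wt bw iu ee]]] := incident_blk au ut eE ux.
move: yx; rewrite ee => /(blk_vx bw)[u' iu' yu'].
have [au' us'] := inblk_alive aw wt bw iu'.
exists u'; split=> //; last by rewrite yu'.
(* Both labels lie in one block, so a step of the walk increases the depth by at most one. *)
by case: iu iu' us => [->|[i ->]] [->|[j ->]] /=; lia.
Qed.

Lemma explores_agree : agree (rclass C) (rclass GW) t.
Proof.
apply/agree_rclass.
have amE u : gw_alive m u = gw_alive N u && (size u <= t.+1)%N.
  by case: Em => <- _; rewrite alive_prune.
have bE u : u \in vset (rball GW [::] t) <-> gw_alive N u /\ (size u <= t)%N.
  split=> [/gw_rball[]|[au ut]]; first by rewrite amE => /andP[].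
  by apply/gw_rball; rewrite amE au leqW.
have bC u : gw_alive N u -> (size u <= t)%N -> [set vx u]%SET \in vset (rball C [set v]%SET t).
  move=> au ut; have [p Cp ps] := walkC au (leqW ut).
  apply: (in_rballT _ Cp); last by rewrite ps.
  exact: (root_vset C).
have adE u u' : u \in vset (rball GW [::] t) ->
    u' \in vset (rball GW [::] t) ->
    adj (rball GW [::] t) u u' =
    adj (rball C [set v]%SET t) [set vx u]%SET [set vx u']%SET.
  move=> bu bu'; have [au ut] := (bE u).1 bu; have [au' ut'] := (bE u').1 bu'.
  have bCu := bC u au ut; have bCu' := bC u' au' ut'.
  have cu : [set vx u]%SET \in vset C by have /in_rball[] := bCu.
  have cu' : [set vx u']%SET \in vset C by have /in_rball[] := bCu'.
  rewrite (adj_induced bu bu') (etrans (adj_induced bCu bCu') (adj_induced cu cu')).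
  rewrite /=; apply/idP/idP.
    move=> /and3P[_ _ nuu].
    have ne : vx u <> vx u'.
      by move=> /inj e; move: nuu; rewrite e ?gw_near_irr// leqW.
    have [w [b [bw iu iu']]] : exists w b, [/\ (b < N w)%N, inblk w b u & inblk w b u'].
      clear -au au' nuu; case/or3P: nuu.
      - case: u' au' => // -[b i] w /= /andP[bw _] /eqP uw; subst u.
        exists w, b; split=> //; [by left|by right; exists i].
      - case: u au => // -[b i] w /= /andP[bw _] /eqP uw; subst u'.
        exists w, b; split=> //; [by right; exists i|by left].
      - case: u au => // -[b i] w /= /andP[bw _].
        case: u' au' => // -[c j] w' /= _ /and3P[/eqP<- /eqP<- _].
        by exists w, b; split=> //; right; [exists i|exists j].
    have [eE _ _ _] := nth_blocks bw.
    by apply: (adjG ne eE); exact: vx_blk.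
  move=> /and4P[_ _ ne /existsP[e /and3P[eE]]]; rewrite !finset.sub1set => ue ue'.
  rewrite !amE au au' !leqW//=.
  have [w [b [iu iu' _]]] := incident_blk2 au ut au' ut' eE ue ue'.
  apply: (blk_near iu iu') => e1; by rewrite e1 eqxx in ne.
(* The isomorphism is built from the tree side, where the map from labels to vertices is
   explicit. *)
apply: riso_sym; first exact: (root_rball GW t).
exists (fun u => [set vx u]%SET); split=> //.
- split.
  + by move=> u /= /bE[au ut]; exact: bC.
  + move=> u u' /set_mem /= /bE[au ut] /set_mem /= /bE[au' ut'] /finset.set1_inj.
    by apply: inj => //; exact: leqW.
  + move=> S /= /in_rball[_ [p Cp pt]].
    have [u [au us ->]] := walkC_inv Cp pt.
    by exists u => //=; apply/bE; split=> //; exact: leq_trans us pt.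
- move=> u u' bu bu' ad.
  have := ad; rewrite adE// => /and3P[_ _ /and3P[_ _ /and4P[_ _ ne /existsP[e /and3P[eE]]]]].
  rewrite !finset.sub1set => ue ue'.
  have [au ut] := (bE u).1 bu; have [au' ut'] := (bE u').1 bu'.
  rewrite /= (_ : [set _ in _ | _]%SET = [set e]%SET) ?cards1//.
  have nuu : u <> u' by move=> uu; rewrite uu eqxx in ne.
  apply/setP => e'; rewrite !inE !finset.sub1set; apply/idP/eqP => [/and3P[e'E h h']|->]; last first.
    by rewrite eE ue ue'.
  have [w [b [i1 i2 ->]]] := incident_blk2 au ut au' ut' e'E h h'.
  have [w' [b' [i3 i4 ->]]] := incident_blk2 au ut au' ut' eE ue ue'.
  by have [-> ->] := blk_uniq i1 i2 i3 i4 nuu.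
Qed.

End local_isomorphism.

(** * Effect of one hyperedge on the number of explored roots *)

Lemma card_bigcup_le (I T : finType) (A : {set I}) (F : I -> {set T}) c :
  (forall i, i \in A -> #|F i| <= c)%N -> (#|\bigcup_(i in A) F i| <= #|A| * c)%N.
Proof.
move=> Fc; apply: (@leq_trans (\sum_(i in A) #|F i|)).
  elim/big_rec2: _ => [|i x y _ xy]; first by rewrite finset.cards0.
  by apply: leq_trans (leq_card_setU _ _) _; rewrite leq_add2l.
by rewrite -sum_nat_const leq_sum.
Qed.

Section lipschitz.
Import boot.fintype boot.finset.
Variables (n d t K : nat) (m : address d -> nat).
Hypothesis mK : forall u, gw_alive m u -> (size u <= t)%N -> (m u < K)%N.
Implicit Types (E : {set {set 'I_n}}) (u : address d).

Definition explored E := [set v | `[< explores t m E v >]].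

Lemma exploredP E v : reflect (explores t m E v) (v \in explored E).
Proof. by rewrite inE; exact: asboolP. Qed.

(** Walk back from [x] towards the root: [x] is an interior vertex, so few hyperedges contain it,
    and the vertex of the parent label lies in one of them. Each generation costs a factor
    K(d+1). *)
Lemma card_explored_vertex E u x : gw_alive m u -> (size u <= t)%N ->
  (#|[set v in explored E | vertex E v u == x]| <= (K * d.+1) ^ size u)%N.
Proof.
elim: u x => [|[b i] w IH] x.
  move=> _ _; rewrite expn0 -(cards1 x); apply: subset_leq_card.
  by apply/subsetP => v; rewrite !inE => /andP[_].
move=> au ut; have /andP[bw aw] : (b < m w)%N && gw_alive m w := au.
set u := (b, i) :: w in au ut *.
have interior v : v \in explored E -> nblocks E v u = m u /\ nblocks E v w = m w.
  move=> /exploredP[mE _]; rewrite -mE /prune.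
  by move: au aw; rewrite -mE !alive_prune => /andP[-> _] /andP[-> _]; rewrite ut (ltnW ut).
have [->|[v0]] := set_0Vmem [set v in explored E | vertex E v u == x].
  by rewrite cards0.
rewrite inE => /andP[v0E /eqP v0x].
pose nb := \bigcup_(e in incident d E x) e.
have nbK : (#|nb| <= K * d.+1)%N.
  apply: leq_trans (card_bigcup_le (c := d.+1) _) _.
    by move=> e; rewrite inE => /and3P[_ /eqP-> _].
  (* [nblocks] leaves out the parent hyperedge; the strict bound [m u < K] makes room for it. *)
  rewrite leq_mul2r /=; have [e _] := interior _ v0E.
  have := mK au ut; rewrite -e nblocksE v0x; set I := incident _ _ _.
  by apply: leq_trans; rewrite (cardsD1 (parent E v0 u) I) -add1n leq_add2r leq_b1.
have sub : ([set v in explored E | vertex E v u == x]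
    \subset \bigcup_(y in nb) [set v in explored E | vertex E v w == y]).
  apply/subsetP => v; rewrite inE => /andP[vE /eqP vx].
  apply/bigcupP; exists (vertex E v w); last by rewrite inE vE eqxx.
  have [_ nw] := interior _ vE; move: bw; rewrite -nw => /(parentP i)[h1 /eqP h2 h3 h4].
  by apply/bigcupP; exists (parent E v u) => //; rewrite inE h1 h2 -vx.
apply: leq_trans (subset_leq_card sub) _; rewrite expnS.
apply: leq_trans (card_bigcup_le (c := ((K * d.+1) ^ size w)%N) _) _.
  by move=> y _; apply: IH => //; exact: ltnW.
by rewrite leq_mul2r nbK orbT.
Qed.

Variable us : seq (address d).
Hypothesis usP : forall u, gw_alive m u -> (size u <= t)%N -> u \in us.

(** The d+1 vertices of the changed hyperedge, times the labels at which it may be met, times the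
    number of roots per label; the successor in the base allows raising every exponent to t. *)
Definition lip_const := (d.+1 * (size us * (K * d.+1).+1 ^ t))%N.

(** A root explored in [E] but not in [E'] has an interior vertex in [e0], since otherwise locality
    transfers the exploration. The hypothesis is symmetric in [E] and [E'], so additions and
    deletions are both covered. *)
Lemma card_explored_lip E E' (e0 : {set 'I_n}) :
  (forall e, e != e0 -> (e \in E) = (e \in E')) ->
  (#|explored E| <= #|explored E'| + lip_const)%N.
Proof.
(* A set of another size is invisible to the exploration. *)
move=> EE'; case: (eqVneq #|e0| d.+1) => [ed|ned]; last first.
  apply: leq_trans (leq_addr _ _); apply: subset_leq_card.
  apply/subsetP => v /exploredP Ev; apply/exploredP.
  apply: (explores_same _ Ev) => u _ _ e ek _; apply: EE'.
  by apply: contraNneq ned => <-; rewrite ek.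
pose bad x := [set v in explored E | has (fun u => [&& gw_alive m u,
   (size u <= t)%N & vertex E v u == x]) us].
have sub : (explored E \subset explored E' :|: \bigcup_(x in e0) bad x).
  apply/subsetP => v vE; rewrite inE; apply/orP.
  have [b|nb] := boolP (v \in \bigcup_(x in e0) bad x); [by right|left].
  move: (vE) => /exploredP Ev; apply/exploredP.
  apply: (explores_same _ Ev) => u au ut e ek ue; apply: EE'.
  apply: contraNneq nb => ee; apply/bigcupP; exists (vertex E v u); first by rewrite -ee.
  by rewrite inE vE /=; apply/hasP; exists u; rewrite ?usP// au ut /=.
apply: leq_trans (subset_leq_card sub) _.
apply: leq_trans (leq_card_setU _ _) _; rewrite leq_add2l /lip_const -[X in (X * _)%N]ed.
apply: card_bigcup_le => x _; rewrite /bad.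
elim: (us) => [|u s IH] /=.
  by rewrite eq_card0// => v; rewrite !inE /= andbF.
pose S := [set v in explored E | [&& gw_alive m u, (size u <= t)%N & vertex E v u == x]].
rewrite mulSn; apply: leq_trans (leq_add (_ : #|S| <= _)%N IH).
  apply: leq_trans (leq_card_setU _ _); apply: subset_leq_card.
  apply/subsetP => v; rewrite inE => /andP[vE /orP[h|h]]; rewrite in_setU; apply/orP.
    by left; rewrite inE vE; exact: h.
  by right; rewrite inE vE.
have [/andP[au ut]|na] := boolP (gw_alive m u && (size u <= t)%N); last first.
  by rewrite eq_card0// => v; rewrite inE; apply/negbTE; apply: contraNN na => /and4P[_ -> ->].
apply: (@leq_trans ((K * d.+1) ^ size u)%N).
  apply: leq_trans (card_explored_vertex E x au ut); apply: subset_leq_card.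
  by apply/subsetP => v; rewrite !in_set => /and4P[-> _ _ ->].
apply: (@leq_trans ((K * d.+1).+1 ^ size u)%N); first by case: (size u) => // e; rewrite leq_exp2r.
by rewrite leq_pexp2l.
Qed.

End lipschitz.

(** * Counting hypertrees with prescribed exploration *)

Section exploration_order.
Variable d : nat.
Implicit Types (u w : address d) (l : seq (address d * nat)).

(** An order in which a tree can be grown: a label is appended once its parent label is listed with
    enough blocks. Unlisted children are leaves, so partially grown trees are described too. *)
Inductive parents_first : seq (address d * nat) -> Prop :=
| parents_first_nil : parents_first [::]
| parents_first_rcons l u j : parents_first l -> u \notin unzip1 l ->
    (u = [::] \/ exists b i w c, [/\ u = (b, i) :: w, (w, c) \in l & (b < c)%N]) ->
    parents_first (rcons l (u, j)).

Lemma parents_first_parent l b i w j : parents_first l -> ((b, i) :: w, j) \in l ->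
  exists2 c, (w, c) \in l & (b < c)%N.
Proof.
elim=> // {}l u {}j' el IH _ uw; rewrite mem_rcons inE => /orP[/eqP[e _]|/IH[c wc bc]].
  case: uw => [|[b' [i' [w' [c [e' wc bc]]]]]]; rewrite -e //.
  by move: e'; rewrite -e => -[-> _ ->]; exists c; rewrite // mem_rcons inE wc orbT.
by exists c; rewrite // mem_rcons inE wc orbT.
Qed.

Lemma mem_unzip1 l u : reflect (exists j, (u, j) \in l) (u \in unzip1 l).
Proof.
apply: (iffP mapP) => [[[w j] wl /= ->]|[j uj]]; first by exists j.
by exists (u, j).
Qed.

Lemma parents_first_suffix l a u : parents_first l -> u \in unzip1 l -> suffix a u -> a \in unzip1 l.
Proof.
move=> el; elim: u => [|[b i] w IH] ul; first by rewrite suffixs0 => /eqP->.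
move=> /suffixP[[|x s] /= e]; first by rewrite -e.
case/mem_unzip1: ul => j /(parents_first_parent el)[c wc _].
apply: IH; first by apply/mem_unzip1; exists c.
by case: e => _ ->; exact: suffix_suffix.
Qed.

Lemma parents_first_uniq l : parents_first l -> uniq (unzip1 l).
Proof. by elim=> // {}l u j _ ul un _; rewrite /unzip1 map_rcons rcons_uniq un. Qed.

Definition labels l : seq (address d) := [::] ::
  flatten [seq [seq (b, i) :: p.1 | b <- iota 0 p.2, i <- enum 'I_d] | p <- l].

Lemma labelsP l u : u \in labels l <->
  u = [::] \/ exists b i w c, [/\ u = (b, i) :: w, (w, c) \in l & (b < c)%N].
Proof.
rewrite inE; split=> [/orP[/eqP->|/flatten_mapP[[w c] wc]]|]; first by left.
  move=> /allpairsP[[b i] [/= + _ ->]]; rewrite mem_iota add0n => bc.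
  by right; exists b, i, w, c.
case=> [->//|[b [i [w [c [-> wc bc]]]]]]; apply/orP; right.
apply/flatten_mapP; exists (w, c) => //; apply/allpairsP; exists (b, i).
by rewrite /= mem_iota mem_enum.
Qed.

Lemma size_labels l : size (labels l) = (1 + d * sumn (unzip2 l))%N.
Proof.
rewrite /labels /= add1n; congr _.+1; elim: l => [|p l IH] /=; first by rewrite muln0.
by rewrite size_cat IH size_allpairs size_iota size_enum_ord mulnDr mulnC.
Qed.

Lemma labels_suffix l a u : parents_first l -> u \in labels l -> suffix a u -> a != u ->
  a \in unzip1 l.
Proof.
move=> el /labelsP[->|[b [i [w [c [-> wc bc]]]]]].
  by rewrite suffixs0 => ->.
move=> /suffixP[[|x s] /= e]; first by rewrite -e eqxx.
move=> _; apply: (parents_first_suffix el) (_ : suffix a w); first by apply/mem_unzip1; exists c.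
by case: e => _ ->; exact: suffix_suffix.
Qed.

Lemma parents_first_labels l u : parents_first l -> u \in unzip1 l -> u \in labels l.
Proof.
move=> el /mem_unzip1[j ul]; apply/labelsP; case: u ul => [|[b i] w] ul; first by left.
by have [c wc bc] := parents_first_parent el ul; right; exists b, i, w, c.
Qed.

Lemma labels_rcons l p u : u \in labels l -> u \in labels (rcons l p).
Proof.
move=> /labelsP h; apply/labelsP; case: h => [|[b [i [w [c [-> wc bc]]]]]]; first by left.
by right; exists b, i, w, c; rewrite mem_rcons inE wc orbT.
Qed.

End exploration_order.

Section trees.
Import boot.fintype boot.finset.
Variables (n d : nat) (v : 'I_n).
Implicit Types (u w : address d) (l : seq (address d * nat)) (D E : {set {set 'I_n}}).

Definition touches D l (e : {set 'I_n}) := has (fun p => vertex D v p.1 \in e) l.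

(* The third condition, that each hyperedge brings d new vertices, forbids cycles. *)
Definition tree l D := [&& all (fun p => nblocks D v p.1 == p.2) l,
  [forall e in D, (#|e| == d.+1) && touches D l e],
  #|v |: cover D| == (1 + d * #|D|)%N & #|D| == sumn (unzip2 l)].

(** Some listed vertex touches [e]; then [e] is one of its blocks, or its parent hyperedge and hence
    a block of the parent label, which is listed as well. *)
Lemma tree_block l D e : parents_first l -> tree l D -> e \in D ->
  exists w c b, [/\ (w, c) \in l, nblocks D v w = c, (b < c)%N &
    e = nth set0 (blocks D v w) b].
Proof.
move=> el /and4P[/allP ln /forallP/(_ e)/implyP h _ _] eD.
have /andP[/eqP ed /hasP[[w c] wc /= we]] := h eD.
have /eqP /= nw := ln _ wc.
case: (eqVneq e (parent D v w)) => [ep|enp]; last first.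
  have eb : e \in blocks D v w by rewrite mem_blocks enp eD ed eqxx.
  by exists w, c, (index e (blocks D v w)); split=> //; [rewrite -nw index_mem|rewrite nth_index].
case: w wc we nw ep => [|[b i] w] wc we nw ep.
  by move: ed; rewrite ep cards0.
have [c' wc' bc'] := parents_first_parent el wc.
by exists w, c', b; split=> //; [exact/eqP/(ln _ wc')|rewrite ep parent_cons].
Qed.

Lemma tree_image l D : parents_first l -> tree l D ->
  [seq vertex D v u | u <- labels l] =i (v |: cover D).
Proof.
move=> el tD y; rewrite in_setU1; have /and4P[/allP ln _ _ _] := tD.
apply/mapP/orP => [[u /labelsP[->|[b [i [w [c [-> wc bc]]]]]] ->]|].
- by left; rewrite eqxx.
- right; have /eqP /= nw := ln _ wc; rewrite -nw in bc.
  by have [pD _ _ vp] := parentP i bc; apply/bigcupP; exists (parent D v ((b, i) :: w)).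
case=> [/eqP->|/bigcupP[e eD ye]]; first by exists [::] => //; apply/labelsP; left.
have [w [c [b [wc nw bc ee]]]] := tree_block el tD eD.
move: ye; rewrite ee block_image ?nw// in_setU1 => /orP[/eqP->|/imsetP[i _ ->]].
  by exists w => //; apply: parents_first_labels => //; apply/mem_unzip1; exists c.
by exists ((b, i) :: w) => //; apply/labelsP; right; exists b, i, w, c.
Qed.

Lemma uniq_map_inj (T U : eqType) (f : T -> U) (s : seq T) :
  uniq (map f s) -> {in s &, injective f}.
Proof.
elim: s => // x s IH /= /andP[xs us] y z; rewrite !inE.
move=> /orP[/eqP->|ys] /orP[/eqP->|zs] // fe; last exact: IH fe.
  by case/negP: xs; rewrite fe; apply: map_f.
by case/negP: xs; rewrite -fe; apply: map_f.
Qed.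

(** The labels map onto [v |: cover D], which by the last two conditions of [tree] has exactly as
    many elements as there are labels. *)
Lemma tree_inj l D : parents_first l -> tree l D -> {in labels l &, injective (vertex D v)}.
Proof.
move=> el tD; apply: uniq_map_inj; have iE := tree_image el tD.
have /and4P[_ _ /eqP cD /eqP sD] := tD.
have se : size (enum (v |: cover D)) = size (map (vertex D v) (labels l)).
  by rewrite size_map size_labels -cardE cD sD.
have me : enum (v |: cover D) =i map (vertex D v) (labels l).
  by move=> y; rewrite mem_enum iE.
by rewrite -(eq_uniq se me) enum_uniq.
Qed.

(** A block at the newly listed [u] would be a block of some listed [w]. Then [u] is [w], which is
    excluded, or [u] is a child of [w] in this block, which makes the block the parent hyperedge of
    [u]. *)
Lemma tree_rcons0 l u D : parents_first (rcons l (u, 0%N)) -> tree l D -> tree (rcons l (u, 0%N)) D.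
Proof.
move=> el' tD.
have [el ul uu] : [/\ parents_first l, u \notin unzip1 l & u \in labels l].
  inversion el' as [e|l' u' j' el ul uu e].
    by move/(congr1 size): e; rewrite size_rcons.
  by have [? ? ?] := rcons_inj e; subst l' u' j'; split=> //; exact/labelsP.
have /and4P[ln /forallP De cD sD] := tD; apply/and4P; split=> //.
- rewrite all_rcons ln andbT /= nblocksE cards_eq0; apply/eqP/setP => e.
  rewrite !inE; apply/negbTE; apply/negP => /and4P[enp eD /eqP ed ue].
  have [w [c [b [wc nw bc ee]]]] := tree_block el tD eD.
  move: ue; rewrite ee block_image ?nw// in_setU1 => /orP[/eqP|/imsetP[i _]] ue.
    have wl : w \in unzip1 l by apply/mem_unzip1; exists c.
    by move/negP: ul; apply; rewrite (tree_inj el tD uu (parents_first_labels el wl) ue).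
  have bl : (b, i) :: w \in labels l by apply/labelsP; right; exists b, i, w, c.
  by move/negP: enp; apply; rewrite (tree_inj el tD uu bl ue) parent_cons ee.
- apply/forallP => e; apply/implyP => /(implyP (De e))/andP[-> h] /=.
  by rewrite /touches has_rcons; apply/orP; right.
- by rewrite /unzip2 map_rcons sumn_rcons addn0.
Qed.

End trees.

Section tree_count.
Import boot.fintype boot.finset.
Variables (n d : nat) (v : 'I_n).
Hypothesis d0 : (0 < d)%N.
Implicit Types (u w : address d) (l : seq (address d * nat)) (D E : {set {set 'I_n}}).
Local Notation tree := (@tree n d v).

Lemma parents_first_rconsE l u j : parents_first (rcons l (u, j)) ->
  [/\ parents_first l, u \notin unzip1 l & u \in labels l].
Proof.
move=> el; inversion el as [e|l' u' j' el' ul uu e].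
  by move/(congr1 size): e; rewrite size_rcons.
by have [? ? ?] := rcons_inj e; subst l' u' j'; split=> //; exact/labelsP.
Qed.

Section add_block.
Variables (l : seq (address d * nat)) (u : address d) (j : nat).
Variables (D : {set {set 'I_n}}) (Z : {set 'I_n}).
Hypothesis el : parents_first (rcons l (u, j)).
Hypothesis tD : tree (rcons l (u, j)) D.
Hypothesis ZF : Z \subset ~: (v |: cover D).
Hypothesis Zd : #|Z| = d.
Local Notation x := (vertex D v u).
Let e := x |: Z.
Let D' := e |: D.

Let labF w : w \in labels l -> vertex D v w \in v |: cover D.
Proof. by move=> wl; rewrite -(tree_image el tD); apply: map_f; exact: labels_rcons. Qed.

Let FZ y : y \in v |: cover D -> y \notin Z.
Proof. by move=> yF; apply: contraL yF => yZ; move/subsetP/(_ y yZ): ZF; rewrite in_setC. Qed.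

Let eD : e \notin D.
Proof.
apply/negP => eD; have /set0Pn[z zZ] : Z != set0 by rewrite -card_gt0 Zd.
have : z \notin v |: cover D by move/subsetP/(_ z zZ): ZF; rewrite in_setC.
by rewrite in_setU1 negb_or => /andP[_ /negP[]]; apply/bigcupP; exists e => //; rewrite in_setU1 zZ orbT.
Qed.

Let xZ : x \notin Z.
Proof. by apply/FZ/labF; have [] := parents_first_rconsE el. Qed.

Let ed : #|e| = d.+1.
Proof. by rewrite cardsU1 xZ Zd. Qed.

Let same w : w \in labels l -> w != u -> same_at d D D' (vertex D v w).
Proof.
move=> wl wu e' _ we; rewrite /D' in_setU1; case: eqP => //= ee; exfalso.
move: we; rewrite ee in_setU1 (negbTE (FZ (labF wl))) orbF => /eqP.
have [_ _ ul] := parents_first_rconsE el.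
move/(tree_inj el tD (labels_rcons _ wl) (labels_rcons _ ul)) => wu'.
by rewrite wu' eqxx in wu.
Qed.

(** The children of [u] are left out: the enumeration may put the new hyperedge before old blocks of
    [u] and so relabel them. No listed offspring number depends on them, because [u] comes last. *)
Let stateE w : w \in labels l -> state D v w = state D' v w.
Proof.
have [el0 ul _] := parents_first_rconsE el.
move=> wl; apply: state_local => a aw sa.
have al := labels_suffix el0 wl sa aw.
by apply: same; [exact: parents_first_labels|apply: contraNneq ul => <-].
Qed.

Lemma vertex_add : vertex D' v u = x.
Proof. by have [_ _ ul] := parents_first_rconsE el; rewrite /vertex -stateE. Qed.

Let parent_neq : e != parent D v u.
Proof.
have [_ ul uu] := parents_first_rconsE el.
have /and4P[/allP ln _ _ _] := tD.
have /labelsP[->|[b [i [w [c [-> wc bc]]]]]] := uu.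
  by rewrite /parent /= -card_gt0 ed.
have /eqP /= nw : nblocks D v w == c.
  by apply: (ln (w, c)); rewrite mem_rcons inE wc orbT.
rewrite -nw in bc; have [pD _ _ _] := parentP i bc.
by apply: contraNneq eD => ->.
Qed.

Let parentE : parent D' v u = parent D v u.
Proof. by have [_ _ ul] := parents_first_rconsE el; rewrite /parent -stateE. Qed.

Lemma add_block_incident : e \in incident d D' (vertex D' v u) :\ parent D' v u.
Proof. by rewrite vertex_add parentE !inE parent_neq !eqxx ed eqxx. Qed.

(** Recovers the smaller tree from the new tree and the added hyperedge; with [add_block_newK] this
    makes the construction injective. *)
Lemma add_blockK : D' :\ e = D.
Proof. exact: setU1K. Qed.

Lemma add_block_newK : e :\ vertex D' v u = Z.
Proof. by rewrite vertex_add; exact: setU1K. Qed.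

(** The new hyperedge meets the old tree only in [x], so no other listed label sees it, and its d
    fresh vertices preserve the vertex count that excludes cycles. *)
Lemma tree_add_block : tree (rcons l (u, j.+1)) D'.
Proof.
have [el0 ul uu] := parents_first_rconsE el.
have /and4P[ln /forallP De /eqP cD /eqP sD] := tD.
move: ln; rewrite all_rcons /= => /andP[/eqP nu /allP ln].
have xF : x \in v |: cover D by exact: labF.
apply/and4P; split.
- rewrite all_rcons /=; apply/andP; split.
    rewrite nblocksE vertex_add parentE -nu nblocksE.
    rewrite (_ : _ :\ _ = e |: (incident d D x :\ parent D v u)).
      by rewrite cardsU1 !inE (negbTE eD) /= andbF.
    apply/setP => e'; rewrite !inE; case: (eqVneq e' e) => //= ->.
    by rewrite ed parent_neq eqxx setU11.
  apply/allP => -[w c] wc /=; have /eqP /= <- := ln _ wc; rewrite eq_sym; apply/eqP.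
  have wl : w \in unzip1 l by apply/mem_unzip1; exists c.
  apply: nblocks_local => a sa.
  have al := parents_first_suffix el0 wl sa.
  by apply: same; [exact: parents_first_labels|apply: contraNneq ul => <-].
- have tE e' : touches v D' (rcons l (u, j.+1)) e' = touches v D (rcons l (u, j)) e'.
    rewrite /touches !has_rcons /= vertex_add; congr (_ || _).
    apply: eq_in_has => -[w c] wc /=; rewrite /vertex -stateE//.
    by apply: parents_first_labels => //; apply/mem_unzip1; exists c.
  apply/forallP => e'; apply/implyP; rewrite tE in_setU1 => /orP[/eqP->|]; last exact/implyP.
  by rewrite ed eqxx /touches has_rcons /= in_setU1 eqxx.
- have cE : v |: cover D' = (v |: cover D) :|: Z.
    rewrite /cover bigcup_setU big_set1 /e; apply/setP => y.
    move: xF; rewrite !inE => /orP[xv|xc].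
      rewrite (eqP xv); case: (y == v) => //=.
      by rewrite orbC.
    case: (eqVneq y x) => [->|_]; first by rewrite xc !orbT.
    by rewrite /= -orbA; congr (_ || _); rewrite orbC.
  have /eqP dZ : (v |: cover D) :&: Z == set0.
    apply/eqP/setP => y; rewrite in_set0 in_setI; apply/negbTE/negP => /andP[/FZ/negP].
    by [].
  have := cardsUI (v |: cover D) Z; rewrite -cE dZ cards0 addn0 => ->.
  by rewrite cD Zd cardsU1 eD mulnDr muln1 -addnA (addnC d).
- by rewrite cardsU1 eD sD /unzip2 !map_rcons !sumn_rcons /= addnS.
Qed.

End add_block.

Definition trees l := [set D | tree l D].

Lemma card_dep_pair (S T : finType) (A : {set S}) (B : S -> {set T}) :
  #|[set q : S * T | (q.1 \in A) && (q.2 \in B q.1)]| = \sum_(x in A) #|B x|.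
Proof.
under eq_bigr do rewrite -sum1_card.
by rewrite pair_big_dep /= -sum1dep_card.
Qed.

(* Add below the last label u a block of d fresh vertices: the added block is one
   of the j+1 blocks of u, so a tree arises at most j+1 times. *)
Lemma card_trees_step l u j s : parents_first (rcons l (u, j)) ->
  (1 + d * sumn (unzip2 (rcons l (u, j))) <= s)%N ->
  (#|trees (rcons l (u, j))| * 'C(n - s, d) <= #|trees (rcons l (u, j.+1))| * j.+1)%N.
Proof.
move=> el ss.
pose B D := [set Z : {set 'I_n} | (Z \subset ~: (v |: cover D)) && (#|Z| == d)].
pose B' D := incident d D (vertex D v u) :\ parent D v u.
pose S := [set q : {set {set 'I_n}} * {set 'I_n} |
  (q.1 \in trees (rcons l (u, j))) && (q.2 \in B q.1)].
pose S' := [set q : {set {set 'I_n}} * {set 'I_n} |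
  (q.1 \in trees (rcons l (u, j.+1))) && (q.2 \in B' q.1)].
pose g (q : {set {set 'I_n}} * {set 'I_n}) :=
  ((vertex q.1 v u |: q.2) |: q.1, vertex q.1 v u |: q.2).
have SP q : q \in S -> [/\ tree (rcons l (u, j)) q.1,
    q.2 \subset ~: (v |: cover q.1) & #|q.2| = d].
  by rewrite !in_set => /and3P[-> -> /eqP].
have gS : g @: S \subset S'.
  apply/subsetP => _ /imsetP[q /SP[tq qF qd] ->].
  rewrite in_set /= in_set (tree_add_block el tq qF qd).
  exact: (add_block_incident el tq qF qd).
have gI : {in S &, injective g}.
  move=> q1 q2 /SP[t1 F1 d1] /SP[t2 F2 d2] [e1 e2].
  have DE : q1.1 = q2.1.
    by rewrite -(add_blockK u F1 d1) -(add_blockK u F2 d2) e1 e2.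
  have ZE : q1.2 = q2.2.
    by rewrite -(add_block_newK el t1 F1) -(add_block_newK el t2 F2) e1 e2.
  by case: q1 q2 DE ZE {t1 F1 d1 t2 F2 d2 e1 e2} => ? ? [? ?] /= -> ->.
have := subset_leq_card gS; rewrite card_in_imset// (card_dep_pair _ B) (card_dep_pair _ B').
have -> : \sum_(D in trees (rcons l (u, j.+1))) #|B' D| = (#|trees (rcons l (u, j.+1))| * j.+1)%N.
  rewrite -sum_nat_const; apply: eq_bigr => D; rewrite in_set => /and4P[/allP + _ _ _].
  move=> /(_ (u, j.+1)); rewrite mem_rcons mem_head => /(_ isT) /eqP /= <-.
  by rewrite nblocksE.
apply: leq_trans; rewrite -sum_nat_const; apply: leq_sum => D.
rewrite in_set => /and4P[_ _ /eqP cD /eqP sD].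
rewrite cards_draws; apply: leq_bin2l.
by rewrite cardsCs setCK card_ord leq_sub2l// cD sD.
Qed.

(** Growing the j blocks of a label one at a time divides by 1, 2, ..., j, whence the factorials. As
    [s] bounds the final number of vertices, every step can use the same binomial coefficient. *)
Lemma card_trees_ge l s : parents_first l -> (1 + d * sumn (unzip2 l) <= s)%N ->
  ('C(n - s, d) ^ sumn (unzip2 l) <= #|trees l| * \prod_(p <- l) p.2`!)%N.
Proof.
move=> el; elim: el s => [|{}l u j el IH ul uu] s ss.
  rewrite big_nil muln1 expn0 card_gt0; apply/set0Pn; exists set0.
  rewrite in_set; apply/and4P; split=> //=; last by rewrite cards0.
  - by apply/forallP => e; rewrite inE.
  - by rewrite /cover big_set0 setU0 cards1 cards0 muln0.
rewrite -cats1 big_cat big_seq1 /= cats1.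
have el' i : parents_first (rcons l (u, i)) by exact: parents_first_rcons.
elim: j ss => [|j IHj] ss.
  rewrite fact0 muln1; move: ss; rewrite /unzip2 map_rcons sumn_rcons addn0 => ss.
  apply: leq_trans (IH _ ss) _; rewrite leq_mul2r; apply/orP; right.
  apply: subset_leq_card; apply/subsetP => D; rewrite !in_set; exact: tree_rcons0.
have ss' : (1 + d * sumn (unzip2 (rcons l (u, j))) <= s)%N.
  apply: leq_trans ss; rewrite /unzip2 !map_rcons !sumn_rcons /=.
  by rewrite leq_add2l leq_mul2l leq_add2l leqnSn orbT.
have := IHj ss'; have := card_trees_step (el' j) ss'.
rewrite factS /unzip2 !map_rcons !sumn_rcons /= addnS expnS.
set c := 'C(_, _); set a := #|_|; set b := #|_|; set pr := (\prod_(p <- l) _)%N.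
move=> h1 h2; apply: (@leq_trans (c * (a * (pr * j`!)))%N).
  by rewrite leq_mul2l h2 orbT.
rewrite mulnA (mulnC c) (_ : (b * _ = (b * j.+1) * (pr * j`!))%N).
  by rewrite leq_mul2r h1 orbT.
by rewrite -!mulnA; congr (_ * _)%N; rewrite mulnCA.
Qed.

End tree_count.

(** * Interior labels as a finite list *)

Section interior.
Variables (d t : nat) (m : address d -> nat).
Hypothesis mt : prune t m = m.
Implicit Types (u w : address d) (l : seq (address d * nat)).

Definition lists_interior l := parents_first l /\
  forall u j, (u, j) \in l <-> [/\ gw_alive m u, (size u <= t)%N & j = m u].

(** Ordering by depth is enough, since a parent label is strictly shorter than its children. *)
Lemma parents_first_sorted (s : seq (address d)) : uniq s -> sorted (relpre size leq) s ->
  (forall b i w, (b, i) :: w \in s -> w \in s /\ (b < m w)%N) ->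
  parents_first [seq (u, m u) | u <- s].
Proof.
elim/last_ind: s => [|s u IH]; first by move=> *; exact: parents_first_nil.
rewrite rcons_uniq => /andP[us un] so ps; rewrite map_rcons.
have su w : w \in s -> (size w <= size u)%N.
  move=> ws; have tr : transitive (relpre (@size (nat * 'I_d)) leq).
    by move=> x y z /=; exact: leq_trans.
  move: so; rewrite -cats1 (sorted_pairwise tr) pairwise_cat.
  by case/and3P => + _ _ => /allrelP/(_ w u ws); rewrite inE eqxx; exact.
apply: parents_first_rcons.
- apply: IH => //; first by move: so; rewrite -cats1 => /cat_sorted2[].
  move=> b i w ws; have [] := ps b i w; first by rewrite mem_rcons inE ws orbT.
  rewrite mem_rcons inE => /orP[/eqP wu|//] _; have := su _ ws.
  by rewrite wu /= ltnn.
- by rewrite /unzip1 -map_comp map_id.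
- case: u {su so} us ps => [|[b i] w] us ps; [by left|right].
  have [] := ps b i w; first by rewrite mem_rcons inE eqxx.
  rewrite mem_rcons inE => /orP[/eqP/(congr1 size)/= /n_Sn//|ws bw].
  by exists b, i, w, (m w); split=> //; apply/mapP; exists w.
Qed.

(** The conditions range over the labels alive in [m], a fixed finite set, and not over those alive
    in [N]; for random [N] the event is therefore a product event. *)
Lemma prune_eqP N : prune t N = m <->
  (forall u, gw_alive m u -> (size u <= t)%N -> N u = m u).
Proof.
have m1 u : gw_alive m u -> (size u <= t.+1)%N by rewrite -mt alive_prune => /andP[].
split=> [Nm u au ut|Nm].
  by rewrite -Nm pruneE//; move: au; rewrite -Nm alive_prune => /andP[].
have al u : (size u <= t.+1)%N -> gw_alive N u = gw_alive m u.
  elim: u => // -[b i] u IH /= ut; rewrite IH; last exact: ltnW.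
  by case au : (gw_alive m u); rewrite ?andbF// Nm.
rewrite -[RHS]mt; apply/funext => u; rewrite /prune.
case: (leqP (size u) t) => ut; last by rewrite !andbF.
by rewrite !andbT al; [case: ifP => // au; exact: Nm|exact: leqW].
Qed.

(* R only serves to form [gw_graph], whose balls are finite. *)
Lemma lists_interior_exists (R : realType) : exists l, lists_interior l.
Proof.
have := finite_rball (@gw_graph R d m) t => /finite_seqP[s sE].
have sP u : u \in s <-> gw_alive m u /\ (size u <= t)%N.
  have <- : (u \in vset (rball (@gw_graph R d m) [::] t)) = (u \in s) :> Prop.
    exact: (congr1 (fun A : set (address d) => A u) sE).
  exact: gw_rball.
pose s' := sort (relpre size leq) (undup s).
have s'P u : u \in s' <-> gw_alive m u /\ (size u <= t)%N.
  by rewrite mem_sort mem_undup.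
exists [seq (u, m u) | u <- s']; split.
  apply: parents_first_sorted.
  - by rewrite sort_uniq undup_uniq.
  - by apply: sort_sorted => u w; exact: leq_total.
  - move=> b i w /s'P[/andP[bw aw] wt]; split=> //; apply/s'P; split=> //.
    exact: ltnW.
move=> u j; split=> [/mapP[w /s'P[aw wt] [-> ->]]//|[au ut ->]].
by apply/mapP; exists u => //; exact/s'P.
Qed.

End interior.

(** * Recognizing a tree inside a hypergraph *)

Section capture.
Import boot.fintype boot.finset.
Variables (n d t : nat) (m : address d -> nat) (v : 'I_n).
Variable l : seq (address d * nat).
Hypothesis mt : prune t m = m.
Hypothesis lP : lists_interior t m l.
Implicit Types (u w : address d) (D E : {set {set 'I_n}}).

Lemma tree_explores D : tree v l D -> explores t m D v.
Proof.
have [el lE] := lP; move=> tD; have /and4P[/allP ln _ _ _] := tD.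
have m1 u : gw_alive m u -> (size u <= t.+1)%N by rewrite -mt alive_prune => /andP[].
split; first by apply/(prune_eqP mt) => u au ut; apply/eqP/(ln (u, m u)); exact/lE.
move=> u w au aw; apply: (tree_inj el tD).
  case: u au => [|[b i] u] au; apply/labelsP; [by left|right].
  have /andP[bu au'] := au; exists b, i, u, (m u); split=> //; apply/lE; split=> //.
  exact: m1 au.
case: w aw => [|[b i] w] aw; apply/labelsP; [by left|right].
have /andP[bw aw'] := aw; exists b, i, w, (m w); split=> //; apply/lE; split=> //.
exact: m1 aw.
Qed.

(** These are potential hyperedges, whether or not they occur. For a tree [D], the event
    [E :&: exposed D = D] prescribes all these coordinates: those of [D] are present, the rest
    absent. *)
Definition exposed D : {set {set 'I_n}} :=
  [set e : {set 'I_n} | (#|e| == d.+1) && touches v D l e].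

Lemma exposed_same D E : E :&: exposed D = D ->
  forall u, gw_alive m u -> (size u <= t)%N -> same_at d D E (vertex D v u).
Proof.
move=> ED u au ut e ed ue; rewrite -ED !inE ed eqxx /= andb_idr//= => _.
by apply/hasP; exists (u, m u) => //; exact/lP.2.
Qed.

Lemma exposed_explores D E : tree v l D -> E :&: exposed D = D -> explores t m E v.
Proof.
move=> /tree_explores tD ED; apply: explores_same tD; exact: exposed_same.
Qed.

(** Both [D] and [D'] have the same states as [E] at the interior labels, so their exposed sets
    coincide. Hence the events of distinct trees are disjoint and their probabilities add up. *)
Lemma exposed_inj D D' E : tree v l D -> tree v l D' ->
  E :&: exposed D = D -> E :&: exposed D' = D' -> D = D'.
Proof.
move=> tD tD' ED ED'; rewrite -ED -ED'; congr (_ :&: _).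
apply/setP => e; rewrite !inE; congr (_ && _); apply: eq_in_has => -[u j] ul /=.
have [au ut _] := (lP.2 u j).1 ul.
rewrite /vertex (explores_state (exposed_same ED) (tree_explores tD) au).
by rewrite (explores_state (exposed_same ED') (tree_explores tD') au).
Qed.

Lemma card_edges_at (x : 'I_n) :
  (#|[set e : {set 'I_n} | (#|e| == d.+1) && (x \in e)]| <= 'C(n.-1, d))%N.
Proof.
have := cards_draws (~: [set x]) d; rewrite (cardsCs (~: [set x])) setCK cards1 card_ord subn1 => <-.
set A := [set e | _]; have inj : {in A &, injective (fun e => e :\ x)}.
  move=> e e'; rewrite !inE => /andP[_ xe] /andP[_ xe'] ee.
  by rewrite -(setD1K xe) -(setD1K xe') ee.
rewrite -(card_in_imset inj); apply: subset_leq_card.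
apply/subsetP => e' /imsetP[e]; rewrite [e \in A]in_set => /andP[/eqP ed xe] ->.
rewrite inE; apply/andP; split; first by apply/subsetP => y; rewrite !inE => /andP[].
by move: ed; rewrite (cardsD1 x e) xe add1n => -[->].
Qed.

Lemma card_exposed D : (#|exposed D| <= size l * 'C(n.-1, d))%N.
Proof.
rewrite /exposed /touches; elim: (l) => [|p s IH] /=.
  by rewrite eq_card0// => e; rewrite !inE andbF.
rewrite mulSn; apply: leq_trans (leq_add (card_edges_at (vertex D v p.1)) IH).
apply: leq_trans (leq_card_setU _ _); apply: subset_leq_card.
by apply/subsetP => e; rewrite !inE => /andP[-> /=].
Qed.

End capture.

Local Open Scope ring_scope.

(** * Independent coordinates *)

Section expectation.
Import boot.fintype boot.finset.
Variables (R : realType) (T : finType) (p : R).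
Implicit Types (s : seq T) (E : {set T}) (f g : {set T} -> R).

(** The mean of [g] over a random subset of [s] that keeps each element independently with
    probability [p], in the form of conditioning on the head, which suits induction on the
    coordinates. *)
Fixpoint expect s g : R :=
  if s is x :: s' then p * expect s' (fun E => g (x |: E)) + (1 - p) * expect s' g
  else g set0.

Lemma expect_cst s c : expect s (fun=> c) = c.
Proof. by elim: s => //= x s ->; lra. Qed.

Lemma expectZ s c g : expect s (fun E => c * g E) = c * expect s g.
Proof. by elim: s g => //= x s IH g; rewrite !IH; lra. Qed.

Lemma expectD s f g : expect s (fun E => f E + g E) = expect s f + expect s g.
Proof. by elim: s f g => //= x s IH f g; rewrite !IH; lra. Qed.

Lemma eq_expect s f g : f =1 g -> expect s f = expect s g.
Proof. by move=> /funext->. Qed.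

Lemma expect_sum s (I : Type) (r : seq I) (P : pred I) (F : I -> {set T} -> R) :
  expect s (fun E => \sum_(i <- r | P i) F i E) = \sum_(i <- r | P i) expect s (F i).
Proof.
elim: r => [|i r IH].
  by rewrite big_nil -[RHS](expect_cst s 0); apply: eq_expect => E; rewrite big_nil.
rewrite big_cons -IH; case: ifP => Pi.
  by rewrite -expectD; apply: eq_expect => E; rewrite big_cons Pi.
by apply: eq_expect => E; rewrite big_cons Pi.
Qed.

Hypothesis p01 : 0 <= p <= 1.
Let p0 : 0 <= p. Proof. by case/andP: p01. Qed.
Let q0 : 0 <= 1 - p. Proof. by rewrite subr_ge0; case/andP: p01. Qed.

Lemma expect_le s f g : (forall E, E \subset [set x in s] -> f E <= g E) ->
  expect s f <= expect s g.
Proof.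
elim: s f g => [|x s IH] f g fg /=; first exact/fg/sub0set.
have sub E : E \subset [set x in s] -> E \subset [set y in x :: s].
  by move=> /subset_trans; apply; apply/subsetP => y; rewrite !inE => ->; rewrite orbT.
apply: lerD; apply: ler_wpM2l => //; apply: IH => E Es; apply: fg; last exact: sub.
by rewrite subUset sub1set inE mem_head /= sub.
Qed.

(** The exact value has, in place of [#|Q|], the number of elements of [Q] that lie in [s] and
    outside [D]; the larger exponent avoids this count. *)
Lemma expect_exposed s (D Q : {set T}) : uniq s -> D \subset Q -> D \subset [set x in s] ->
  p ^+ #|D| * (1 - p) ^+ #|Q| <= expect s (fun E => (E :&: Q == D)%:R).
Proof.
elim: s D Q => [|x s IH] D Q /=.
  move=> _ _; rewrite subset0 => /eqP->; rewrite cards0 expr0 mul1r set0I eqxx.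
  by rewrite exprn_ile1// gerBl.
move=> /andP[xs us] DQ Ds.
have xE E : E \subset [set x in s] -> x \notin E.
  by move=> /subsetP Es; apply: contra xs => /Es; rewrite inE.
have DsN : x \notin D -> D \subset [set x in s].
  move=> xD; apply/subsetP => y yD; move/subsetP/(_ y yD): Ds; rewrite !inE.
  by case/orP => // /eqP yx; move: xD; rewrite -yx yD.
case: (boolP (x \in Q)) => xQ; last first.
  have xD : x \notin D by apply: contra xQ; exact: (subsetP DQ).
  rewrite (_ : (fun E => ((x |: E) :&: Q == D)%:R) = (fun E => (E :&: Q == D)%:R)).
    by rewrite -mulrDl [p + _]addrC subrK mul1r; apply: IH => //; exact: DsN.
  apply/funext => E; congr (_ == _)%:R; apply/setP => y; rewrite !inE.
  by case: eqVneq => //= ->; rewrite (negbTE xQ) andbF.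
case: (boolP (x \in D)) => xD.
  apply: (@le_trans _ _ (p * expect s (fun E => (E :&: (Q :\ x) == D :\ x)%:R))).
    apply: (@le_trans _ _ (p * (p ^+ #|D :\ x| * (1 - p) ^+ #|Q :\ x|))); last first.
      apply: ler_wpM2l => //; apply: IH => //; first exact: setSD.
      apply/subsetP => y; rewrite !inE => /andP[yx yD].
      by move/subsetP/(_ y yD): Ds; rewrite !inE (negbTE yx).
    rewrite (cardsD1 x D) xD (cardsD1 x Q) xQ !exprS -mulrA.
    rewrite ler_wpM2l// ler_wpM2l ?exprn_ge0//.
    by rewrite ler_piMl ?exprn_ge0// gerBl.
  rewrite -[leLHS]addr0; apply: lerD; last first.
    by rewrite mulr_ge0// -(expect_cst s 0); apply: expect_le => E _; rewrite ler0n.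
  apply: ler_wpM2l => //; apply: expect_le => E _; rewrite ler_nat.
  case: eqP => // e; suff -> : (x |: E) :&: Q = D by rewrite eqxx.
  apply/setP => y; move/setP/(_ y): e; rewrite !inE.
  by case: (eqVneq y x) => //= -> _; rewrite xQ xD.
rewrite -[leLHS]add0r; apply: lerD.
  by rewrite mulr_ge0// -(expect_cst s 0); apply: expect_le => E _; rewrite ler0n.
apply: (@le_trans _ _ ((1 - p) * (p ^+ #|D| * (1 - p) ^+ #|Q :\ x|))).
  by rewrite (cardsD1 x Q) xQ exprS mulrCA.
apply: ler_wpM2l => //; apply: (le_trans (IH D (Q :\ x) us _ _)).
- by apply/subsetP => y yD; rewrite !inE (subsetP DQ _ yD) andbT; apply: contraNneq xD => <-.
- exact: DsN.
apply: expect_le => E Es; rewrite ler_nat.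
case: eqP => // e; suff -> : E :&: Q = D by rewrite eqxx.
apply/setP => y; move/setP/(_ y): e; rewrite !inE.
by case: (eqVneq y x) => //= -> _; rewrite (negbTE xD) (negbTE (xE _ Es)).
Qed.

(** From [expR (- y) >= 1 - y] one gets [expR y <= (1 - y)^-1], and (1 + y + 2y^2)(1 - y) = 1 + y^2
    (1 - 2y) is at least 1 when y <= 1/2. *)
Lemma expR_le2 (y : R) : y <= 2^-1 -> expR y <= 1 + y + 2 * y ^+ 2.
Proof.
move=> y2; have h := expR_ge1Dx (- y).
have y1 : 0 < 1 - y by rewrite subr_gt0; lra.
apply: (@le_trans _ _ (1 - y)^-1).
  by rewrite -[expR y]invrK -expRN lef_pV2 ?posrE ?expR_gt0//.
rewrite -[leLHS]mul1r ler_pdivrMr//.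
have -> : (1 + y + 2 * y ^+ 2) * (1 - y) = 1 + y ^+ 2 * (1 - 2 * y) by lra.
by rewrite lerDl mulr_ge0 ?sqr_ge0// subr_ge0; lra.
Qed.

Lemma expect_lip s f c : (forall x E, `|f (x |: E) - f E| <= c) ->
  forall x, `|expect s (fun E => f (x |: E)) - expect s f| <= c.
Proof.
move=> fc x; have := fun g h => @expect_le s g h.
have e : expect s (fun E => f (x |: E)) - expect s f = expect s (fun E => f (x |: E) - f E).
  by rewrite expectD; congr (_ + _); rewrite -mulN1r -expectZ; apply: eq_expect => E; rewrite mulN1r.
rewrite e ler_norml => le; apply/andP; split.
  by rewrite -[leLHS](expect_cst s); apply: le => E _; move: (fc x E); rewrite ler_norml => /andP[].
by rewrite -[leRHS](expect_cst s); apply: le => E _; move: (fc x E); rewrite ler_norml => /andP[].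
Qed.

(* Exponential moments tensorize: conditioning on one coordinate moves the mean
   by at most [c] and this coordinate has variance at most [p]. *)
Lemma expect_mgf s f c th : 0 <= th -> th * c <= 2^-1 ->
  (forall x E, `|f (x |: E) - f E| <= c) ->
  expect s (fun E => expR (- th * (f E - expect s f))) <=
    expR ((size s)%:R * (2 * p * (th * c) ^+ 2)).
Proof.
move=> th0 thc; elim: s f => [|x s IH] f fc /=.
  by rewrite subrr mulr0 mul0r.
have fc1 y E : `|f (x |: (y |: E)) - f (x |: E)| <= c by rewrite setUCA.
set f1 := fun E => f (x |: E); set a1 := expect s f1; set a0 := expect s f.
set a := p * a1 + (1 - p) * a0.
(* Moves the centre from the overall mean [a] to a conditional mean [b]. *)
have shift g b : expect s (fun E => expR (- th * (g E - a))) =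
    expR (- th * (b - a)) * expect s (fun E => expR (- th * (g E - b))).
  by rewrite -expectZ; apply: eq_expect => E; rewrite -expRD; congr expR; lra.
rewrite (shift f1 a1) (shift f a0).
set Y := expR ((size s)%:R * (2 * p * (th * c) ^+ 2)).
have I1 : expect s (fun E => expR (- th * (f1 E - a1))) <= Y by exact: IH.
have I0 : expect s (fun E => expR (- th * (f E - a0))) <= Y by exact: IH.
rewrite [leRHS](_ : _ = expR (2 * p * (th * c) ^+ 2) * Y); last first.
  by rewrite /Y -expRD; congr expR; rewrite -natr1; lra.
apply: (@le_trans _ _ (p * (expR (- th * (a1 - a)) * Y) + (1 - p) * (expR (- th * (a0 - a)) * Y))).
  by apply: lerD; apply: ler_wpM2l => //; apply: ler_wpM2l => //; exact: expR_ge0.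
rewrite (mulrA p) (mulrA (1 - p)) -mulrDl; apply: ler_wpM2r; first exact: expR_ge0.
apply: le_trans (expR_ge1Dx _).
set dl := a1 - a0; have dlc : `|dl| <= c by exact: expect_lip.
have e1 : - th * (a1 - a) = - (th * dl * (1 - p)) by rewrite /a /dl; lra.
have e0 : - th * (a0 - a) = th * dl * p by rewrite /a /dl; lra.
have c0 : 0 <= c by apply: le_trans dlc; exact: normr_ge0.
have [dl1 dl2] : - (th * c) <= th * dl /\ th * dl <= th * c.
  move: dlc; rewrite ler_norml => /andP[? ?].
  by split; [rewrite -mulrN|]; rewrite ler_wpM2l.
have p1 : p <= 1 by case/andP: p01.
have b1 := @expR_le2 (- (th * dl * (1 - p))) _.
have b0 := @expR_le2 (th * dl * p) _.
rewrite e1 e0.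
apply: (@le_trans _ _ (p * (1 + - (th * dl * (1 - p)) + 2 * (- (th * dl * (1 - p))) ^+ 2) +
   (1 - p) * (1 + th * dl * p + 2 * (th * dl * p) ^+ 2))).
  have tc0 : 0 <= th * c by exact: mulr_ge0.
  have hq q : 0 <= q -> q <= 1 -> `|th * dl * q| <= th * c.
    move=> qq0 qq1; rewrite normrM (ger0_norm qq0) -[leRHS]mulr1.
    by apply: ler_pM => //; rewrite ler_norml dl1 dl2.
  apply: lerD; apply: ler_wpM2l => //; [apply: b1|apply: b0]; apply: le_trans thc.
    by apply: le_trans (hq _ q0 _); rewrite ?gerBl// -normrN ler_norm.
  by apply: le_trans (hq _ p0 p1); rewrite ler_norm.
(* The first-order terms cancel because [a] averages [a1] and [a0] with weights p and 1-p. *)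
have -> : p * (1 + - (th * dl * (1 - p)) + 2 * (- (th * dl * (1 - p))) ^+ 2) +
   (1 - p) * (1 + th * dl * p + 2 * (th * dl * p) ^+ 2) =
   1 + 2 * p * ((1 - p) * (th * dl) ^+ 2) by lra.
rewrite lerD2l ler_wpM2l//; first by rewrite mulr_ge0.
have sq : (th * dl) ^+ 2 <= (th * c) ^+ 2 by nra.
by apply: le_trans sq; rewrite ler_piMl ?sqr_ge0// gerBl.
Qed.

(** Exponential Markov inequality: on the event, the variable of [expect_mgf] is at least
    [expR (th * r)]. *)
Lemma expect_lower_tail s f c th r : 0 <= th -> th * c <= 2^-1 ->
  (forall x E, `|f (x |: E) - f E| <= c) ->
  expect s (fun E => (f E <= expect s f - r)%R%:R) <=
    expR ((size s)%:R * (2 * p * (th * c) ^+ 2) - th * r).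
Proof.
move=> th0 thc fc; rewrite [X in expR X]addrC expRD.
apply: (@le_trans _ _ (expR (- (th * r)) * expect s (fun E => expR (- th * (f E - expect s f))))); last first.
  by rewrite ler_wpM2l ?expR_ge0// expect_mgf.
rewrite -expectZ; apply: expect_le => E _; rewrite -expRD.
case: (leP (f E) _) => h; last exact: expR_ge0.
rewrite -expR0 ler_expR; have : th * r <= th * (expect s f - f E).
  by rewrite ler_wpM2l// lerBrDr addrC -lerBrDr.
by rewrite mulNr -mulrN opprB; lra.
Qed.

End expectation.

(** * First moment *)

Definition edges n k : seq {set 'I_n} := enum [set e : {set 'I_n} | #|e| == k]%SET.

Lemma mem_edges n k (e : {set 'I_n}) : (e \in edges n k) = (#|e| == k).
Proof. by rewrite mem_enum finset.in_set. Qed.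

Lemma size_edges n k : size (edges n k) = 'C(n, k).
Proof. by rewrite -cardE card_draws card_ord. Qed.

Section mean.
Import boot.fintype boot.finset.
Variables (R : realType) (n d t : nat) (m : address d -> nat) (v : 'I_n).
Variable (l : seq (address d * nat)) (p : R).
Hypothesis d0 : (0 < d)%N.
Hypothesis mt : prune t m = m.
Hypothesis lP : lists_interior t m l.
Hypothesis p01 : 0 <= p <= 1.
Local Notation S := (sumn (unzip2 l)).

(** Sums the probabilities of the disjoint events [E :&: exposed D = D] over all trees [D]. Such a
    tree has 1 + d S vertices; the two factors tend to the powers of lam over factorials and to the
    exponentials in the Poisson weights. *)
Lemma mean_lower :
  ('C(n - (1 + d * S), d)%:R * p) ^+ S / (\prod_(q <- l) q.2`!)%:R *
    ((1 - p) ^+ 'C(n.-1, d)) ^+ size l <=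
  expect p (edges n d.+1) (fun E => (v \in explored t m E)%:R).
Proof.
have /andP[p0 p1] := p01.
have q0 : 0 <= 1 - p by rewrite subr_ge0.
set pr := (\prod_(q <- l) _)%N.
have pr0 : 0 < pr%:R :> R.
  by rewrite ltr0n /pr big_seq; apply: prodn_gt0 => q; exact: fact_gt0.
apply: (@le_trans _ _ (#|trees v l|%:R * (p ^+ S * (1 - p) ^+ (size l * 'C(n.-1, d))))).
  rewrite -exprM (mulnC 'C(_, _)) mulrA; apply: ler_wpM2r; first exact: exprn_ge0.
  rewrite exprMn -mulrAC; apply: ler_wpM2r; first exact: exprn_ge0.
  rewrite ler_pdivrMr// -natrX -natrM ler_nat.
  exact: (card_trees_ge v d0 lP.1 (leqnn _)).
apply: (@le_trans _ _ (expect p (edges n d.+1) (fun E => \sum_(D in trees v l)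
   (E :&: exposed v l D == D)%:R))).
  rewrite expect_sum -[#|_|%:R]sumr_const mulr_suml; apply: ler_sum => D.
  rewrite in_set => tD; rewrite mul1r.
  have /and4P[_ /forallP De _ /eqP sD] := tD.
  apply: (@le_trans _ _ (p ^+ #|D| * (1 - p) ^+ #|exposed v l D|)).
    rewrite sD ler_wpM2l ?exprn_ge0// ler_wiXn2l ?gerBl//.
    exact: (card_exposed v l D).
  apply: expect_exposed => //.
  - exact: enum_uniq.
  - by apply/subsetP => e eD; rewrite in_set; exact: (implyP (De e)).
  - apply/subsetP => e eD; rewrite in_set mem_edges.
    by have /andP[] := implyP (De e) eD.
apply: expect_le => // E _.
have [[D [tD ED]]|no] := pselect (exists D, D \in trees v l /\ E :&: exposed v l D = D).
  rewrite (bigD1 D)//= ED eqxx big1 ?addr0.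
    suff -> : v \in explored t m E by [].
    apply/exploredP; apply: (exposed_explores mt lP _ ED).
    by move: tD; rewrite in_set.
  move=> D' /andP[tD' DD']; case: eqP => // ED'; exfalso; move/eqP: DD'; apply.
  by apply: (exposed_inj mt lP _ _ ED' ED); [move: tD'|move: tD]; rewrite in_set.
rewrite big1 ?ler0n// => D tD; case: eqP => // ED; exfalso; apply: no.
by exists D.
Qed.

End mean.

Local Open Scope classical_set_scope.

Lemma ffact_le_exp n d : (n ^_ d <= n ^ d)%N.
Proof.
elim: d => // d IH; rewrite ffactnSr expnSr.
by apply: leq_mul => //; exact: leq_subr.
Qed.

Lemma ffact_ge_exp n d : ((n - d) ^ d <= n ^_ d)%N.
Proof.
suff h c : (c <= d -> (n - d) ^ c <= n ^_ c)%N by exact: h.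
elim: c => // c IH cd; rewrite ffactnSr expnSr.
by apply: leq_mul; [apply: IH; exact: ltnW|lia].
Qed.

(** * Poisson limit of the first moment *)

Section asymptotics.
Variable R : realType.

(** After multiplication by d!, the right side is a falling factorial at least (n-s-d)^d, and
    ['C(n.-1, d)] becomes one at most n^d. *)
Lemma bin_ratio (n d s : nat) : (0 < n)%N -> (s + d <= n)%N ->
  (1 - (s + d)%:R / n%:R) ^+ d * 'C(n.-1, d)%:R <= 'C(n - s, d)%:R :> R.
Proof.
move=> n0 sdn; have nR : 0 < n%:R :> R by rewrite ltr0n.
rewrite -(ler_pM2r (_ : 0 < d`!%:R)) ?ltr0n ?fact_gt0// -mulrA -!natrM !bin_ffact.
apply: (@le_trans _ _ ((n - s - d)%N%:R ^+ d)); last by rewrite -natrX ler_nat ffact_ge_exp.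
apply: (@le_trans _ _ ((1 - (s + d)%:R / n%:R) ^+ d * n%:R ^+ d)).
  rewrite ler_wpM2l//; last first.
    rewrite -natrX ler_nat; apply: leq_trans (ffact_le_exp _ _) _.
    by case: (d) => // d'; rewrite leq_exp2r// leq_pred.
  by rewrite exprn_ge0// subr_ge0 ler_pdivrMr// mul1r ler_nat.
rewrite -exprMn mulrBl mul1r divfK ?gt_eqF//.
by rewrite -natrB// subnDA.
Qed.

(** Crude linear growth, enough to force the edge probability to 0. *)
Lemma bin_ge (n d : nat) : (0 < d)%N -> (2 * d.+1 <= n)%N ->
  n%:R / (2 * d`!%:R) <= 'C(n.-1, d)%:R :> R.
Proof.
move=> d0 dn; rewrite ler_pdivrMr ?mulr_gt0 ?ltr0n ?fact_gt0//.
rewrite mulrCA -natrM bin_ffact -natrM ler_nat.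
apply: (@leq_trans (2 * (n.-1 - d) ^ d)%N); last by rewrite leq_mul2l ffact_ge_exp orbT.
apply: (@leq_trans (2 * (n.-1 - d))%N); first by lia.
by rewrite leq_mul2l /= -[X in (X <= _)%N]expn1 leq_pexp2l//; lia.
Qed.

(** This is [expR y >= 1 + y] at y = p/(1-p), where 1 + y = 1/(1-p). Since p C(n-1,d) = lam, the
    power C(n-1,d) of the left side is exactly exp(-lam/(1-p)). *)
Lemma expR_lower (p : R) : 0 <= p < 1 -> expR (- (p / (1 - p))) <= 1 - p.
Proof.
move=> /andP[p0 p1]; have q0 : 0 < 1 - p by rewrite subr_gt0.
rewrite expRN -[leRHS]invrK lef_pV2 ?posrE ?expR_gt0 ?invr_gt0//.
apply: le_trans (expR_ge1Dx _); have qn := lt0r_neq0 q0.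
have -> // : 1 + p / (1 - p) = (1 - p)^-1.
by apply: (mulIf qn); rewrite mulrDl divfK// mulVf// mul1r subrK.
Qed.

Lemma inv_cvg0 (c : R) : (c / n%:R) @[n --> \oo] --> (0 : R).
Proof.
rewrite -[X in _ --> X](mulr0 c); apply: cvgMl_tmp.
apply/gtr0_cvgV0; last exact: cvgr_idn.
by exists 1%N => // n /= n1; rewrite ltr0n.
Qed.

Lemma cvg_exprn (f : nat -> R) (a : R) k : f n @[n --> \oo] --> a ->
  f n ^+ k @[n --> \oo] --> a ^+ k.
Proof.
move=> fa; elim: k => [|k IH]; first exact: cvg_cst.
by rewrite exprS; under eq_cvg do rewrite exprS; exact: cvgM.
Qed.

Variables (lam : R) (d : nat) (p : nat -> R).
Hypothesis lam0 : 0 < lam.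
Hypothesis d0 : (0 < d)%N.
Hypothesis hp : \forall n \near \oo, 0 < p n <= 1 /\ ('C(n.-1, d))%:R * p n = lam.

Lemma edge_prob_cvg0 : p n @[n --> \oo] --> (0 : R).
Proof.
apply: (@squeeze_cvgr _ _ _ _ (fun=> 0) (fun n => (lam * (2 * d`!%:R)) / n%:R)); last 2 first.
- exact: cvg_cst.
- exact: inv_cvg0.
near=> n; have [/andP[p0 _] e] : 0 < p n <= 1 /\ ('C(n.-1, d))%:R * p n = lam by near: n.
have n0 : 0 < n%:R :> R by rewrite ltr0n; near: n; exists 1%N.
rewrite (ltW p0) /= ler_pdivlMr// -e.
have b : n%:R / (2 * d`!%:R) <= 'C(n.-1, d)%:R :> R.
  by apply: bin_ge => //; near: n; exists (2 * d.+1)%N.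
rewrite ler_pdivrMr ?mulr_gt0 ?ltr0n ?fact_gt0// in b.
by rewrite [X in _ <= X * _]mulrC -mulrA ler_wpM2l// ltW.
Unshelve. all: by end_near. Qed.

Definition poisson_weight (l : seq (address d * nat)) : R :=
  \prod_(q <- l) poisson_pmf lam q.2.

Lemma mean_limit (l : seq (address d * nat)) (eps : R) : 0 < eps ->
  \forall n \near \oo, poisson_weight l - eps <=
   ('C(n - (1 + d * sumn (unzip2 l)), d)%:R * p n) ^+ sumn (unzip2 l) /
     (\prod_(q <- l) q.2`!)%:R * ((1 - p n) ^+ 'C(n.-1, d)) ^+ size l.
Proof.
move=> eps0; set S := sumn _; set s := (1 + d * S)%N; set pr := (\prod_(q <- l) _)%N.
(* A smaller quantity that depends on n only through (s+d)/n and [p n], so its limit is explicit. *)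
pose LB n := ((1 - (s + d)%:R / n%:R) ^+ d * lam) ^+ S / pr%:R *
  expR (- (lam / (1 - p n))) ^+ size l.
have pr0 : 0 < pr%:R :> R.
  by rewrite ltr0n /pr big_seq; apply: prodn_gt0 => q; exact: fact_gt0.
have wE : poisson_weight l = lam ^+ S / pr%:R * expR (- lam) ^+ size l.
  rewrite /poisson_weight /S /pr; elim: (l) => [|q l' IH].
    by rewrite !big_nil /= !expr0 divr1 mulr1.
  rewrite !big_cons IH /= exprD natrM invfM exprS /poisson_pmf lam0.
  by lra.
have LBc : LB n @[n --> \oo] --> poisson_weight l.
  rewrite wE; apply: cvgM.
    apply: cvgMr_tmp; apply: cvg_exprn.
    rewrite -[X in _ --> X]mul1r; apply: cvgMr_tmp.
    rewrite -[X in _ --> X](expr1n _ d).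
    apply: cvg_exprn.
    rewrite -[X in _ --> X]subr0; apply: cvgB; [exact: cvg_cst|exact: inv_cvg0].
  apply: cvg_exprn.
  apply: (@continuous_cvg _ _ _ _ _ _ expR); first exact: continuous_expR.
  apply: cvgN; rewrite -[X in _ --> X]divr1; apply: cvgMl_tmp.
  apply: cvgV; first exact: oner_neq0.
  rewrite -[X in _ --> X]subr0; apply: cvgB; [exact: cvg_cst|exact: edge_prob_cvg0].
near=> n; apply: (@le_trans _ _ (LB n)).
  apply/ltW; near: n; apply: (cvgr_gt _ LBc); by rewrite ltrBlDr ltrDl.
have [/andP[p0 _] e] : 0 < p n <= 1 /\ ('C(n.-1, d))%:R * p n = lam by near: n.
have p1 : p n < 1 by near: n; apply: (cvgr_lt _ edge_prob_cvg0).
have n0 : (0 < n)%N by near: n; exists 1%N.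
have sn : (s + d <= n)%N by near: n; exists (s + d)%N.
have x1 : 0 <= 1 - (s + d)%:R / n%:R :> R.
  by rewrite subr_ge0 ler_pdivrMr ?ltr0n// mul1r ler_nat.
apply: ler_pM.
- by rewrite divr_ge0 ?(ltW pr0)// exprn_ge0// mulr_ge0 ?(ltW lam0)// exprn_ge0.
- by rewrite exprn_ge0// expR_ge0.
- rewrite ler_wpM2r ?invr_ge0 ?(ltW pr0)//; apply: lerXn2r.
  + by rewrite nnegrE mulr_ge0 ?(ltW lam0)// exprn_ge0.
  + by rewrite nnegrE mulr_ge0 ?(ltW p0).
  + by rewrite -e mulrA ler_wpM2r ?(ltW p0)//; exact: bin_ratio.
- apply: lerXn2r; rewrite ?nnegrE ?expR_ge0 ?exprn_ge0 ?subr_ge0 ?(ltW p1)//.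
  rewrite (_ : - (lam / (1 - p n)) = - (p n / (1 - p n)) * 'C(n.-1, d)%:R); last first.
    by rewrite -e; lra.
  rewrite expRM_natr; apply: lerXn2r; rewrite ?nnegrE ?expR_ge0 ?subr_ge0 ?(ltW p1)//.
  by apply: expR_lower; rewrite (ltW p0).
Unshelve. all: by end_near. Qed.

End asymptotics.

(** * Almost sure lower bounds *)

Section law.
Context {R : realType} {dsp : measure_display} {Omega : measurableType dsp}.
Variables (P : probability Omega R) (T : finType) (H : Omega -> {set T}) (p : R).

Let mixed (s1 s2 : seq T) : set Omega :=
  [set w | all (mem (H w)) s1 && all [predC H w] s2].

Let mixed_split s1 s2 x : mixed s1 s2 = mixed (x :: s1) s2 `|` mixed s1 (x :: s2).
Proof.
apply/seteqP; split=> w /=; rewrite /mixed /=; last first.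
  by case=> [/andP[/andP[_ ->] ->]|/andP[-> /andP[_ ->]]].
move=> /andP[-> ->]; case: (boolP (x \in H w)) => xH; [left|right]; rewrite ?andbT//.
Qed.

Let mixed_disj s1 s2 x : mixed (x :: s1) s2 `&` mixed s1 (x :: s2) = set0.
Proof.
rewrite -subset0 => w [/= /andP[/andP[h _] _] /andP[_ /andP[h' _]]].
by move/negP: h'; apply.
Qed.

Variable s : seq T.
Hypothesis us : uniq s.
Hypothesis mH : forall x, x \in s -> measurable [set w | x \in H w].
Hypothesis PH : forall s1, uniq s1 -> {subset s1 <= s} ->
  P [set w | all (mem (H w)) s1] = (p ^+ size s1)%:E.

Let m_mixed s1 s2 : {subset s1 <= s} -> {subset s2 <= s} -> measurable (mixed s1 s2).
Proof.
move=> h1 h2; rewrite (_ : mixed _ _ = (\big[setI/setT]_(x <- s1) [set w | x \in H w]) `&`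
   (\big[setI/setT]_(x <- s2) ~` [set w | x \in H w])).
  apply: measurableI; rewrite big_seq; apply: bigsetI_measurable => x.
    by move/h1; exact: mH.
  by move/h2 => ?; apply/measurableC/mH.
rewrite -!bigcap_seq; apply/seteqP; split=> w /=; rewrite /mixed /=.
  by move=> /andP[/allP a /allP b]; split=> x /= xs; [exact: a|apply/negP; exact: b].
by move=> [a b]; apply/andP; split; apply/allP => x xs; [exact: a|apply/negP; exact: b].
Qed.

(** The product rule is given for presences only; absences enter one at a time by subtracting the
    event that the element is present. *)
Let P_mixed s1 s2 : uniq (s1 ++ s2) -> {subset s1 ++ s2 <= s} ->
  P (mixed s1 s2) = (p ^+ size s1 * (1 - p) ^+ size s2)%:E.
Proof.
elim: s2 s1 => [|x s2 IH] s1 u12 s12.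
  rewrite cats0 in u12 s12; rewrite expr0 mulr1 -PH//; congr (P _).
  by apply/seteqP; split=> w; rewrite /mixed /= andbT.
have sub1 : {subset x :: s1 <= s}.
  by move=> y; rewrite inE => /orP[/eqP->|ys]; apply: s12; rewrite mem_cat ?mem_head ?orbT ?ys.
have sub2 : {subset x :: s2 <= s}.
  by move=> y ys; apply: s12; rewrite mem_cat ys orbT.
have u1 : uniq ((x :: s1) ++ s2) by rewrite -(perm_uniq (permEl (perm_catCA s1 [:: x] s2))).
have s1' : {subset (x :: s1) ++ s2 <= s}.
  move=> y; rewrite mem_cat => /orP[/sub1//|ys]; apply: sub2; by rewrite inE ys orbT.
have u2 : uniq (s1 ++ s2) by move: u1 => /andP[].
have s2' : {subset s1 ++ s2 <= s} by move=> y ys; apply: s1'; rewrite inE ys orbT.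
have m1 : measurable (mixed (x :: s1) s2).
  by apply: m_mixed => // y ys; apply: sub2; rewrite inE ys orbT.
have m2 : measurable (mixed s1 (x :: s2)).
  by apply: m_mixed => // y ys; apply: sub1; rewrite inE ys orbT.
have e : (P (mixed s1 s2) = P (mixed (x :: s1) s2) + P (mixed s1 (x :: s2)))%E.
  rewrite (mixed_split _ _ x) measureU//; exact: mixed_disj.
move: e; rewrite !IH// => e.
have fin : P (mixed s1 (x :: s2)) \is a fin_num by exact: fin_num_measure.
rewrite -(fineK fin) in e *; move: e; rewrite -EFinD => -[e]; congr (_%:E).
move: e; rewrite /= !exprS.
by set a := p ^+ _; set b := (1 - p) ^+ _ => e; lra.
Qed.

Lemma law_expect (A : pred {set T}) : (forall w, H w \subset [set x in s]%SET) ->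
  measurable [set w | A (H w)] /\
  P [set w | A (H w)] = (expect p s (fun E => (A E)%:R))%:E.
Proof.
move=> Hs.
(* [s1] collects the elements revealed as present, [s2] those revealed as absent, and [s'] is
   undecided; on [mixed s1 s2], [part s1 s' w] is [H w] as long as the three lists exhaust [s].
   Induction on [s'] follows the recursion of [expect]. *)
pose part (s1 s' : seq T) w := ([set x in s1] :|: (H w :&: [set x in s']))%SET.
suff step s1 s2 s' : uniq (s1 ++ s2 ++ s') -> {subset s1 ++ s2 ++ s' <= s} ->
   measurable [set w | mixed s1 s2 w /\ A (part s1 s' w)] /\
   P [set w | mixed s1 s2 w /\ A (part s1 s' w)] =
   (p ^+ size s1 * (1 - p) ^+ size s2 *
     expect p s' (fun E => (A ([set x in s1] :|: E)%SET)%:R))%:E.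
  have := step [::] [::] s us (fun _ h => h).
  rewrite (_ : [set w | _] = [set w | A (H w)]).
    rewrite !expr0 !mul1r; congr (_ /\ (_ = (expect _ _ _)%:E)).
    apply/funext => E; congr (A _)%:R; apply/setP => x; by rewrite !inE.
  have e w : part [::] s w = H w.
    apply/setP => x; rewrite !inE /=; case: (boolP (x \in H w)) => //= xH.
    by have := fintype.subsetP (Hs w) _ xH; rewrite inE.
  by apply/seteqP; split=> w /=; rewrite e /mixed /=; [case|].
elim: s' s1 s2 => [|x s' IH] s1 s2 u12 s12.
  have e w : part s1 [::] w = [set x in s1]%SET.
    by apply/setP => x; rewrite !inE /= andbF orbF.
  have e0 : ([set x in s1] :|: finset.set0 = [set x in s1])%SET by rewrite finset.setU0.
  rewrite cats0 in u12 s12; rewrite /= e0.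
  have sub1 : {subset s1 <= s} by move=> y ys; apply: s12; rewrite mem_cat ys.
  have sub2 : {subset s2 <= s} by move=> y ys; apply: s12; rewrite mem_cat ys orbT.
  case: (boolP (A [set x in s1]%SET)) => As.
    rewrite (_ : [set w | _] = mixed s1 s2).
      by rewrite mulr1; split; [exact: m_mixed|exact: P_mixed].
    by apply/seteqP; split=> w /=; rewrite e; [case|].
  rewrite (_ : [set w | _] = set0); first by rewrite mulr0 measure0.
  by rewrite -subset0 => w /= [_]; rewrite e; exact/negP.
have pm1 : perm_eq ((x :: s1) ++ s2 ++ s') (s1 ++ s2 ++ x :: s').
  by rewrite -cat1s -!catA perm_sym catA (perm_catCA _ [:: x] s') /= -!catA.
have pm2 : perm_eq (s1 ++ (x :: s2) ++ s') (s1 ++ s2 ++ x :: s').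
  by rewrite perm_cat2l perm_sym (perm_catCA s2 [:: x] s').
have [||m1 P1] := IH (x :: s1) s2; first by rewrite (perm_uniq pm1).
  by move=> y; rewrite (perm_mem pm1); exact: s12.
have [||m2 P2] := IH s1 (x :: s2); first by rewrite (perm_uniq pm2).
  by move=> y; rewrite (perm_mem pm2); exact: s12.
set M1 := [set w | mixed (x :: s1) s2 w /\ _] in m1 P1.
set M2 := [set w | mixed s1 (x :: s2) w /\ _] in m2 P2.
have -> : [set w | mixed s1 s2 w /\ A (part s1 (x :: s') w)] = M1 `|` M2.
  have p1 w : x \in H w -> part s1 (x :: s') w = part (x :: s1) s' w.
    move=> xH; apply/setP => y; rewrite !inE.
    by case: (eqVneq y x) => [->|] //=; rewrite xH orbT.
  have p2 w : x \notin H w -> part s1 (x :: s') w = part s1 s' w.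
    move=> xH; apply/setP => y; rewrite !inE.
    by case: (eqVneq y x) => [->|] //=; rewrite (negbTE xH).
  apply/seteqP; split=> w /=.
    rewrite (mixed_split _ _ x) => -[[h|h] a].
      left; split=> //; rewrite -p1//; by move: h => /andP[/andP[]].
    right; split=> //; rewrite -p2//; by move: h => /andP[_ /andP[]].
  rewrite (mixed_split _ _ x); case=> -[h a]; split; [by left| |by right|].
    rewrite p1//; by move: h => /andP[/andP[]].
  rewrite p2//; by move: h => /andP[_ /andP[]].
split; first exact: measurableU.
have -> : P (M1 `|` M2) = (P M1 + P M2)%E.
  rewrite measureU//; rewrite -subset0 => w [[h1 _] [h2 _]].
  by rewrite -(mixed_disj s1 s2 x).
rewrite P1 P2 -EFinD; congr (_%:E); rewrite /=.
rewrite (_ : (fun E => (A ([set x0 in x :: s1] :|: E)%SET)%:R) =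
   (fun E => (A ([set x0 in s1] :|: (x |: E))%SET)%:R)).
  by rewrite !exprS; lra.
apply/funext => E; congr (A _)%:R; apply/setP => y; rewrite !inE.
by rewrite orbCA orbA.
Qed.

End law.

Section almost_sure.
Context {R : realType} {dsp : measure_display} {Omega : measurableType dsp}.
Variable (P : probability Omega R).

Lemma random_hypergraph_law n k (p : R) (H : Omega -> {set {set 'I_n}})
    (A : pred {set {set 'I_n}}) : random_hypergraph P k p H ->
  measurable [set w | A (H w)] /\
  P [set w | A (H w)] = (expect p (edges n k) (fun E => (A E)%:R))%:E.
Proof.
case=> Hk HP Hi; apply: law_expect.
- exact: enum_uniq.
- by move=> e; rewrite mem_edges => /eqP /HP[].
- move=> s us sk.
  (* Independence is indexed by the subtype of k-sets, hence the lift through [insub]. *)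
  pose s' : seq {e : {set 'I_n} | #|e| == k} := pmap insub s.
  have vs : map val s' = s.
    rewrite /s' pmap_filter; last exact: insubK.
    apply/all_filterP/allP => e /sk; rewrite mem_edges => ek.
    by rewrite insubT.
  have us' : uniq s' by apply: pmap_sub_uniq.
  rewrite (_ : [set w | all (mem (H w)) s] = \bigcap_(i in [set` s']) [set w | val i \in H w]).
    rewrite Hi// -[in RHS]vs size_map.
    elim: (s') => [|e r IH]; first by rewrite big_nil.
    by rewrite big_cons IH exprS EFinM; have [_ ->] := HP (val e) (eqP (valP e)).
  rewrite -vs; apply/seteqP; split=> w /=.
    by rewrite all_map => /allP h e /= es; exact: h.
  by move=> h; rewrite all_map; apply/allP => e es; exact: h.
- move=> w; apply/fintype.subsetP => e eH; rewrite finset.in_set mem_edges.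
  by apply/eqP; exact: Hk eH.
Qed.

(** * Exponential concentration and Borel-Cantelli *)

Section concentration.
Variables (lam : R) (d t : nat) (m : address d -> nat) (l : seq (address d * nat)).
Variables (p : nat -> R) (H : forall n : nat, Omega -> {set {set 'I_n}}).
Hypothesis lam0 : 0 < lam.
Hypothesis d0 : (0 < d)%N.
Hypothesis mt : prune t m = m.
Hypothesis lP : lists_interior t m l.
Hypothesis hp : \forall n \near \oo, 0 < p n <= 1 /\ ('C(n.-1, d))%:R * p n = lam.
Hypothesis hH : \forall n \near \oo, random_hypergraph P d.+1 (p n) (H n).

Let K := (\max_(q <- l) q.2).+1.
(** The successor keeps [c] positive, as the choice of [th] below divides by it. *)
Let c : R := (lip_const t K (unzip1 l)).+1%:R.
Let c0 : 0 < c. Proof. by rewrite ltr0n. Qed.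

Let count_lip n (e : {set 'I_n}) E :
  `|#|explored t m (e |: E)%SET|%:R - #|explored t m E|%:R| <= c.
Proof.
have mK u : gw_alive m u -> (size u <= t)%N -> (m u < K)%N.
  move=> au ut; rewrite ltnS; have ul : (u, m u) \in l by exact/lP.2.
  exact: (@leq_bigmax_seq _ l xpredT (fun q => q.2) _ ul isT).
have usP u : gw_alive m u -> (size u <= t)%N -> u \in unzip1 l.
  by move=> au ut; apply/mem_unzip1; exists (m u); exact/lP.2.
have same e' : e' != e -> (e' \in (e |: E)%SET) = (e' \in E).
  by move=> ne; rewrite finset.in_setU1 (negbTE ne).
have h1 := card_explored_lip mK usP same.
have h2 := card_explored_lip mK usP (fun e' ne => esym (same e' ne)).
rewrite ler_distl lerBlDr /c -!natrD !ler_nat !addnS.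
by rewrite (leqW h1) (leqW h2).
Qed.

Let bad (eps : R) n : set Omega :=
  [set w | #|explored t m (H n w)|%:R <= n%:R * (poisson_weight lam l - eps)].

Let bad_bound eps : 0 < eps -> exists2 q : R, 0 <= q < 1 &
  \forall n \near \oo, measurable (bad eps n) /\ (P (bad eps n) <= (q ^+ n)%:E)%E.
Proof.
(* Half of [eps] absorbs the error of the mean, the other half is the deviation. *)
move=> eps0; pose h := eps / 2; have h0 : 0 < h by rewrite divr_gt0.
(* The first entry gives th c <= 1/2, as [expect_mgf] requires; the second keeps the quadratic term
   of the exponent below half of the linear term th h n. *)
pose th := Num.min (1 / (2 * c)) (h / (4 * lam * c ^+ 2)).
have th0 : 0 < th.
  by rewrite lt_min !divr_gt0 ?mulr_gt0 ?exprn_gt0.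
have thc : th * c <= 2^-1.
  rewrite -ler_pdivlMr// (_ : 2^-1 / c = 1 / (2 * c)); first by rewrite ge_min lexx.
  by rewrite invfM mul1r.
have the : 4 * lam * c ^+ 2 * th <= h.
  rewrite mulrC -ler_pdivlMr ?mulr_gt0 ?exprn_gt0//.
  by rewrite ge_min lexx orbT.
exists (expR (- (th * h / 2))).
  by rewrite expR_ge0/= expR_lt1 oppr_lt0 !mulr_gt0.
near=> n.
have [/andP[p0 p1] e] : 0 < p n <= 1 /\ ('C(n.-1, d))%:R * p n = lam by near: n.
have RH : random_hypergraph P d.+1 (p n) (H n) by near: n.
have n0 : (0 < n)%N by near: n; exists 1%N.
have p01 : 0 <= p n <= 1 by rewrite (ltW p0).
have [mB ->] := random_hypergraph_law (fun E : {set {set 'I_n}} =>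
  #|explored t m E|%:R <= n%:R * (poisson_weight lam l - eps)) RH.
split=> //; rewrite lee_fin.
pose f (E : {set {set 'I_n}}) : R := #|explored t m E|%:R.
have mean : n%:R * (poisson_weight lam l - h) <= expect (p n) (edges n d.+1) f.
  rewrite (_ : f = (fun E => \sum_(v : 'I_n) (v \in explored t m E)%:R)); last first.
    apply/funext => E; rewrite -natr_sum /f -sum1_card big_mkcond /=.
    by congr (_%:R); apply: eq_bigr => v _; case: (v \in _).
  rewrite expect_sum mulr_natl -[n in _ *+ n]card_ord -sumr_const; apply: ler_sum => v _.
  apply: le_trans (mean_lower v d0 mt lP p01).
  near: n; exact: mean_limit.
apply: (@le_trans _ _ (expect (p n) (edges n d.+1)
    (fun E => (f E <= expect (p n) (edges n d.+1) f - n%:R * h)%R%:R))).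
  apply: expect_le => // E _; rewrite ler_nat; set X := (X in (nat_of_bool X <= _)%N).
  case: (boolP X) => // le; suff -> : f E <= expect (p n) (edges n d.+1) f - n%:R * h by [].
  apply: le_trans le _; rewrite lerBrDr; apply: le_trans mean.
  by rewrite -mulrDr ler_wpM2l// /h; lra.
have tail := @expect_lower_tail R _ (p n) p01 (edges n d.+1) f c th (n%:R * h) (ltW th0) thc.
apply: (le_trans (tail _)); first by move=> x E; exact: count_lip.
rewrite -expRM_natr ler_expR size_edges.
(* As (d+1) C(n,d+1) = n C(n-1,d), the mean number of hyperedges is at most n lam, and the exponent
   is linear in n. *)
have bl : 'C(n, d.+1)%:R * p n <= n%:R * lam.
  rewrite -e mulrA; apply: ler_wpM2r; first exact: ltW.
  by rewrite -natrM ler_nat mul_bin_diag leq_pmull.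
have -> : 'C(n, d.+1)%:R * (2 * p n * (th * c) ^+ 2) =
  ('C(n, d.+1)%:R * p n) * (2 * (th * c) ^+ 2) by lra.
apply: (@le_trans _ _ ((n%:R * lam) * (2 * (th * c) ^+ 2) - th * (n%:R * h))).
  by rewrite lerD2r ler_wpM2r// mulr_ge0// sqr_ge0.
have -> : n%:R * lam * (2 * (th * c) ^+ 2) - th * (n%:R * h) =
  (th * (4 * lam * c ^+ 2 * th) / 2 - th * h) * n%:R by lra.
rewrite ler_wpM2r//.
have : th * (4 * lam * c ^+ 2 * th) <= th * h by rewrite ler_wpM2l// ltW.
by lra.
Unshelve. all: by end_near. Qed.

(** The bounds q^n are summable, so the first Borel-Cantelli lemma applies under every coupling of
    the [H n]. *)
Lemma ae_explored_lower (eps : R) : 0 < eps ->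
  {ae P, forall w, \forall n \near \oo,
    poisson_weight lam l - eps <= #|explored t m (H n w)|%:R / n%:R}.
Proof.
move=> eps0; have [q /andP[q0 q1] [N _ bd]] := bad_bound eps0.
pose B n := if (N <= n)%N then bad eps n else set0.
have mB n : measurable (B n).
  by rewrite /B; case: ifP => // /bd[].
have PB n : (P (B n) <= (q ^+ n)%:E)%E.
  rewrite /B; case: ifP => [/bd[]//|_]; by rewrite measure0 lee_fin exprn_ge0.
have sB : (\sum_(n <oo) P (B n) < +oo)%E.
  apply: (@le_lt_trans _ _ (\sum_(n <oo) (q ^+ n)%:E)%E).
    by apply: lee_nneseries => n _.
  have : (\sum_(0 <= i < n) (q ^+ i)%:E)%E @[n --> \oo] --> ((1 - q)^-1)%:E.
    under eq_cvg do rewrite sumEFin.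
    apply: cvg_EFin; first by near=> n.
    have := @cvg_geometric_series R 1 q; rewrite ger0_norm// => /(_ q1).
    rewrite mul1r; apply: cvg_trans; apply: near_eq_cvg; near=> n.
    by rewrite /series /geometric /=; apply: eq_bigr => i _; rewrite mul1r.
  by move=> /cvg_lim ->//; exact: ltry.
have := lim_sup_set_cvg0 mB sB => B0.
exists (lim_sup_set B); split=> //.
  by apply: bigcap_measurable => // k _; exact: bigcup_measurable.
move=> w; apply: contra_notP => /existsNP[k kw].
have {}kw : forall j, (k <= j)%N -> ~ B j w.
  by move=> j kj Bj; apply: kw => _; exists j.
exists (maxn 1 (maxn N k)) => // n /=; rewrite !geq_max => /and3P[n1 Nn kn].
have := kw n kn; rewrite /B Nn /bad /= => /negP; rewrite -ltNge => lt.
by rewrite ler_pdivlMr ?ltr0n// mulrC ltW.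
Unshelve. all: by end_near. Qed.

End concentration.
End almost_sure.

(** * Weak convergence *)

Section gw_cylinders.
Context {R : realType} {dsp : measure_display} {T : measurableType dsp}.
Variables (Q : probability T R) (d : nat) (lam : R).
Variable X : address d -> {RV Q >-> nat}.
Hypothesis Xp : forall v m, Q (X v @^-1` [set m]) = (poisson_pmf lam m)%:E.
Hypothesis Xi : independent_RVs X.
Variables (t : nat) (m : address d -> nat) (l : seq (address d * nat)).
Hypothesis mt : prune t m = m.
Hypothesis lP : lists_interior t m l.

Lemma gw_cylinderE : [set w | prune t (fun v => X v w) = m] =
  \bigcap_(u in [set` unzip1 l]) (X u @^-1` [set m u]).
Proof.
apply/seteqP; split=> w /=; rewrite (prune_eqP mt) => h u.
  by move=> /mem_unzip1[j /lP.2[au ut _]]; exact: h.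
by move=> au ut; apply: (h u); apply/mem_unzip1; exists (m u); apply/lP.2.
Qed.

Lemma gw_cylinder_measurable : measurable [set w | prune t (fun v => X v w) = m].
Proof.
rewrite gw_cylinderE bigcap_seq; apply: bigsetI_measurable => u _.
by rewrite -[X in measurable X]setTI; exact: measurable_funPT.
Qed.

Lemma gw_cylinder_prob :
  Q [set w | prune t (fun v => X v w) = m] = (poisson_weight lam l)%:E.
Proof.
rewrite gw_cylinderE (Xi (B := fun u => [set m u]))//; last exact: parents_first_uniq lP.1.
rewrite /unzip1 big_map /poisson_weight -[RHS]prodEFin.
by apply: eq_big_seq => -[u j] /lP.2[_ _ ->]; rewrite Xp.
Qed.

End gw_cylinders.

Section local_topology.
Context {R : realType}.

Lemma measurable_continuous (f : Gstar R -> R) : continuous f -> measurable_fun setT f.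
Proof.
move=> cf; apply: (measurability (RGenOpens.G (R:=R))); first exact: RGenOpens.measurableE.
move=> _ [_ [a [b ->]] <-]; rewrite setTI; apply: sub_sigma_algebra.
by apply: open_comp; [move=> x _; exact: cf|exact: interval_open].
Qed.

Lemma continuous_agree (f : Gstar R -> R) (x : Gstar R) (e : R) : continuous f -> 0 < e ->
  exists t, forall y, agree x y t -> `|f y - f x| < e.
Proof.
move=> cf e0; have /cvgrPdist_lt/(_ e e0)/nbhs_ballP[r /= r0 rP] := cf x.
have [t te] : exists t : nat, t.+1%:R^-1 < r.
  exists (Num.truncn r^-1); rewrite invf_plt ?posrE//; exact: truncnS_gt.
exists t => y xy; rewrite distrC; apply: rP; rewrite ballEmdist /=.
by apply: le_lt_trans te; exact/local_dist_le.
Qed.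

End local_topology.

Section unif_root_integral.
Context {R : realType}.

Lemma integral_unif_root (V : finType) (G : wgraph R V) (f : Gstar R -> R) :
  measurable_fun setT f -> (forall x, 0 <= f x) ->
  (\int[unif_root G]_x (f x)%:E = (#|vset G|%:R^-1 *
     \sum_(o : {o | o \in vset G}) f (rclass (rooted_component (valP o))))%:E)%E.
Proof.
move=> mf f0; pose pts := [seq rclass (rooted_component (valP o)) | o : {o | o \in vset G}].
pose c : {nonneg R} := NngNum (ltac:(by rewrite invr_ge0) : 0 <= #|vset G|%:R^-1 :> R).
pose mu i : {measure set Gstar R -> \bar R} := \d_(nth point pts i).
rewrite (eq_measure_integral (mscale c (msum mu (size pts)))); last first.
  move=> A _ _; rewrite /mscale /= /msum /unif_root; congr (_ * _)%E.
  transitivity (\sum_(x <- pts) (\d_x A : \bar R))%E; first by rewrite big_image.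
  by rewrite (big_nth point) big_mkord.
rewrite ge0_integral_mscale//; [|exact/measurable_EFinP|by move=> x _; rewrite lee_fin].
rewrite ge0_integral_measure_sum//; [|by move=> x _; rewrite lee_fin|exact/measurable_EFinP].
rewrite EFinM; congr (_ * _)%E.
rewrite (eq_bigr (fun i : 'I_(size pts) => (f (nth point pts i))%:E)); last first.
  move=> i _; rewrite integral_dirac//; last exact/measurable_EFinP.
  by rewrite diracT mul1e.
transitivity (\sum_(x <- pts) (f x)%:E)%E; first by rewrite (big_nth point) big_mkord.
by rewrite big_image /= sumEFin.
Qed.

Lemma root_line_graph n (E : {set {set 'I_n}}) (v : 'I_n) :
  [set v]%SET \in vset (@line_graph R 1 n E).
Proof. by rewrite inE /= cards1. Qed.

Definition vertex_class n (E : {set {set 'I_n}}) (v : 'I_n) : Gstar R :=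
  rclass (rooted_component (root_line_graph E v)).

Lemma integral_U1 n (E : {set {set 'I_n}}) (f : Gstar R -> R) :
  measurable_fun setT f -> (forall x, 0 <= f x) ->
  (\int[U_r 1 E]_x (f x)%:E = (n%:R^-1 * \sum_(v < n) f (vertex_class E v))%:E)%E.
Proof.
move=> mf f0; rewrite integral_unif_root//; congr (_%:E).
pose G := @line_graph R 1 n E.
pose h v : {S | S \in vset G} := exist _ [set v]%SET (root_line_graph E v).
have hb : bijective h.
  apply: inj_card_bij; first by move=> v w /(congr1 val)/finset.set1_inj.
  rewrite card_sig card_ord -[leqRHS]bin1 -[X in 'C(X, _)]card_ord -card_draws.
  by apply: subset_leq_card; apply/fintype.subsetP => S; rewrite !inE.
congr (_ * _).
  congr ((_%:R)^-1); apply: (etrans (esym (card_sig _))).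
  exact: (etrans (esym (bij_eq_card hb)) (card_ord n)).
rewrite (reindex h) /=; last exact: onW_bij.
by apply: eq_bigr => v _; congr (f (rclass (rooted_component _))); exact: bool_irrelevance.
Qed.

End unif_root_integral.

(** The limsup of the complements is empty, so the probabilities of their tail unions decrease to
    0. *)
Lemma measure_eventually_setC {R : realType} {dsp} {T : measurableType dsp}
    (Q : probability T R) (A : nat -> set T) (e : R) : 0 < e ->
  (forall n, measurable (A n)) -> (forall w, exists N, forall n, (N <= n)%N -> A n w) ->
  exists n, (Q (~` A n) <= e%:E)%E.
Proof.
move=> e0 mA ev; pose F n := ~` A n.
have mF n : measurable (F n) by exact: measurableC.
have mU n : measurable (\bigcup_(k >= n) F k) by exact: bigcup_measurable.
have L0 : Q (lim_sup_set F) = 0%E.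
  rewrite (_ : lim_sup_set F = set0) ?measure0// -subset0 => w Fw.
  have [N NA] := ev w; have [k /= Nk] := Fw N I; apply; exact: NA.
have c : Q (\bigcup_(k >= n) F k) @[n --> \oo] --> (0%E : \bar R).
  rewrite -L0; apply: (@lim_sup_set_cvg _ _ _ Q F mF).
  by apply: (@le_lt_trans _ _ 1%E); [exact: probability_le1|exact: ltry].
have nb : nbhs (0%E : \bar R) [set y | (y < e%:E)%E].
  by apply: open_nbhs_nbhs; split; [exact: open_ereal_lt_ereal|rewrite /= lte_fin].
have [N _ /(_ N (leqnn N)) /= h] := c _ nb.
exists N; apply: le_trans (ltW h); apply: le_measure; rewrite ?inE; [exact: mF|exact: mU|].
by move=> w Fw; exists N => //=.
Qed.

Lemma near_all (I : eqType) (s : seq I) (A : I -> nat -> Prop) :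
  (forall i, i \in s -> \forall n \near \oo, A i n) ->
  \forall n \near \oo, forall i, i \in s -> A i n.
Proof.
elim: s => [|i s IH] h; first by near=> n.
have hs : \forall n \near \oo, forall j, j \in s -> A j n.
  by apply: IH => j js; apply: h; rewrite inE js orbT.
have hi := h i (mem_head _ _).
near=> n => j; rewrite inE => /orP[/eqP->|js]; first by near: n.
by move: j js; near: n.
Unshelve. all: by end_near. Qed.

Section lookup.
Variables (d t : nat) (m : address d -> nat) (l : seq (address d * nat)).

(** The maximum over no entries is 0, the value that [prune] gives outside the interior. *)
Definition lookup (c : seq (address d * nat)) : address d -> nat :=
  fun u => (\max_(q <- c | q.1 == u) q.2)%N.

Lemma lookup_lists : prune t m = m -> lists_interior t m l -> lookup l = m.
Proof.
move=> mt [el lE]; apply/funext => u; apply/eqP; rewrite eqn_leq; apply/andP; split.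
  by apply/bigmax_leqP_seq => -[w j] /lE[_ _ /= ->] /eqP->.
rewrite -mt {1}/prune; case: ifP => // /andP[au ut].
have ul : (u, m u) \in l by exact/lE.
by have := @leq_bigmax_seq _ l (fun q => q.1 == u) (fun q => q.2) _ ul (eqxx _).
Qed.

(** An enumeration that reaches every truncated offspring function, so that almost sure statements
    about each of them hold almost surely for all at once. *)
Definition coded (i : nat) : address d -> nat :=
  if unpickle i is Some c then lookup c else fun=> 0%N.

End lookup.

Lemma coded_surj (R : realType) d t (m : address d -> nat) : prune t m = m ->
  exists i, @coded d i = m.
Proof.
move=> mt; have [l lP] := lists_interior_exists t m R.
exists (pickle l); rewrite /coded pickleK; exact: lookup_lists lP.
Qed.

(** * Lower semicontinuity of integrals along the sequence *)

Section lower_semicontinuity.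
Context {R : realType} {dsp : measure_display} {T : measurableType dsp}.
Variables (Q : probability T R) (d : nat).
Variable X : address d -> {RV Q >-> nat}.
Variable E : forall n : nat, {set {set 'I_n}}.
Hypothesis Ek : \forall n \near \oo, {in E n, forall e : {set 'I_n}, #|e| = d.+1}.
Let N w : address d -> nat := fun v => X v w.
Let cyl t m : set T := [set w | prune t (N w) = m].
Hypothesis EQ : forall t m, prune t m = m -> forall e : R, 0 < e ->
  \forall n \near \oo, fine (Q (cyl t m)) - e <= #|explored t m (E n)|%:R / n%:R.
Variables (g : Gstar R -> R) (M : R).
Hypothesis cg : continuous g.
Hypothesis gM : forall x, 0 <= g x <= M.

Let tree_class (m : address d -> nat) : Gstar R := rclass (gw_graph m).
Let M0 : 0 <= M. Proof. by have /andP[/le_trans] := gM point; apply. Qed.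

Let mcyl t m : measurable (cyl t m).
Proof.
have [mt|nmt] := pselect (prune t m = m); last first.
  rewrite (_ : cyl t m = set0)// -subset0 => w /= e; apply: nmt.
  by rewrite -e; apply/funext => u; exact: pruneK.
by have [l lP] := lists_interior_exists t m R; exact: gw_cylinder_measurable lP.
Qed.

Let agree_prune t w : agree (tree_class (prune t (N w))) (gw_class X w) t.
Proof.
apply: gw_agree => v av vt; rewrite pruneE//.
by move: av; rewrite alive_prune => /andP[].
Qed.

Let good (e : R) t (m : address d -> nat) := prune t m = m /\
  forall y, agree (tree_class m) y t -> `|g y - g (tree_class m)| <= e.

Let good_eventually e w : 0 < e ->
  exists t0, forall t, (t0 <= t)%N -> good e t (prune t (N w)).
Proof.
move=> e0; have e2 : 0 < e / 2 by rewrite divr_gt0.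
have [t0 h] := continuous_agree (gw_class X w) cg e2.
exists t0 => t t0t; split; first by apply/funext => u; exact: (pruneK t (N w) u).
(* Both [y] and the pruned tree are compared with the full tree of [w], at cost e/2 each. *)
move=> y ay; have h1 := h _ (agree_sym (agree_le t0t (agree_prune t w))).
have h2 := h _ (agree_trans (conj (agree_sym (agree_le t0t (agree_prune t w))) (agree_le t0t ay))).
apply/ltW; rewrite (splitr e); apply: le_lt_trans (ltrD h2 h1).
by rewrite [X in _ <= _ + X]distrC; exact: ler_distD.
Qed.

(** The depth in [good_eventually] depends on [w]. A depth [t] that is good outside probability e/2
    is fixed first; then finitely many of the countably many good [m] at this depth cover all but
    another e/2. This plays the role of tightness. *)
Let cover e : 0 < e -> exists t (F : seq (address d -> nat)),
  [/\ uniq F, forall m, m \in F -> good e t m &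
      (Q [set w | prune t (N w) \notin F] <= e%:E)%E].
Proof.
move=> e0; have e2 : 0 < e / 2 by rewrite divr_gt0.
pose A t := [set w | good e t (prune t (N w))].
pose D t j := [set w | exists2 i, (i < j)%N & good e t (@coded d i) /\ cyl t (@coded d i) w].
have mD t j : measurable (D t j).
  rewrite (_ : D t j = \bigcup_(i in [set i | (i < j)%N /\ good e t (@coded d i)]) cyl t (@coded d i)).
    by apply: bigcup_measurable => i [_ [mt _]]; exact: mcyl.
  by apply/seteqP; split=> w [i]; [move=> ij [? ?]; exists i|case=> ij ?; exists i].
have AE t : A t = \bigcup_j D t j.
  apply/seteqP; split=> w.
    move=> gw; have [i ci] := coded_surj R gw.1.
    by exists i.+1 => //; exists i => //; rewrite ci.
  by case=> j _ [i _ [gi /= ci]]; rewrite /A /= ci.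
have mA t : measurable (A t) by rewrite AE; exact: bigcup_measurable.
have [t At] := measure_eventually_setC Q e2 mA (fun w => good_eventually w e0).
have mB j : measurable (D t j `|` ~` A t) by apply: measurableU => //; exact: measurableC.
have evB w : exists j0, forall j, (j0 <= j)%N -> (D t j `|` ~` A t) w.
  have [Aw|nA] := pselect (A t w); last by exists 0%N => n _; right.
  move: (Aw); rewrite AE => -[j _ [i ij h]]; exists j => n jn; left.
  by exists i => //; exact: leq_trans ij jn.
have [j Bj] := measure_eventually_setC Q e2 mB evB.
exists t, (undup [seq @coded d i | i <- iota 0 j & `[< good e t (@coded d i) >]]).
set F := undup _.
have FP m : m \in F <-> exists2 i, (i < j)%N & good e t (@coded d i) /\ m = @coded d i.
  rewrite mem_undup; split=> [/mapP[i]|[i ij [gi ->]]].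
    by rewrite mem_filter mem_iota /= => /andP[/asboolP gi ij] ->; exists i.
  by apply: map_f; rewrite mem_filter mem_iota /=; apply/andP; split=> //; exact/asboolP.
split; first exact: undup_uniq.
  by move=> m /FP[i _ [gi ->]].
have DE : [set w | prune t (N w) \notin F] = ~` D t j.
  apply/seteqP; split=> w /=.
    by move=> /negP nF Dw; apply: nF; apply/FP; case: Dw => i ij [gi ci]; exists i.
  by move=> nD; apply/negP => /FP[i ij [gi ci]]; apply: nD; exists i.
rewrite DE; apply: (@le_trans _ _ (Q (~` A t `|` ~` (D t j `|` ~` A t)))).
  apply: le_measure; rewrite ?inE; first exact: measurableC.
    by apply: measurableU; apply: measurableC.
  move=> w nD; have [Aw|nA] := pselect (A t w); [right|by left].
  by case.
apply: (le_trans (measureU2 _ _ _)); [exact: measurableC|exact: measurableC|].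
by rewrite (splitr e) EFinD; exact: leeD.
Qed.

(** On the cylinder of an [m] in [F] the integrand is within e of its value at the tree [m];
    elsewhere it is at most M, on mass at most e. *)
Let gw_upper e t (F : seq (address d -> nat)) : 0 < e ->
  (forall m, m \in F -> good e t m) ->
  (Q [set w | prune t (N w) \notin F] <= e%:E)%E ->
  (\int[Q]_w (g (gw_class X w))%:E <=
    (\sum_(m <- F) fine (Q (cyl t m)) * g (tree_class m) + e + M * e)%:E)%E.
Proof.
move=> e0 gF QF; set C := [set w | _] in QF *.
have mC : measurable C.
  rewrite (_ : C = \big[setI/setT]_(m <- F) ~` cyl t m).
    by apply: bigsetI_measurable => m _; exact/measurableC/mcyl.
  rewrite -bigcap_seq; apply/seteqP; split=> w /=.
    by move=> nF m mF Nm; move/negP: nF; apply; rewrite Nm.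
  by move=> h; apply/negP => mF; exact: (h _ mF).
have g0 x : 0 <= g x by have /andP[] := gM x.
pose h m w : \bar R := ((g (tree_class m))%:E * (\1_(cyl t m) w)%:E)%E.
have h0 m w : (0 <= h m w)%E by rewrite mule_ge0 ?lee_fin ?g0.
have mh m : measurable_fun setT (h m).
  by apply: emeasurable_funM => //; apply/measurable_EFinP.
pose r w : \bar R := (M%:E * (\1_C w)%:E)%E.
have r0 w : (0 <= r w)%E by rewrite mule_ge0 ?lee_fin.
have mr : measurable_fun setT r by apply: emeasurable_funM => //; apply/measurable_EFinP.
have mg : measurable_fun setT (fun w => (g (gw_class X w))%:E).
  apply/measurable_EFinP; apply: (measurableT_comp (measurable_continuous cg)).
  exact: measurable_gw_class.
pose s w : \bar R := (\sum_(m <- F) h m w)%E.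
have s0 w : (0 <= s w)%E by exact: sume_ge0.
have ms : measurable_fun setT s by exact: emeasurable_sum.
have se0 w : (0 <= s w + e%:E)%E by rewrite adde_ge0// lee_fin ltW.
have mse : measurable_fun setT (fun w => s w + e%:E)%E by exact: emeasurable_funD.
have mser : measurable_fun setT (fun w => s w + e%:E + r w)%E by exact: emeasurable_funD.
apply: (@le_trans _ _ (\int[Q]_w (s w + e%:E + r w))%E).
  apply: (ge0_le_integral _ measurableT _ mg mser); first by move=> w _; rewrite lee_fin.
  move=> w _; have [wF|wF] := boolP (prune t (N w) \in F); last first.
    have cw : C w by [].
    rewrite (le_trans (_ : _ <= r w)%E)//; last by rewrite leeDr.
    by rewrite /r indicE mem_set// mule1 lee_fin; have /andP[] := gM (gw_class X w).
  apply: (@le_trans _ _ (h (prune t (N w)) w + e%:E)%E).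
    rewrite /h indicE mem_set//= mule1 -EFinD lee_fin -lerBlDl.
    apply: le_trans (ler_norm _) _; have [_ gd] := gF _ wF; apply: gd.
    exact: agree_prune.
  rewrite -[leLHS]adde0; apply: leeD => //; apply: leeD => //.
  by rewrite /s (big_rem _ wF) /= leeDl// sume_ge0.
rewrite (ge0_integralD _ measurableT (fun w _ => se0 w) mse (fun w _ => r0 w) mr).
rewrite (ge0_integralD _ measurableT (fun w _ => s0 w) ms (fun w _ => _))//; last by rewrite lee_fin ltW.
rewrite ge0_integral_sum// integral_cst//= probability_setT mule1 !EFinD.
apply: leeD; [apply: leeD => //|].
  rewrite -sumEFin; apply: lee_sum => m _.
  rewrite /h ge0_integralZl_EFin//; last first.
  - exact/measurable_EFinP.
  rewrite integral_indic// setIT EFinM fineK ?fin_num_measure// muleC.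
  exact: lexx.
rewrite /r ge0_integralZl_EFin//; last exact/measurable_EFinP.
by rewrite integral_indic// setIT EFinM lee_wpmul2l// lee_fin.
Qed.

(** Roots whose exploration lies in [F] contribute nearly the value at their tree; all other roots
    contribute at least 0, so they need no count. *)
Let U1_lower e e' t (F : seq (address d -> nat)) n : 0 < e -> 0 <= e' -> (0 < n)%N ->
  {in E n, forall e : {set 'I_n}, #|e| = d.+1} -> uniq F ->
  (forall m, m \in F -> good e t m) ->
  (forall m, m \in F ->
     fine (Q (cyl t m)) - e' <= #|explored t m (E n)|%:R / n%:R) ->
  ((\sum_(m <- F) fine (Q (cyl t m)) * g (tree_class m) - e' * M *+ size F - e)%:E <=
   \int[U_r 1 (E n)]_x (g x)%:E)%E.
Proof.
move=> e0 e'0 n0 En uF gF lF.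
have g0 x : 0 <= g x by have /andP[] := gM x.
rewrite (integral_U1 (E n) (measurable_continuous cg) g0) lee_fin.
have nR : 0 < n%:R :> R by rewrite ltr0n.
pose b (m : address d -> nat) (v : 'I_n) : R := (v \in explored t m (E n))%:R.
have b0 m v : 0 <= b m v by rewrite ler0n.
have bsum v : \sum_(m <- F) b m v <= 1.
  (* A root has a single exploration, so the events of distinct [m] exclude each other. *)
  have [/hasP[m mF mv]|/hasPn no] := boolP (has (fun m => v \in explored t m (E n)) F).
    rewrite (big_rem _ mF) /= big_seq big1 ?addr0; first by rewrite /b mv.
    move=> m'; rewrite mem_rem_uniq// inE => /andP[mm' _]; rewrite /b.
    case: (boolP (v \in _)) => // m'v; exfalso; move/negP: mm'; apply; apply/eqP.
    by move/exploredP: mv => [<- _]; move/exploredP: m'v => [<- _].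
  by rewrite big_seq big1// => m /no mv; rewrite /b (negbTE mv).
have cb m : \sum_v b m v = #|explored t m (E n)|%:R.
  rewrite -natr_sum -sum1_card [in RHS]big_mkcond /=.
  by congr (_%:R); apply: eq_bigr => v _; case: (v \in _).
have S1 : \sum_(m <- F) #|explored t m (E n)|%:R * (g (tree_class m) - e) <=
    \sum_(v < n) g (vertex_class (E n) v).
  apply: (@le_trans _ _ (\sum_(v < n) \sum_(m <- F) b m v * (g (tree_class m) - e))).
    rewrite exchange_big /=; apply: ler_sum => m _.
    by rewrite -cb mulr_suml.
  apply: ler_sum => v _; apply: (@le_trans _ _ (\sum_(m <- F) b m v * g (vertex_class (E n) v))).
    rewrite big_seq [leRHS]big_seq; apply: ler_sum => m mF; rewrite /b.
    case: (boolP (v \in _)) => mv; last by rewrite !mul0r.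
    rewrite !mul1r lerBlDr -lerBlDl.
    have [_ gd] := gF _ mF; apply: le_trans (ler_norm _) _; rewrite distrC; apply: gd.
    by apply: agree_sym; move/exploredP: mv => mv; exact: explores_agree.
  by rewrite -mulr_suml ler_piMl.
have S2 : \sum_(m <- F) #|explored t m (E n)|%:R <= n%:R :> R.
  under eq_bigr do rewrite -cb.
  rewrite exchange_big /= -[n in leRHS]card_ord -sumr_const.
  by apply: ler_sum => v _; exact: bsum.
apply: (@le_trans _ _ (n%:R^-1 * \sum_(m <- F) #|explored t m (E n)|%:R * (g (tree_class m) - e))).
  have -> : n%:R^-1 * (\sum_(m <- F) #|explored t m (E n)|%:R * (g (tree_class m) - e)) =
     \sum_(m <- F) (#|explored t m (E n)|%:R / n%:R) * g (tree_class m) -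
     e * ((\sum_(m <- F) #|explored t m (E n)|%:R) / n%:R).
    rewrite mulr_suml !mulr_sumr -sumrB; apply: eq_bigr => m _; lra.
  apply: lerB; last first.
    by rewrite -[leRHS]mulr1 ler_wpM2l ?(ltW e0)// ler_pdivrMr// mul1r.
  rewrite -[size F]count_predT -sum1_count -sumrMnr -sumrB big_seq [leRHS]big_seq.
  apply: ler_sum => m mF; rewrite mulr1n.
  have := lF m mF; set a := fine _; set a' := _ / _ => aa.
  have /andP[x0 xM] := gM (tree_class m).
  apply: (@le_trans _ _ ((a - e') * g (tree_class m))); last by rewrite ler_wpM2r.
  by rewrite mulrBl lerB// ler_wpM2l.
by rewrite ler_wpM2l// invr_ge0.
Qed.

Lemma U1_liminf (eps : R) : 0 < eps -> \forall n \near \oo,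
  (\int[Q]_w (g (gw_class X w))%:E <= \int[U_r 1 (E n)]_x (g x)%:E + eps%:E)%E.
Proof.
(* The errors add up to (M + 3) e: e + M e from [gw_upper], e from the oscillation of [g] at
   explored roots, and e from [e' * M *+ size F]. *)
move=> eps0; have M3 : 0 < M + 3 by rewrite ltr_wpDl.
pose e := eps / (M + 3); have e0 : 0 < e by rewrite divr_gt0.
have [t [F [uF gF QF]]] := cover e0.
have M1 : 0 < M * (size F)%:R + 1 by rewrite ltr_wpDl// mulr_ge0.
pose e' := e / (M * (size F)%:R + 1); have e'0 : 0 < e' by rewrite divr_gt0.
have lF : \forall n \near \oo, forall m, m \in F ->
    fine (Q (cyl t m)) - e' <= #|explored t m (E n)|%:R / n%:R.
  by apply: near_all => m /gF[mt _]; exact: EQ.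
near=> n.
have n0 : (0 < n)%N by near: n; exists 1%N.
have low := @U1_lower e e' t F n e0 (ltW e'0) n0 _ uF gF _.
apply: le_trans (gw_upper e0 gF QF) _.
apply: (@le_trans _ _ ((\sum_(m <- F) fine (Q (cyl t m)) * g (tree_class m) - e' * M *+ size F - e)%:E + eps%:E)%E).
  rewrite -EFinD lee_fin -[_ *+ size F]mulr_natr.
  have h1 : e' * M * (size F)%:R <= e.
    rewrite -mulrA /e' mulrAC ler_pdivrMr// ler_wpM2l ?(ltW e0)//; lra.
  have h2 : e * (M + 3) = eps by rewrite /e divfK// gt_eqF.
  lra.
by rewrite leeD2r//; apply: low; near: n.
Unshelve. all: by end_near. Qed.

End lower_semicontinuity.

(** * Shifting bounded functions *)

Section shift.
Context {R : realType}.
Variables (mu : {measure set (Gstar R) -> \bar R}) (f : Gstar R -> R) (M : R).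
Hypothesis mu1 : mu setT = 1%E.
Hypothesis mf : measurable_fun setT f.
Hypothesis fM : forall x, `|f x| <= M.

Let finmu : (mu setT < +oo)%E. Proof. by rewrite mu1 ltry. Qed.

Lemma bounded_integrable : mu.-integrable setT (EFin \o f).
Proof.
apply: measurable_bounded_integrable => //.
exists M; split; first exact: num_real.
by move=> x Mx y _; apply: le_trans (fM y) (ltW Mx).
Qed.

Lemma cst_integrable : mu.-integrable setT (EFin \o cst M).
Proof.
apply: measurable_bounded_integrable => //.
exists `|M|; split; first exact: num_real.
by move=> x Mx y _ /=; exact: ltW.
Qed.

Let cstM : (\int[mu]_x M%:E = M%:E)%E.
Proof. by rewrite integral_cst// mu1 mule1. Qed.

Lemma integral_addM : (\int[mu]_x (f x + M)%:E = \int[mu]_x (f x)%:E + M%:E)%E.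
Proof.
under eq_integral do rewrite EFinD.
rewrite (integralD_EFin _ bounded_integrable cst_integrable)//.
by congr (_ + _)%E; exact: cstM.
Qed.

Lemma integral_subM : (\int[mu]_x (M - f x)%:E = M%:E - \int[mu]_x (f x)%:E)%E.
Proof.
under eq_integral do rewrite EFinB.
rewrite (integralB_EFin _ cst_integrable bounded_integrable)//.
by congr (_ - _)%E; exact: cstM.
Qed.

End shift.

Lemma U1_setT (R : realType) n (E : {set {set 'I_n}}) : (0 < n)%N ->
  @U_r R 1 n E setT = 1%E.
Proof.
move=> n0; have e : (\int[U_r 1 E]_x 1%:E = @U_r R 1 n E setT)%E.
  by rewrite integral_cst// mul1e.
rewrite -e; apply: etrans (integral_U1 E (measurable_cst (1 : R)) (fun _ => ler01)) _.
by rewrite sumr_const card_ord mulVf// pnatr_eq0 -lt0n.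
Qed.

Theorem theorem3p1 (R : realType) (lam : R) (hlam : 0 < lam)
    (k : nat) (hk : (2 <= k)%N)
    (d : measure_display) (Omega : measurableType d) (P : probability Omega R)
    (p : nat -> R) (H : forall n : nat, Omega -> {set {set 'I_n}})
    (hp : \forall n \near \oo,
       0 < p n <= 1 /\ ('C(n.-1, k.-1))%:R * p n = lam)
    (hH : \forall n \near \oo, random_hypergraph P k (p n) (H n))
    (nu : probability (Gstar R) R) (hnu : gw_law k.-1 lam nu) :
  {ae P, forall w, local_weak_limit 1 (fun n => H n w) nu}.
Proof.
case: k hk hp hH hnu => // d' hk hp hH [disp [T [Q [X [Xp Xi nuE]]]]] /=.
have d0 : (0 < d')%N by rewrite ltnS in hk.
(* Depth, exploration and precision are indexed by natural numbers, so only countably many null sets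
   are discarded. *)
have ev : \forall w \ae P, forall t i j, prune t (@coded d' i) = coded i ->
    \forall n \near \oo, fine (Q [set w' | prune t (fun v => X v w') = @coded d' i]) -
      j.+1%:R^-1 <= #|explored t (@coded d' i) (H n w)|%:R / n%:R.
  apply: ae_foralln => t; apply: ae_foralln => i; apply: ae_foralln => j.
  have [mt|nmt] := pselect (prune t (@coded d' i) = coded i); last exact: aeW.
  have [l lP] := lists_interior_exists t (@coded d' i) R.
  rewrite (gw_cylinder_prob Xp Xi mt lP) /=.
  have j0 : 0 < j.+1%:R^-1 :> R by rewrite invr_gt0.
  by apply: filterS (ae_explored_lower hlam d0 mt lP hp hH j0) => w h _.
apply: filterS ev => w ev f cf [] M fM.
have Ek : \forall n \near \oo, {in H n w, forall e : {set 'I_n}, #|e| = d'.+1}.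
  by near=> n; have [] : random_hypergraph P d'.+1 (p n) (H n) by near: n.
have EQ t (m : address d' -> nat) : prune t m = m -> forall e : R, 0 < e ->
  \forall n \near \oo, fine (Q [set w' | prune t (fun v => X v w') = m]) - e <=
      #|explored t m (H n w)|%:R / n%:R.
  move=> mt e e0; have [i mi] := coded_surj R mt; subst m.
  have [j je] : exists j : nat, j.+1%:R^-1 < e.
    by exists (Num.truncn e^-1); rewrite invf_plt ?posrE//; exact: truncnS_gt.
  by apply: filterS (ev t i j mt) => n; apply: le_trans; rewrite lerD2l lerN2 ltW.
have mf := measurable_continuous cf.
have fM' x : - M <= f x <= M by rewrite -ler_norml.
have g1 x : 0 <= f x + M <= 2 * M by have /andP[] := fM' x; lra.
(* This second function turns the lower bound into an upper bound for [f]. *)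
have g2 x : 0 <= M - f x <= 2 * M by have /andP[] := fM' x; lra.
have c1 : continuous (fun x => f x + M) by move=> x; exact: (cvgD (cf x) (cvg_cst M)).
have c2 : continuous (fun x => M - f x) by move=> x; exact: (cvgB (cvg_cst M) (cf x)).
have nuQ (g : Gstar R -> R) : measurable_fun setT g -> (forall x, 0 <= g x) ->
    (\int[nu]_x (g x)%:E = \int[Q]_w' (g (gw_class X w'))%:E)%E.
  move=> mg g0; rewrite (eq_measure_integral (distribution Q (gw_class X))); last first.
    by move=> A mA _; exact: nuE.
  by rewrite ge0_integral_distribution//; exact/measurable_EFinP.
have nu1 : nu setT = 1%E by exact: probability_setT.
set I := (\int[nu]_x (f x)%:E)%E.
have If : I \is a fin_num by apply: integrable_fin_num => //; exact: bounded_integrable fM.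
have key (eps : R) : 0 < eps -> \forall n \near \oo,
   (\int[U_r 1 (H n w)]_x (f x)%:E \is a fin_num)%E /\
   `|fine I - fine (\int[U_r 1 (H n w)]_x (f x)%:E)%E| <= eps.
  move=> eps0.
  have l1 := U1_liminf Ek EQ c1 g1 eps0.
  have l2 := U1_liminf Ek EQ c2 g2 eps0.
  near=> n; have n0 : (0 < n)%N by near: n; exists 1%N.
  have U1 : U_r 1 (H n w) setT = 1%E :> \bar R by exact: U1_setT.
  have Jf : (\int[U_r 1 (H n w)]_x (f x)%:E \is a fin_num)%E.
    by apply: integrable_fin_num => //; exact: bounded_integrable fM.
  split=> //.
  have : (\int[Q]_w' (f (gw_class X w') + M)%:E <=
     \int[U_r 1 (H n w)]_x (f x + M)%:E + eps%:E)%E by near: n.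
  have : (\int[Q]_w' (M - f (gw_class X w'))%:E <=
     \int[U_r 1 (H n w)]_x (M - f x)%:E + eps%:E)%E by near: n.
  rewrite -(nuQ (fun x => f x + M)); [|exact: measurable_continuous|by move=> x; case/andP: (g1 x)].
  rewrite -(nuQ (fun x => M - f x)); [|exact: measurable_continuous|by move=> x; case/andP: (g2 x)].
  rewrite !(integral_addM _ mf fM)// !(integral_subM _ mf fM)// -/I.
  rewrite -(fineK If) -(fineK Jf) -!EFinD !lee_fin /= => h2 h1.
  by rewrite ler_norml; apply/andP; split; lra.
rewrite -(fineK If); apply/fine_cvgP; split.
  by apply: filterS (key 1 ltr01) => n [].
apply/cvgrPdist_le => eps eps0.
by apply: filterS (key eps eps0) => n [_].
Unshelve. all: by end_near. Qed.
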